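(* Let $\Omega\subset\mathbb{R}^n$ be a bounded connected open set with smooth boundary. Let $f\in W^{1,n}(\Omega;\mathbb{R}^{n+1})$ with $\nabla f$ of full rank a.e., and such that $\nu_f\in W^{1,n}(\Omega;S^n)$. Then, for some (small) $d$ with $0<d<1$, the function $\tilde F:\Omega\times(-d,d)\to\mathbb{R}^{n+1}$ given by $$\tilde F(x,t)=f(x)+t\,\nu_f(x)$$ satisfies $$\tilde F\in VMO(\Omega\times(-d,d);\mathbb{R}^{n+1})\cap W^{1,n}(\Omega\times(-d,d);\mathbb{R}^{n+1})\quad\text{and}\quad \det\nabla\tilde F\in L^1(\Omega\times(-d,d);\mathbb{R}).$$
   Context: $S^n$ is the unit sphere of $\mathbb{R}^{n+1}$, and $\nu_f(x)\in S^n$ is the unit normal to $f(\Omega)$ at $f(x)$, i.e. a unit vector orthogonal to $\partial_1f(x),\dots,\partial_nf(x)$ (for a choice of sign), defined for a.e. $x$. For a bounded open set $O\subset\mathbb{R}^m$ and $h\in L^1_{loc}(O)$ (vector valued), let $\bar h_\epsilon(x)$ be the average of $h$ over the ball $B_\epsilon(x)$ and $\|h\|_{BMO(O)}=\sup\frac{1}{\lambda_m(B_\epsilon(x))}\int_{B_\epsilon(x)}|h(y)-\bar h_\epsilon(x)|\,dy$, the supremum over $x\in O$ and $0<\epsilon<\operatorname{dist}(x,\partial O)$, where $\lambda_m$ is Lebesgue measure. $BMO(O)$ is the set of $h$ with finite seminorm, and $VMO(O)$ is the closure of $C(\overline O)$ in the BMO seminorm. *)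

(* Defs.v *)
From HB Require Import structures.
From mathcomp Require Import all_boot all_order all_algebra.
From mathcomp Require Import all_classical all_reals all_analysis.

Set Implicit Arguments.
Unset Strict Implicit.
Unset Printing Implicit Defensive.

Import Order.TTheory GRing.Theory Num.Theory.
Import numFieldNormedType.Exports.

Local Open Scope classical_set_scope.
Local Open Scope ring_scope.

(* The product sigma-algebra on ['rV[R]_m], generated by the coordinates; it is
   the Borel sigma-algebra by [measurable_rV_open]. *)
Section measurable_rV.
Context {R : realType} (m : nat).

Let coor (i : 'I_m) (x : 'rV[R]_m) : R := x 0 i.

Let rV_set0 : g_sigma_preimage coor set0.
Proof. exact: sigma_algebra0. Qed.

Let rV_setC A : g_sigma_preimage coor A -> g_sigma_preimage coor (~` A).
Proof. exact: sigma_algebraC. Qed.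

Let rV_bigcup (F : (set 'rV[R]_m)^nat) :
  (forall i, g_sigma_preimage coor (F i)) ->
  g_sigma_preimage coor (\bigcup_i F i).
Proof. exact: sigma_algebra_bigcup. Qed.

HB.instance Definition _ := @isMeasurable.Build default_measure_display
  'rV[R]_m (g_sigma_preimage coor) rV_set0 rV_setC rV_bigcup.

Lemma measurable_coor (i : 'I_m) :
  measurable_fun [set: 'rV[R]_m] (fun x : 'rV[R]_m => x 0 i).
Proof.
move=> _ Y mY; rewrite setTI; apply: sub_sigma_algebra.
rewrite -bigcup_seq/=; exists i => /=; first by rewrite mem_index_enum.
by exists Y => //; rewrite setTI.
Qed.

Lemma measurable_fun_rV d (T : measurableType d) (f : T -> 'rV[R]_m) :
  (forall i, measurable_fun setT (fun x => f x 0 i)) -> measurable_fun setT f.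
Proof.
move=> mf _ Y mY; rewrite setTI.
have /= := mY (fun Y => measurable (f @^-1` Y)).
apply; split.
  split => /=.
  - exact: measurable0.
  - by move=> A mA; rewrite setTD preimage_setC; exact: measurableC.
  - by move=> F mF; rewrite preimage_bigcup; exact: bigcupT_measurable.
move=> A; rewrite -bigcup_seq => -[i _ [B mB <-]] /=.
by rewrite setTI -[X in measurable X]setTI; exact: mf.
Qed.

End measurable_rV.

Lemma measurable_rV_open (R : realType) n :
  (measurable : set (set 'rV[R]_n)) = <<s (open : set (set 'rV[R]_n)) >>.
Proof.
apply/seteqP; split; apply: smallest_sub.
- exact: smallest_sigma_algebra.
- move=> A; rewrite -bigcup_seq => -[i _ [B mB <-]].
  have mc : @measurable_fun _ _
      (g_sigma_algebraType (open : set (set 'rV[R]_n)))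
      R setT (fun x : 'rV[R]_n => x 0 i).
    apply: (measurability _ (measurable_realfun.RGenOpens.measurableE R)).
    move=> _ [_ [a [b ->]] <-]; rewrite setTI.
    apply: sub_sigma_algebra; apply: open_comp; last exact: interval_open.
    by move=> x _; exact: coord_continuous.
  exact: mc.
- exact: sigma_algebra_measurable.
- move=> A oA.
  pose c (q : 'rV[rat]_n) : 'rV[R]_n := \row_i ratr (q 0 i).
  pose B (u : 'rV[rat]_n * nat) : set 'rV[R]_n := ball (c u.1) u.2.+1%:R^-1.
  have mB u : measurable (B u).
    have -> : B u = \big[setI/setT]_(i < n)
        ((fun x : 'rV[R]_n => x 0 i) @^-1` ball (c u.1 0 i) u.2.+1%:R^-1).
      rewrite -bigcap_seq; apply/seteqP; split => x /=.
        by move=> [_ h] i _; exact: h.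
      move=> h; split; first by rewrite invr_gt0.
      by move=> i j; rewrite (ord1 i); apply: h; exact: mem_index_enum.
    apply: bigsetI_measurable => i _; rewrite -[X in measurable X]setTI.
    by apply: measurable_coor => //; rewrite ball_itv; exact: measurable_itv.
  have -> : A = \bigcup_u (if pselect (B u `<=` A) then B u else set0).
    apply/seteqP; split => [x Ax|x [u _]]; last by case: pselect => // h /h.
    have [e /= e0 eA] := (nbhs_ballP _ _).1 (oA _ Ax).
    have e20 : 0 < e / 2 by rewrite divr_gt0.
    have [k _ /(_ k (leqnn k)) /= ke] := near_infty_natSinv_lt (PosNum e20).
    have k0 : 0 < k.+1%:R^-1 :> R by rewrite invr_gt0.
    have /choice[q hq] i : exists q : rat, `|x 0 i - ratr q| < k.+1%:R^-1.
      have : x 0 i - k.+1%:R^-1 < x 0 i + k.+1%:R^-1.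
        by rewrite ltrBlDr -addrA ltrDl addr_gt0.
      move=> /rat_in_itvoo[q]; rewrite in_itv/= => /andP[q1 q2]; exists q.
      by rewrite distrC ltr_distl q1 q2.
    exists (\row_i q i, k) => //.
    have xB : B (\row_i q i, k) x.
      split=> // i j; rewrite (ord1 i) !mxE /ball/= distrC; exact: hq.
    case: pselect => // -[]; move=> y By; apply: eA.
    rewrite [e]splitr; apply: (@ball_triangle _ _ (c (\row_i q i))).
      by apply: ball_sym; apply: le_ball xB; exact: ltW.
    by apply: le_ball By; exact: ltW.
  apply: countable_bigcupT_measurable => [|u]; first exact: countableP.
  by case: pselect => ?; [exact: mB|exact: measurable0].
Qed.

Definition append {R : realType} n (x : 'rV[R]_n) (t : R) : 'rV[R]_n.+1 :=
  \row_i oapp (x 0) t (unlift ord_max i).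

Lemma measurable_append {R : realType} n :
  measurable_fun setT (fun p : 'rV[R]_n * measurableTypeR R => append p.1 p.2).
Proof.
apply: measurable_fun_rV => i; under eq_fun do rewrite mxE.
case: (unlift ord_max i) => [j|] /=.
- exact: (measurableT_comp (measurable_coor j)).
- exact: measurable_snd.
Qed.

(* The product of [n] copies of the one-dimensional Lebesgue measure, carried
   over to row vectors; [lebesgue_rV_box] checks the normalization. *)
Fixpoint lebesgue_rV {R : realType} (n : nat) :
    {measure set 'rV[R]_n -> \bar R} :=
  if n is k.+1 then
    measure_function_pushforward__canonical__measure_function_Measure
      (lebesgue_rV k \x lebesgue_measure)%E (@measurable_append R k)
  else \d_(0 : 'rV[R]_0).

Lemma lebesgue_rV_box (R : realType) n (a b : 'rV[R]_n) :
  (forall i, a 0 i <= b 0 i) ->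
  lebesgue_rV n [set x | forall i, a 0 i <= x 0 i <= b 0 i] =
  (\prod_i (b 0 i - a 0 i))%:E.
Proof.
elim: n a b => [|n IH] a b ab.
  by rewrite big_ord0 /= diracE mem_set//= => -[].
rewrite /= /pushforward.
set pa := col' ord_max a : 'rV_n; set pb := col' ord_max b : 'rV_n.
set A := _ @^-1` _.
have -> : A = [set x : 'rV[R]_n | forall i, pa 0 i <= x 0 i <= pb 0 i] `*`
  (`[a 0 ord_max, b 0 ord_max]%classic : set (measurableTypeR R)).
  rewrite {}/A.
  apply/seteqP; split=> -[x t] /=.
    move=> H; split=> [i|].
      by have := H (lift ord_max i); rewrite !mxE liftK.
    by have := H ord_max; rewrite !mxE unlift_none in_itv.
  rewrite in_itv/= => -[H ht] i; rewrite mxE.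
  case: unliftP => [j ->|->]//=.
  by have := H j; rewrite !mxE.
rewrite product_measure1E//; last first.
  rewrite (_ : mkset _ = \big[setI/setT]_(i < n)
      ((fun x : 'rV[R]_n => x 0 i) @^-1` `[pa 0 i, pb 0 i]%classic)).
    apply: bigsetI_measurable => i _; rewrite -[X in measurable X]setTI.
    exact: measurable_coor.
  rewrite -bigcap_seq; apply/seteqP; split => x /= H i.
    by move=> _ /=; rewrite in_itv/=; exact: H.
  by have := H i (mem_index_enum _); rewrite /= in_itv/=.
rewrite IH => [|i]; last by rewrite !mxE.
rewrite big_ord_recr/= lebesgue_measure_itv/= lte_fin.
rewrite EFinM; congr (_ * _)%E.
  congr EFin; apply: eq_bigr => i _; rewrite !mxE.
  rewrite (_ : lift ord_max i = widen_ord (leqnSn n) i)//.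
  by apply/val_inj; rewrite /= /bump leqNgt ltn_ord.
case: ltP => //=; have := ab ord_max.
rewrite le_eqVlt => /orP[/eqP->|]; rewrite ?subrr//.
by move=> /lt_le_trans h /h; rewrite ltxx.
Qed.

Section sobolev_bmo.
Context {R : realType}.
Implicit Types (m k : nat).

Definition dotv k (u v : 'rV[R]_k) : R := \sum_i u 0 i * v 0 i.

(* The norm [`|x|] on ['rV[R]_k] is the sup norm; all metric notions below are
   Euclidean. *)
Definition enorm k (u : 'rV[R]_k) : R := Num.sqrt (dotv u u).

Definition eball m (x : 'rV[R]_m) (r : R) : set 'rV[R]_m :=
  [set y | enorm (y - x) < r].

Definition boundary m (D : set 'rV[R]_m) : set 'rV[R]_m :=
  closure D `\` interior D.

Definition eucl_dist m (x : 'rV[R]_m) (A : set 'rV[R]_m) : \bar R :=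
  ereal_inf [set (enorm (x - y))%:E | y in A].

Definition partial m (i : 'I_m) (g : 'rV[R]_m -> R) : 'rV[R]_m -> R :=
  fun x => 'D_(delta_mx 0 i) g x.

Fixpoint Ck m (k : nat) (g : 'rV[R]_m -> R) : Prop :=
  continuous g /\
  if k is k'.+1 then
    forall i : 'I_m,
      (forall x, derivable g x (delta_mx 0 i)) /\ Ck k' (partial i g)
  else True.

Definition smooth m (g : 'rV[R]_m -> R) : Prop := forall k, Ck k g.

(* Near each boundary point, up to relabelling and reorienting the coordinate
   axes, [D] is the region strictly above the graph of a smooth function of
   the remaining coordinates ([col' j x] is [x] without its [j]-th entry). *)
Definition smooth_boundary m (D : set 'rV[R]_m) : Prop :=
  forall x0, boundary D x0 ->
    exists (r : R) (j : 'I_m) (s : bool) (gamma : 'rV[R]_m.-1 -> R),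
      [/\ 0 < r, smooth gamma &
          D `&` eball x0 r =
          [set x | gamma (col' j x) < (-1) ^+ s * x 0 j] `&` eball x0 r].

Definition Lp m (D : set 'rV[R]_m) (p : R) (g : 'rV[R]_m -> R) : Prop :=
  measurable_fun D g /\
  (\int[lebesgue_rV m]_(x in D) (`|g x| `^ p)%:E < +oo)%E.

Definition L1loc m (D : set 'rV[R]_m) (g : 'rV[R]_m -> R) : Prop :=
  measurable_fun D g /\
  forall K, compact K -> K `<=` D ->
    (lebesgue_rV m).-integrable K (EFin \o g).

Definition test_function m (D : set 'rV[R]_m) (phi : 'rV[R]_m -> R) : Prop :=
  let supp := closure [set x | phi x != 0] in
  [/\ smooth phi, compact supp & supp `<=` D].

Definition weak_partial m (D : set 'rV[R]_m) (i : 'I_m)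
    (g dg : 'rV[R]_m -> R) : Prop :=
  [/\ L1loc D g, L1loc D dg &
      forall phi, test_function D phi ->
        \int[lebesgue_rV m]_(x in D) (g x * partial i phi x) =
        - \int[lebesgue_rV m]_(x in D) (dg x * phi x)].

(* Row [i] of [Dh x] is the weak partial derivative of [h] in direction [i],
   as in the library's Jacobian ['J h x] for row vectors, and transposed with
   respect to the usual matrix of column vectors. *)
Definition weak_gradient m k (D : set 'rV[R]_m) (h : 'rV[R]_m -> 'rV[R]_k)
    (Dh : 'rV[R]_m -> 'M[R]_(m, k)) : Prop :=
  forall i j, weak_partial D i (fun x => h x 0 j) (fun x => Dh x i j).

Definition W1p m k (D : set 'rV[R]_m) (p : R) (h : 'rV[R]_m -> 'rV[R]_k) :
    Prop :=
  (forall j, Lp D p (fun x => h x 0 j)) /\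
  exists2 Dh, weak_gradient D h Dh &
    forall i j, Lp D p (fun x => Dh x i j).

Definition average m k (h : 'rV[R]_m -> 'rV[R]_k) (B : set 'rV[R]_m) :
    'rV[R]_k :=
  (fine (lebesgue_rV m B))^-1 *:
    \row_j \int[lebesgue_rV m]_(y in B) h y 0 j.

Definition mean_oscillation m k (h : 'rV[R]_m -> 'rV[R]_k)
    (B : set 'rV[R]_m) : \bar R :=
  ((lebesgue_rV m B)^-1 *
    \int[lebesgue_rV m]_(y in B) (enorm (h y - average h B))%:E)%E.

Definition bmo_seminorm m k (D : set 'rV[R]_m) (h : 'rV[R]_m -> 'rV[R]_k) :
    \bar R :=
  ereal_sup [set a | exists x r,
    [/\ D x, 0 < r, (r%:E < eucl_dist x (boundary D))%E &
        a = mean_oscillation h (eball x r)]].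

Definition BMO m k (D : set 'rV[R]_m) (h : 'rV[R]_m -> 'rV[R]_k) : Prop :=
  (forall j, L1loc D (fun x => h x 0 j)) /\ (bmo_seminorm D h < +oo)%E.

Definition VMO m k (D : set 'rV[R]_m) (h : 'rV[R]_m -> 'rV[R]_k) : Prop :=
  BMO D h /\
  forall e : R, 0 < e ->
    exists2 g : 'rV[R]_m -> 'rV[R]_k, {within closure D, continuous g} &
      (bmo_seminorm D (h \- g)%R < e%:E)%E.

Definition cylinder n (Omega : set 'rV[R]_n) (d : R) : set 'rV[R]_n.+1 :=
  [set y | Omega (col' ord_max y) /\ - d < y 0 ord_max < d].

(* [unit_normal Omega Df nu]: for a.e. [x], [nu x] is one of the two unit
   normals at [f x], where [Df] is the weak gradient of [f]. *)
Definition unit_normal n (Omega : set 'rV[R]_n)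
    (Df : 'rV[R]_n -> 'M[R]_(n, n.+1)) (nu : 'rV[R]_n -> 'rV[R]_n.+1) : Prop :=
  {ae lebesgue_rV n, forall x, Omega x ->
    enorm (nu x) = 1 /\ forall i, dotv (row i (Df x)) (nu x) = 0}.

Definition normal_extension n (f nu : 'rV[R]_n -> 'rV[R]_n.+1) :
    'rV[R]_n.+1 -> 'rV[R]_n.+1 :=
  fun y => let x := col' ord_max y in f x + y 0 ord_max *: nu x.

End sobolev_bmo.

(* Main.v *)
Require Import Defs.
From mathcomp Require Import all_boot all_order all_algebra.
From mathcomp Require Import all_classical all_reals all_analysis.
From mathcomp Require Import measurable_realfun.
From mathcomp Require Import perm.
From HB Require Import structures.
From mathcomp Require Import ring lra.
Import Order.TTheory GRing.Theory Num.Theory.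
Import numFieldNormedType.Exports.
Local Open Scope classical_set_scope.
Local Open Scope ring_scope.

Set Implicit Arguments.
Unset Strict Implicit.
Unset Printing Implicit Defensive.

(** Take [d = 1/2].  Membership in [W^{1,n}] is Tonelli's theorem: the weak
    gradient of [F(x, t) = f x + t * nu x] has the rows [Df + t * Dnu] and [nu].
    Weak gradients are unique almost everywhere, so in the Leibniz formula each
    product has [n] factors in [L^n] and one entry of [nu], bounded by 1; hence
    the determinant is integrable.

    For VMO, the weak gradient of [F] is dominated by a function [w] of [x] alone
    with [w^n] integrable on [Omega].  The Poincare inequality in dimension
    [n + 1], Tonelli, and [w <= e / r + (r / e)^(n - 1) * w^n] bound the mean
    oscillation of [F] on a ball of radius [r] by a multiple of
    [e + e^(1 - n) * int_{B_r} w^n], which is uniformly small for small [r] by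
    absolute continuity of the integral.

    An integrable [h] on a bounded open [U] whose mean oscillation is small on
    all small balls of [U] is a BMO limit of bounded continuous functions, without
    any regularity of the boundary: truncate [h] at a high level (on large balls
    the remainder is small in [L^1]), multiply by a cutoff depending on the
    logarithm of the distance to the complement of [U] (such a cutoff oscillates
    slowly on every ball of [U]), and average the result over small balls. *)

(** * Lebesgue measure on row vectors *)

(** In dimension n + 1 the exponent critical for VMO is n + 1, so membership in W^{1,n} alone would
    not suffice. The missing power of r is the height of the ball: the integral over a ball of
    radius r of a function of x alone is at most 2 r times its integral over the projected ball,
    which makes L^n in the n horizontal variables critical again. Of the value of [d] only
    [|t| <= 1] is used, to remove t from all bounds.

    The seminorm sees balls that nearly touch the boundary, where an average at a fixed scale would
    read values outside [U]. Hence a boundary layer is removed before averaging; and truncation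
    precedes the cutoff, because the oscillation of the cutoff gets multiplied by a bound on the
    function.

    Sobolev functions are never approximated by smooth ones. The Poincare inequality rests on a
    translation estimate proved by duality, which asks for test functions nearly realizing an L^1
    norm; these come from exp(-1/t) and an induction over Borel sets. The same density gives
    uniqueness of weak gradients. *)

Section box.
Context {R : realType} (n : nat).

Lemma measurable_box (a b : 'rV[R]_n) :
  measurable [set x : 'rV[R]_n | forall i, a 0 i <= x 0 i <= b 0 i].
Proof.
rewrite (_ : mkset _ = \big[setI/setT]_(i < n)
    ((fun x : 'rV[R]_n => x 0 i) @^-1` `[a 0 i, b 0 i]%classic)).
  apply: bigsetI_measurable => i _; rewrite -[X in measurable X]setTI.
  exact: measurable_coor.
rewrite -bigcap_seq; apply/seteqP; split => x /= H i.
  by move=> _ /=; rewrite in_itv/=; exact: H.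
by have := H i (mem_index_enum _); rewrite /= in_itv/=.
Qed.

(* An alias of [lebesgue_rV n] that can carry the sigma-finite structure required
   by the Fubini lemmas; [lebesgue_rV] itself computes on [n]. *)
Definition lam : set 'rV[R]_n -> \bar R := lebesgue_rV n.
HB.instance Definition _ := Measure.on lam.

Lemma lebesgue_rV_sigma_finite : sigma_finite setT lam.
Proof.
pose c (k : nat) : 'rV[R]_n := const_mx k%:R.
exists (fun k => [set x : 'rV[R]_n | forall i, (- c k) 0 i <= x 0 i <= (c k) 0 i]).
  apply/seteqP; split => // x _.
  pose M := \big[Order.max/0]_i `|x 0 i|.
  have /truncn_itv M0 : 0 <= M by rewrite /M; elim/big_ind : _ => // u v; rewrite le_max => ->.
  exists (Num.trunc M).+1 => //= i; rewrite !mxE -ler_norml.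
  apply: (@le_trans _ _ M); last by case/andP : M0 => _ /ltW.
  exact: le_bigmax.
move=> k; split; first exact: measurable_box.
by rewrite lebesgue_rV_box ?ltry// => i; rewrite !mxE ge0_cp.
Qed.

HB.instance Definition _ := Measure_isSigmaFinite.Build _ _ _ lam lebesgue_rV_sigma_finite.

End box.

Arguments lam {R} n _.

(** * Fubini and Tonelli for row vectors *)

Section fubini.
Context {R : realType} (n : nat).
Local Open Scope ereal_scope.

Local Notation ml := (lam n : {sigma_finite_measure set _ -> \bar R}).
Local Notation m1 := (lebesgue_measure : {sigma_finite_measure set _ -> \bar R}).

Lemma measurable_fun_append (f : 'rV[R]_n.+1 -> \bar R) :
  measurable_fun [set: 'rV[R]_n.+1] f ->
  measurable_fun [set: 'rV[R]_n * measurableTypeR R] (fun p => f (append p.1 p.2)).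
Proof. by move=> mf; apply: (measurableT_comp mf); exact: measurable_append. Qed.

Lemma ge0_integral_rVS (f : 'rV[R]_n.+1 -> \bar R) :
  measurable_fun [set: 'rV[R]_n.+1] f -> (forall x, 0 <= f x) ->
  \int[lebesgue_rV n.+1]_x f x =
  \int[lebesgue_rV n]_x \int[lebesgue_measure]_t f (append x t).
Proof.
move=> mf f0; rewrite /= ge0_integral_pushforward//; last exact: measurable_append.
rewrite preimage_setT.
have := @fubini_tonelli1 _ _ _ _ _ ml m1 (fun p => f (append p.1 p.2)).
by apply => //; exact: measurable_fun_append.
Qed.

(** Both orders are kept: the vertical weak derivative is handled by integrating first over the last
    coordinate, the horizontal ones by integrating first over the others. *)
Lemma integral_rVS (f : 'rV[R]_n.+1 -> \bar R) :
  (lebesgue_rV n.+1).-integrable setT f ->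
  \int[lebesgue_rV n.+1]_x f x =
  \int[lebesgue_rV n]_x \int[lebesgue_measure]_t f (append x t) /\
  \int[lebesgue_rV n.+1]_x f x =
  \int[lebesgue_measure]_t \int[lebesgue_rV n]_x f (append x t).
Proof.
move=> /integrableP[mf If].
have ig : ((lebesgue_rV n : {measure set _ -> \bar R}) \x lebesgue_measure)%E.-integrable
    setT (fun p => f (append p.1 p.2)).
  apply/integrableP; split; first exact: measurable_fun_append.
  move: If; rewrite /= ge0_integral_pushforward ?preimage_setT//; first exact: measurable_append.
  exact: measurableT_comp.
rewrite /= integral_pushforward ?preimage_setT//; first last.
  exact: measurable_append.
split.
  exact/esym/(@integral12_prod_meas1 _ _ _ _ _ ml m1 (fun p => f (append p.1 p.2))).
exact/esym/(@integral21_prod_meas1 _ _ _ _ _ ml m1 (fun p => f (append p.1 p.2))).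
Qed.

End fubini.

Section fubini2.
Context {R : realType} (n m : nat).
Local Open Scope ereal_scope.

Local Notation ml k := (lam k : {sigma_finite_measure set _ -> \bar R}).

Lemma tonelli_rV (f : 'rV[R]_n * 'rV[R]_m -> \bar R) :
  measurable_fun [set: 'rV[R]_n * 'rV[R]_m] f -> (forall x, 0 <= f x) ->
  \int[lebesgue_rV n]_x \int[lebesgue_rV m]_y f (x, y) =
  \int[lebesgue_rV m]_y \int[lebesgue_rV n]_x f (x, y).
Proof. by move=> mf f0; exact: (@fubini_tonelli _ _ _ _ _ (ml n) (ml m) f). Qed.

Lemma measurable_tonelli_rV (f : 'rV[R]_n * 'rV[R]_m -> \bar R) :
  measurable_fun [set: 'rV[R]_n * 'rV[R]_m] f -> (forall x, 0 <= f x) ->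
  measurable_fun [set: 'rV[R]_n] (fun x => \int[lebesgue_rV m]_y f (x, y)).
Proof.
by move=> mf f0; exact: (@measurable_fun_fubini_tonelli_F _ _ _ _ _ (ml m) f).
Qed.

End fubini2.

(** * Affine changes of variables *)

Section affine.
Context {R : realType}.
Local Open Scope ereal_scope.

(** Uniqueness of Lebesgue measure: [a] times its image under t -> a t + b gives every interval []u,
    v]] its length. *)
Lemma ge0_integral_affineR (a b : R) (f : measurableTypeR R -> \bar R) : (0 < a)%R ->
  measurable_fun [set: measurableTypeR R] f -> (forall x, 0 <= f x) ->
  \int[lebesgue_measure]_t f (a * t + b)%R = a^-1%:E * \int[lebesgue_measure]_t f t.
Proof.
move=> a0 mf f0.
have mphi : measurable_fun [set: measurableTypeR R] (fun t : measurableTypeR R => a * t + b : measurableTypeR R)%R.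
  by apply: measurable_funD => //; apply: measurable_funM.
pose pm := measure_function_pushforward__canonical__measure_function_Measure
  (@lebesgue_measure R) mphi.
pose nu := mscale (NngNum (ltW a0)) pm.
have E A : measurable A -> lebesgue_measure A = nu A.
  apply: (@lebesgue_measure_unique R nu) => _ [[u v]] _ <-.
  change (lebesgue_measure `]u, v] = a%:E *
    lebesgue_measure ((fun t : measurableTypeR R => a * t + b)%R @^-1` `]u, v])).
  set S := (X in _ * lebesgue_measure X); have -> : S =
     [set` `](u - b) / a, (v - b) / a]%R].
    apply/seteqP; split => t; rewrite /= !in_itv/= ltr_pdivrMr// ler_pdivlMr//;
      by rewrite ltrBlDr lerBrDr (mulrC t).
  rewrite !lebesgue_measure_itv/= !lte_fin ltr_pM2r ?invr_gt0// ltrD2r.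
  case: ifPn => uv; last by rewrite mule0.
  by rewrite -EFinM -mulrBl mulrCA mulfV ?gt_eqF// mulr1; congr EFin; ring.
have -> : \int[lebesgue_measure]_t f t = \int[nu]_t f t.
  by apply: eq_measure_integral => A mA _; exact: E.
rewrite ge0_integral_mscale// ge0_integral_pushforward//.
by rewrite preimage_setT muleA -EFinM mulVf ?gt_eqF// mul1e.
Qed.

Lemma appendD (n : nat) (a : R) (x b : 'rV[R]_n.+1) (y : 'rV[R]_n) t :
  (a *: append y t + b = append (a *: y + col' ord_max b) (a * t + b 0 ord_max))%R.
Proof.
by apply/rowP => i; rewrite !mxE; case: unliftP => [j ->|->] //=; rewrite !mxE.
Qed.

Lemma measurable_affine_rV n (a : R) (b : 'rV[R]_n) :
  measurable_fun [set: 'rV[R]_n] (fun x => a *: x + b)%R.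
Proof.
apply: measurable_fun_rV => i; under eq_fun do rewrite !mxE.
apply: measurable_funD => //; apply: measurable_funM => //; exact: measurable_coor.
Qed.

Lemma ge0_integral_affine n (a : R) (b : 'rV[R]_n) (f : 'rV[R]_n -> \bar R) : (0 < a)%R ->
  measurable_fun [set: 'rV[R]_n] f -> (forall x, 0 <= f x) ->
  \int[lebesgue_rV n]_x f (a *: x + b)%R = (a^-1 ^+ n)%:E * \int[lebesgue_rV n]_x f x.
Proof.
move=> a0; elim: n b f => [|n IH] b f mf f0.
  rewrite expr0 mul1e; apply: eq_integral => x _; congr f.
  by rewrite [LHS]thinmx0 [RHS]thinmx0.
have mfa : measurable_fun [set: 'rV[R]_n.+1] (fun x => f (a *: x + b)%R).
  by apply: (measurableT_comp mf); exact: measurable_affine_rV.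
rewrite ge0_integral_rVS// ge0_integral_rVS//.
set F := fun y : 'rV[R]_n => \int[lebesgue_measure]_t f (append y t).
have mF : measurable_fun [set: 'rV[R]_n] F.
  apply: (@measurable_fun_fubini_tonelli_F _ _ _ _ _
   (lebesgue_measure : {sigma_finite_measure set _ -> \bar R}) (fun p => f (append p.1 p.2))) => //.
  exact: measurable_fun_append.
under eq_integral => y _.
  under eq_integral do rewrite appendD//.
  rewrite (@ge0_integral_affineR _ _ (fun t => f (append (a *: y + col' ord_max b)%R t)))//; last first.
    have := measurableT_comp (measurable_fun_append mf)
      (@pair1_measurable _ _ _ (measurableTypeR R) (a *: y + col' ord_max b)%R).
    by [].
  rewrite -/(F _); over.
rewrite (@ge0_integralZl _ _ _ (lebesgue_rV n) setT measurableT
  (fun y => F (a *: y + col' ord_max b)%R)); first last.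
- by rewrite lee_fin invr_ge0 ltW.
- by move=> *; exact: integral_ge0.
- by apply: (measurableT_comp mF); exact: measurable_affine_rV.
rewrite (IH _ F)//; last by move=> y; exact: integral_ge0.
by rewrite muleA -EFinM exprS.
Qed.

End affine.

(** * Euclidean balls *)

Section ball.
Context {R : realType} (m : nat).
Implicit Types (x y u v : 'rV[R]_m) (r : R).

Lemma dotv_ge0 u : 0 <= dotv u u.
Proof. by apply: sumr_ge0 => i _; rewrite -expr2 sqr_ge0. Qed.

Lemma enorm_ge0 u : 0 <= enorm u.
Proof. exact: sqrtr_ge0. Qed.

Lemma enorm0 : enorm (0 : 'rV[R]_m) = 0.
Proof. by rewrite /enorm /dotv big1 ?sqrtr0// => i _; rewrite mxE mul0r. Qed.

Lemma sqr_enorm u : enorm u ^+ 2 = dotv u u.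
Proof. by rewrite sqr_sqrtr// dotv_ge0. Qed.

Lemma enormZ (a : R) u : enorm (a *: u) = `|a| * enorm u.
Proof.
rewrite /enorm -sqrtr_sqr -sqrtrM ?sqr_ge0//; congr Num.sqrt.
by rewrite /dotv mulr_sumr; apply: eq_bigr => i _; rewrite !mxE; ring.
Qed.

Lemma enormN u : enorm (- u) = enorm u.
Proof. by rewrite -scaleN1r enormZ normrN1 mul1r. Qed.

Lemma enormBC u v : enorm (u - v) = enorm (v - u).
Proof. by rewrite -enormN opprB. Qed.

Lemma coord_le_enorm u i : `|u 0 i| <= enorm u.
Proof.
rewrite -sqrtr_sqr; apply: ler_wsqrtr.
by rewrite /dotv (bigD1 i)//= -expr2 lerDl sumr_ge0// => j _; rewrite -expr2 sqr_ge0.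
Qed.

Lemma enorm_eq0 u : enorm u = 0 -> u = 0.
Proof.
move=> u0; apply/rowP => i; rewrite mxE; apply/eqP.
by rewrite -normr_le0 -u0 coord_le_enorm.
Qed.

(** Cauchy-Schwarz, by expanding the nonnegative square of [enorm v *: u - enorm u *: v]. *)
Lemma dotv_enorm u v : dotv u v <= enorm u * enorm v.
Proof.
have [/enorm_eq0 ->|u0] := eqVneq (enorm u) 0.
  by rewrite enorm0 mul0r /dotv big1// => i _; rewrite mxE mul0r.
have [/enorm_eq0 ->|v0] := eqVneq (enorm v) 0.
  by rewrite enorm0 mulr0 /dotv big1// => i _; rewrite mxE mulr0.
have {}u0 : 0 < enorm u by rewrite lt_neqAle eq_sym u0 enorm_ge0.
have {}v0 : 0 < enorm v by rewrite lt_neqAle eq_sym v0 enorm_ge0.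
have := dotv_ge0 (enorm v *: u - enorm u *: v).
have -> : dotv (enorm v *: u - enorm u *: v) (enorm v *: u - enorm u *: v) =
  enorm v ^+ 2 * dotv u u + enorm u ^+ 2 * dotv v v - 2 * enorm u * enorm v * dotv u v.
  rewrite /dotv !mulr_sumr -!big_split/= -sumrB; apply: eq_bigr => i _; rewrite !mxE; ring.
rewrite -!sqr_enorm => h.
have uv : 0 < enorm u * enorm v by rewrite mulr_gt0.
rewrite -(ler_pM2l uv); nra.
Qed.

Lemma enormD u v : enorm (u + v) <= enorm u + enorm v.
Proof.
rewrite -(@ler_pXn2r _ 2)// ?nnegrE ?addr_ge0 ?enorm_ge0//.
rewrite sqr_enorm.
have -> : dotv (u + v) (u + v) = dotv u u + dotv v v + 2 * dotv u v.
  by rewrite /dotv !mulr_sumr -!big_split/=; apply: eq_bigr => i _; rewrite !mxE; ring.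
rewrite -!sqr_enorm; have := dotv_enorm u v; nra.
Qed.

Lemma enorm_triangle u v w : enorm (u - w) <= enorm (u - v) + enorm (v - w).
Proof. by apply: le_trans (enormD _ _); rewrite addrA subrK. Qed.

Lemma enorm_le_sum u : enorm u <= \sum_i `|u 0 i|.
Proof.
have s0 : 0 <= \sum_i `|u 0 i| by apply: sumr_ge0.
rewrite -(@ler_pXn2r _ 2)// ?nnegrE ?enorm_ge0// sqr_enorm /dotv expr2 mulr_suml.
apply: ler_sum => i _; rewrite -expr2 -normr_id -real_normK ?num_real// normr_id expr2.
by apply: ler_wpM2l => //; rewrite (bigD1 i)//= lerDl sumr_ge0.
Qed.

Lemma measurable_enorm : measurable_fun [set: 'rV[R]_m] (@enorm R m).
Proof.
apply: (@measurableT_comp _ _ _ _ _ _ (@Num.sqrt R)).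
  by apply: continuous_measurable_fun => x; exact: sqrt_continuous.
apply: measurable_sum => i; apply: measurable_funM; exact: measurable_coor.
Qed.

Lemma measurable_eball x r : measurable (eball x r).
Proof.
have h : measurable_fun [set: 'rV[R]_m] (fun y => enorm (y - x)).
  apply: (measurableT_comp measurable_enorm).
  by have := measurable_affine_rV 1 (- x); under eq_fun do rewrite scale1r.
have := h measurableT `]-oo, r[%classic (measurable_itv _).
rewrite setTI; congr measurable; apply/seteqP; split => y /=; by rewrite in_itv.
Qed.

Lemma mem_eball x r : 0 < r -> eball x r x.
Proof. by rewrite /eball/= subrr enorm0. Qed.

Lemma sub_eball x r r' : r <= r' -> eball x r `<=` eball x r'.
Proof. by move=> rr y /lt_le_trans; exact. Qed.

Lemma eball_sub x y r r' : enorm (x - y) + r <= r' -> eball x r `<=` eball y r'.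
Proof.
move=> h z; rewrite /eball/= => zx; apply: lt_le_trans h.
by rewrite (le_lt_trans (enorm_triangle z x y))// addrC ltrD2l.
Qed.

Lemma ball_rV x r y : ball x r y <-> 0 < r /\ forall i, `|x 0 i - y 0 i| < r.
Proof.
split=> [[r0 h]|[r0 h]]; split=> // i; first exact: h.
by move=> j; rewrite (ord1 i); exact: h.
Qed.

Lemma eball_ball x r : 0 < r -> eball x r `<=` ball x r.
Proof.
move=> r0 y xy; apply/ball_rV; split => // i; rewrite distrC.
by have := coord_le_enorm (y - x) i; rewrite !mxE => /le_lt_trans; exact.
Qed.

(** The Euclidean norm is bounded crudely by the sum of the coordinates; [m.+1] instead of [m] makes
    the inequality strict and the factor positive also for [m = 0]. *)
Lemma ball_eball x r : ball x r `<=` eball x (m.+1%:R * r).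
Proof.
move=> y /ball_rV[r0 h]; rewrite /eball/= (le_lt_trans (enorm_le_sum _))//.
rewrite (@le_lt_trans _ _ (m%:R * r))//; last by rewrite ltr_pM2r// ltr_nat.
rewrite mulr_natl -[X in _ *+ X]card_ord -sumr_const.
by apply: ler_sum => i _; rewrite !mxE distrC ltW.
Qed.

Lemma open_eballP (U : set 'rV[R]_m) :
  open U <-> forall x, U x -> exists2 r, 0 < r & eball x r `<=` U.
Proof.
split=> [oU x Ux|h].
  have [e /= e0 eU] := (nbhs_ballP _ _).1 (oU _ Ux).
  by exists e => // y /(eball_ball e0); exact: eU.
rewrite openE => x /h[r r0 rU]; apply/nbhs_ballP; exists (m.+1%:R^-1 * r) => /=.
  by rewrite mulr_gt0// invr_gt0.
by move=> y /ball_eball; rewrite mulrA mulfV// mul1r => /rU.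
Qed.

Lemma open_eball x r : open (eball x r).
Proof.
apply/open_eballP => y xy; exists (r - enorm (y - x)); first by rewrite subr_gt0.
by apply: eball_sub; rewrite addrC subrK.
Qed.

Local Open Scope ereal_scope.

Lemma integral_shift (v : 'rV[R]_m) (f : 'rV[R]_m -> \bar R) :
  measurable_fun [set: 'rV[R]_m] f ->
  \int[lebesgue_rV m]_x f (x + v)%R = \int[lebesgue_rV m]_x f x.
Proof.
have S (g : 'rV[R]_m -> \bar R) : measurable_fun [set: 'rV[R]_m] g -> (forall x, 0 <= g x) ->
    \int[lebesgue_rV m]_x g (x + v)%R = \int[lebesgue_rV m]_x g x.
  move=> mg g0; have := ge0_integral_affine v (@ltr01 R) mg g0.
  by under eq_integral do rewrite scale1r; rewrite invr1 expr1n mul1e.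
move=> mf; rewrite integralE [RHS]integralE.
congr (_ - _).
  under eq_integral do rewrite (funepos_comp f (fun y => y + v)%R)/=.
  by apply: (S f^\+); [exact: measurable_funepos|move=> x; exact: funepos_ge0].
under eq_integral do rewrite (funeneg_comp f (fun y => y + v)%R)/=.
 by apply: (S f^\-); [exact: measurable_funeneg|move=> x; exact: funeneg_ge0].
Qed.

(** The volume of the unit ball is never computed; comparison with two cubes shows that it is
    positive and finite, and scaling does the rest. *)
Definition bvol : R := fine (lebesgue_rV m (eball 0 1)).

Lemma eball0_fin : 0 < lebesgue_rV m (eball (0 : 'rV[R]_m) 1) < +oo.
Proof.
apply/andP; split.
  pose d : R := (m.+1%:R^-1)%R.
  apply: (@lt_le_trans _ _ (lebesgue_rV m
     [set x : 'rV[R]_m | forall i, (const_mx (- d) : 'rV[R]_m) 0 i <= x 0 i <= (const_mx d : 'rV[R]_m) 0 i]%R)).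
    rewrite lebesgue_rV_box; last by move=> i; rewrite !mxE ge0_cp// invr_ge0.
    by rewrite lte_fin prodr_gt0// => i _; rewrite !mxE opprK addr_gt0// invr_gt0.
  apply: le_measure; rewrite ?inE.
  - exact: measurable_box.
  - exact: measurable_eball.
  move=> y h; rewrite /eball/= subr0 (le_lt_trans (enorm_le_sum _))//.
  rewrite (@le_lt_trans _ _ (m%:R * d)%R)//.
    rewrite mulr_natl -[X in (_ *+ X)%R]card_ord -sumr_const.
    by apply: ler_sum => i _; have := h i; rewrite !mxE -ler_norml.
  by rewrite /d ltr_pdivrMr// mul1r ltr_nat.
apply: (@le_lt_trans _ _ (lebesgue_rV m
   [set x : 'rV[R]_m | forall i, (const_mx (- 1) : 'rV[R]_m) 0 i <= x 0 i <= (const_mx 1 : 'rV[R]_m) 0 i]%R)).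
  apply: le_measure; rewrite ?inE.
  - exact: measurable_eball.
  - exact: measurable_box.
  move=> y /=; rewrite /eball/= subr0 => h i.
  by rewrite !mxE -ler_norml (le_trans (coord_le_enorm _ _))// ltW.
by rewrite lebesgue_rV_box ?ltry// => i; rewrite !mxE; lra.
Qed.

Lemma bvol_gt0 : (0 < bvol)%R.
Proof. by apply: fine_gt0; exact: eball0_fin. Qed.

Lemma lebesgue_eball x r : (0 < r)%R ->
  lebesgue_rV m (eball x r) = (r ^+ m * bvol)%:E.
Proof.
move=> r0.
have E : lebesgue_rV m (eball (0 : 'rV[R]_m) 1) = (r^-1 ^+ m)%:E * lebesgue_rV m (eball x r).
  rewrite -[X in lebesgue_rV m X]setIT -integral_indic//; last exact: measurable_eball.
  rewrite -[X in _ * lebesgue_rV m X]setIT -integral_indic//; last exact: measurable_eball.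
  rewrite -(ge0_integral_affine x r0)//; last first.
    by apply/measurable_EFinP; apply: measurable_indic; exact: measurable_eball.
  apply: eq_integral => y _; congr EFin; rewrite !indicE; congr (_%:R); congr nat_of_bool.
  apply/idP/idP; rewrite !inE /eball/= subr0 addrK enormZ gtr0_norm//.
    by move=> y1; rewrite -[ltRHS]mulr1 ltr_pM2l.
  by rewrite -[ltRHS]mulr1 ltr_pM2l.
have F : lebesgue_rV m (eball (0 : 'rV[R]_m) 1) = bvol%:E.
  by rewrite fineK// ge0_fin_numE//; case/andP: eball0_fin.
by rewrite EFinM -F E muleA -EFinM -exprMn divff ?gt_eqF// expr1n mul1e.
Qed.

End ball.

(** * Smooth functions *)

Section flat.
Context {R : realType}.
Implicit Types (P : {poly R}) (t : R).

(* All derivatives of [exp (- 1 / t)] have this form, with another polynomial. *)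
Definition flat P t : R := if 0 < t then P.[t^-1] * expR (- t^-1) else 0.

(** With u = 1 / t, the exponential series gives e^u >= u^(i+1) / (i+1)!, so u^i e^(-u) <= (i+1)! t
    for each monomial. This linear bound yields the derivative at 0. *)
Lemma flat_bound P : exists2 C, 0 <= C & forall t, `|flat P t| <= C * `|t|.
Proof.
exists (\sum_(i < size P) `|P`_i| * i.+1`!%:R); first exact: sumr_ge0.
move=> t; rewrite /flat; case: ifPn => [t0|_]; last first.
  by rewrite normr0 mulr_ge0//; exact: sumr_ge0.
rewrite normrM (ger0_norm (expR_ge0 _)) (gtr0_norm t0) horner_coef.
rewrite (@le_trans _ _ ((\sum_(i < size P) `|P`_i * t^-1 ^+ i|) * expR (- t^-1)))//.
  by rewrite ler_wpM2r ?expR_ge0// ler_norm_sum.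
rewrite !mulr_suml; apply: ler_sum => i _.
have u0 : 0 <= t^-1 by rewrite invr_ge0 ltW.
rewrite normrM -!mulrA ler_wpM2l// ger0_norm ?exprn_ge0//.
have := expR_ge1Dxn i u0.
set u := t^-1 in u0 *; have -> : t = u^-1 by rewrite invrK.
have up : 0 < u by rewrite /u invr_gt0.
rewrite expRN => h.
rewrite ler_pdivrMr ?expR_gt0// mulrAC ler_pdivlMr// -exprSr.
have f0 : 0 < (i.+1)`!%:R :> R by rewrite ltr0n fact_gt0.
by rewrite -ler_pdivrMl// mulrC (le_trans _ h)// lerDr.
Qed.

(** For t > 0, differentiating P(1/t) exp(-1/t) produces the factor 1/t^2 in both terms, whence the
    polynomial X^2 (P - P'). The family is thus closed under differentiation, and smoothness follows
    by induction. *)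
Lemma is_derive_flat P t : is_derive t 1 (flat P) (flat ('X^2 * (P - P^`())) t).
Proof.
have [t0|t0|->] := ltgtP t 0.
- rewrite {2}/flat ltNge ltW//=.
  have H : is_derive t (1 : R) (cst (0 : R)) 0 by exact: is_derive_cst.
  apply: near_eq_is_derive H.
  by near=> x; rewrite /flat ifN// -leNgt ltW//; near: x; exact: lt_nbhsl.
- have -> : flat ('X^2 * (P - P^`())) t = ('X^2 * (P - P^`())).[t^-1] * expR (- t^-1).
    by rewrite /flat t0.
  have tn0 : t != 0 by rewrite gt_eqF.
  have dV : is_derive t 1 (@GRing.inv R) (- t ^- 2).
    apply: DeriveDef; first exact: (@derivableV R R^o id t 1).
    have h := @derivable_id R R^o t 1.
    have e := @derive_id R R^o t 1.
    transitivity (- t ^- 2 *: 'D_1 (@id R^o) t); last by rewrite e /GRing.scale/= mulr1.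
    exact: (@deriveV R R^o id t 1).
  have d1 := is_derive1_comp (is_derive_poly P t^-1) dV.
  have dN : is_derive t 1 (fun x : R => - x^-1) (- - t ^- 2) by exact: is_deriveN.
  have d2 := @is_derive1_comp _ expR (fun x : R => - x^-1) t _ _ (is_derive_expR (- t^-1)) dN.
  have H : is_derive t 1 (fun x => P.[x^-1] * expR (- x^-1))
      (('X^2 * (P - P^`())).[t^-1] * expR (- t^-1)).
    have d := is_deriveM d1 d2.
    suff -> : ('X^2 * (P - P^`())).[t^-1] * expR (- t^-1) =
      (horner P \o GRing.inv) t *: (expR (- t^-1) * - - t ^- 2) +
      (expR \o (fun x : R => - x^-1)) t *: (P^`().[t^-1] * - t ^- 2) by exact: d.
    by rewrite /GRing.scale /= hornerM hornerXn hornerD hornerN exprVn; ring.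
  apply: near_eq_is_derive H.
  by near=> x; rewrite /flat ifT//; near: x; exact: lt_nbhsr.
(* At 0 the difference quotient is again a flat function, with polynomial X P, so [flat_bound] makes
   it tend to 0. *)
- have E h : h^-1 *: ((flat P \o shift 0) (h *: (1 : R)) - flat P 0) = flat ('X * P) h.
    rewrite /flat ltxx subr0 /= addr0 /GRing.scale/= mulr1.
    by case: ifPn => [h0|_]; rewrite ?mulr0// hornerM hornerX mulrA.
  have C0 : flat ('X * P) h @[h --> 0^'] --> (0 : R).
    have [C C0 hC] := flat_bound ('X * P).
    have : (fun h : R => C * `|h|) @ 0^' --> (0 : R).
      apply: cvg_within_filter.
      have h : (C * `|h| : R) @[h --> (0 : R)] --> C * `|0 : R|.
        by apply: cvgM; [exact: cvg_cst|apply: cvg_norm; exact: cvg_id].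
      by move: h; rewrite normr0 mulr0.
    move=> H; apply/norm_cvg0P.
    apply: (@squeeze_cvgr _ _ _ _ (cst 0) _ _ _ _ _ H); last exact: cvg_cst.
    by near=> h; rewrite normr_ge0/= hC.
  have F : (fun h => h^-1 *: ((flat P \o shift 0) (h *: (1 : R)) - flat P 0)) = flat ('X * P).
    by apply/funext => h; exact: E.
  have Z : flat ('X^2 * (P - P^`())) 0 = 0 by rewrite /flat ltxx.
  rewrite Z; apply: DeriveDef.
    by rewrite /derivable F; apply/cvg_ex; exists 0.
  by rewrite /derive F; apply/cvg_lim.
Unshelve. all: by end_near. Qed.

End flat.

Section smooth.
Context {R : realType} (m : nat).
Implicit Types (f g psi : 'rV[R]_m -> R) (x v : 'rV[R]_m).

Lemma is_derive_line f x v d :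
  is_derive (0 : R) 1 (fun h : R => f (h *: v + x)) d -> is_derive x v f d.
Proof.
move=> [D E]; split; first exact/derivable1P.
rewrite -E /derive; set g1 := fun h => h^-1 *: _; set g2 := fun h => h^-1 *: _.
suff -> : g1 = g2 by [].
by rewrite funeqE /g1 /g2 => h /=; rewrite addr0 scale0r add0r [_%:A]mulr1.
Qed.

Lemma is_derive_line_shift f x v d (s : R) :
  is_derive (s *: v + x) v f d -> is_derive s 1 (fun h : R => f (h *: v + x)) d.
Proof.
move=> [D E]; have H (h : R) : (f \o shift (s *: v + x)) (h *: v) - f (s *: v + x) =
    ((fun h : R => f (h *: v + x)) \o shift s) (h *: 1) - f (s *: v + x).
  by rewrite /= [_%:A]mulr1 scalerDl addrA.
split.
  by move: D; rewrite /derivable; under eq_fun do rewrite H.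
by rewrite -E /derive; under [in RHS]eq_fun do rewrite H.
Qed.

Lemma is_derive_comp_coord (b b' : R -> R) (a c : R) i x v :
  (forall t : R, is_derive t 1 b (b' t)) ->
  is_derive x v (fun y : 'rV[R]_m => b (a * y 0 i + c)) (a * v 0 i * b' (a * x 0 i + c)).
Proof.
move=> hb; apply: is_derive_line.
have -> : (fun h : R => b (a * (h *: v + x) 0 i + c)) =
    b \o (fun h : R => (a * v 0 i) * h + (a * x 0 i + c)).
  by apply/funext => h /=; rewrite !mxE; congr b; ring.
have dl : is_derive (0 : R) 1 (fun h : R => (a * v 0 i) * h + (a * x 0 i + c)) (a * v 0 i).
  apply: is_derive_eq; rewrite /GRing.scale/=; ring.
have := @is_derive1_comp _ b _ 0 _ _ (hb _) dl.
by rewrite mulr0 add0r [b' _ * _]mulrC.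
Qed.

Lemma Ck_continuous k f : Ck k f -> continuous f.
Proof. by case: k => [|k] []. Qed.

Lemma CkS k f : Ck k.+1 f -> Ck k f.
Proof.
elim: k f => [|k IH] f [cf h]; first by split.
split=> // i; have [d c] := h i; split => //; exact: IH.
Qed.

Lemma continuous_rV_cst (c : R) : continuous (fun _ : 'rV[R]_m => c).
Proof. by move=> x; exact: (@cvg_cst _ _ _ (nbhs x) (nbhs_filter x)). Qed.

Lemma continuous_rVD f g : continuous f -> continuous g -> continuous (fun x => f x + g x).
Proof.
by move=> cf cg x; apply: (@cvgD _ _ _ _ (nbhs_filter x)); [exact: cf|exact: cg].
Qed.

Lemma continuous_rVM f g : continuous f -> continuous g -> continuous (fun x => f x * g x).
Proof.
by move=> cf cg x; apply: (@cvgM _ _ _ (nbhs_filter x)); [exact: cf|exact: cg].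
Qed.

Lemma Ck_cst k (c : R) : Ck k (fun _ : 'rV[R]_m => c).
Proof.
elim: k c => [|k IH] c; first by split => //; exact: continuous_rV_cst.
split; first exact: continuous_rV_cst.
move=> i; split; first by move=> x; exact: derivable_cst.
rewrite (_ : partial i _ = fun=> 0); first exact: IH.
by apply/funext => x; rewrite /partial derive_cst.
Qed.

Lemma CkD k f g : Ck k f -> Ck k g -> Ck k (fun x => f x + g x).
Proof.
elim: k f g => [|k IH] f g Hf Hg.
  by split=> //; apply: continuous_rVD; [exact: (Ck_continuous Hf)|exact: (Ck_continuous Hg)].
split; first by apply: continuous_rVD; [exact: (Ck_continuous Hf)|exact: (Ck_continuous Hg)].
case: Hf Hg => [_ Hf] [_ Hg] i; have [df cf] := Hf i; have [dg cg] := Hg i.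
split; first by move=> x; exact: derivableD.
rewrite (_ : partial i _ = fun x => partial i f x + partial i g x); first exact: IH.
by apply/funext => x; rewrite /partial (deriveD (df x) (dg x)).
Qed.

Lemma CkM k f g : Ck k f -> Ck k g -> Ck k (fun x => f x * g x).
Proof.
elim: k f g => [|k IH] f g Hf Hg.
  by split=> //; apply: continuous_rVM; [exact: (Ck_continuous Hf)|exact: (Ck_continuous Hg)].
split; first by apply: continuous_rVM; [exact: (Ck_continuous Hf)|exact: (Ck_continuous Hg)].
have Hf' := CkS Hf; have Hg' := CkS Hg.
case: Hf Hg => [_ Hf] [_ Hg] i; have [df cf] := Hf i; have [dg cg] := Hg i.
split; first by move=> x; exact: derivableM.
rewrite (_ : partial i _ = fun x => f x * partial i g x + g x * partial i f x).
  by apply: CkD; exact: IH.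
by apply/funext => x; rewrite /partial (deriveM (df x) (dg x)).
Qed.

Lemma Ck_flat k P (a c : R) (i : 'I_m) : Ck k (fun x : 'rV[R]_m => flat P (a * x 0 i + c)).
Proof.
have cont Q : continuous (fun x : 'rV[R]_m => flat Q (a * x 0 i + c)).
  move=> x; apply: (@continuous_comp _ _ _ (fun x : 'rV[R]_m => a * x 0 i + c) (flat Q)).
    apply: continuous_rVD; last exact: continuous_rV_cst.
    by apply: continuous_rVM; [exact: continuous_rV_cst|exact: coord_continuous].
  apply/differentiable_continuous/derivable1_diffP.
  exact: (@ex_derive _ _ _ _ _ _ _ (is_derive_flat Q _)).
elim: k P => [|k IH] P; first by split.
split => // j; have D x := is_derive_comp_coord a c i x (delta_mx 0 j) (is_derive_flat P).
split; first by move=> x; exact: (@ex_derive _ _ _ _ _ _ _ (D x)).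
set Q := 'X^2 * (P - P^`()) in D.
rewrite (_ : partial j _ = fun x => (a * (delta_mx 0 j : 'rV[R]_m) 0 i) * flat Q (a * x 0 i + c)).
  by apply: CkM; [exact: Ck_cst|exact: IH].
by apply/funext => x; rewrite /partial (@derive_val _ _ _ _ _ _ _ (D x)).
Qed.

Definition line_diff psi :=
  forall x v, is_derive x v psi (\sum_i v 0 i * partial i psi x).

Lemma line_diff_cst (c : R) : line_diff (fun=> c).
Proof.
move=> x v; rewrite big1; first exact: is_derive_cst.
by move=> i _; rewrite /partial derive_cst mulr0.
Qed.

Lemma line_diffD f g : smooth f -> smooth g -> line_diff f -> line_diff g ->
  line_diff (fun x => f x + g x).
Proof.
move=> sf sg lf lg x v; have h := is_deriveD (lf x v) (lg x v).
suff -> : \sum_i v 0 i * partial i (fun x => f x + g x) x =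
  \sum_i v 0 i * partial i f x + \sum_i v 0 i * partial i g x by exact: h.
rewrite -big_split; apply: eq_bigr => i _ /=; rewrite -mulrDr /partial.
have [_ /(_ i) [df _]] := sf 1%N; have [_ /(_ i) [dg _]] := sg 1%N.
by rewrite (deriveD (df x) (dg x)).
Qed.

Lemma line_diffM f g : smooth f -> smooth g -> line_diff f -> line_diff g ->
  line_diff (fun x => f x * g x).
Proof.
move=> sf sg lf lg x v; have h := is_deriveM (lf x v) (lg x v).
suff -> : \sum_i v 0 i * partial i (fun x => f x * g x) x =
  f x *: (\sum_i v 0 i * partial i g x) + g x *: \sum_i v 0 i * partial i f x by exact: h.
rewrite /GRing.scale/= !mulr_sumr -big_split; apply: eq_bigr => i _ /=; rewrite /partial.
have [_ /(_ i) [df _]] := sf 1%N; have [_ /(_ i) [dg _]] := sg 1%N.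
by rewrite (deriveM (df x) (dg x)) /GRing.scale/=; ring.
Qed.

Lemma line_diff_flat P (a c : R) (i : 'I_m) : line_diff (fun x : 'rV[R]_m => flat P (a * x 0 i + c)).
Proof.
move=> x v; have D w := is_derive_comp_coord a c i x w (is_derive_flat P).
suff -> : \sum_j v 0 j * partial j (fun x : 'rV[R]_m => flat P (a * x 0 i + c)) x =
   a * v 0 i * flat ('X^2 * (P - P^`())) (a * x 0 i + c) by exact: D.
rewrite (bigD1 i)//= big1 ?addr0 => [|j ji].
  by rewrite /partial (@derive_val _ _ _ _ _ _ _ (D (delta_mx 0 i))) !mxE !eqxx /=; ring.
by rewrite /partial (@derive_val _ _ _ _ _ _ _ (D (delta_mx 0 j))) !mxE (eq_sym i) (negbTE ji) andbF /=; ring.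
Qed.

(* [line_diff] is carried along because a chain rule along lines is not available
   from the existence of continuous partial derivatives. *)
Definition nice psi := [/\ smooth psi, line_diff psi & forall x, 0 <= psi x <= 1].

Lemma nice1 : nice (fun=> 1).
Proof. by split=> [k||x]; [exact: Ck_cst|exact: line_diff_cst|rewrite ler01 lexx]. Qed.

Lemma niceM f g : nice f -> nice g -> nice (fun x => f x * g x).
Proof.
move=> [sf lf f01] [sg lg g01]; split=> [k||x]; [exact: CkM|exact: line_diffM|].
have /andP[f0 f1] := f01 x; have /andP[g0 g1] := g01 x.
by rewrite mulr_ge0//= mulr_ile1.
Qed.

Lemma nice_compl f : nice f -> nice (fun x => 1 - f x).
Proof.
move=> [sf lf f01].
have sN : smooth (fun x => -1 * f x) by move=> k; apply: CkM => //; exact: Ck_cst.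
have lN : line_diff (fun x => -1 * f x).
  by apply: line_diffM => //; [move=> k; exact: Ck_cst|exact: line_diff_cst].
rewrite (_ : (fun x => 1 - f x) = (fun x => 1 + -1 * f x)); last first.
  by apply/funext => x; rewrite mulN1r.
split=> [k||x].
- by apply: CkD => //; exact: Ck_cst.
- by apply: line_diffD => //; [move=> k; exact: Ck_cst|exact: line_diff_cst].
- by rewrite mulN1r subr_ge0 lerBlDr lerDl andbC; exact: f01.
Qed.

Lemma nice_prod (I : finType) (F : I -> 'rV[R]_m -> R) : (forall i, nice (F i)) ->
  nice (fun x => \prod_i F i x).
Proof.
move=> nF; rewrite (_ : (fun x => _) = \big[(fun f g x => f x * g x)/(fun=> 1)]_i F i).
  by elim/big_ind : _ => [|f g|i _]; [exact: nice1|exact: niceM|exact: nF].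
apply/funext => x; elim/big_rec2: _ => // i f y _ ->; done.
Qed.

(** The function exp(-1/t) on the positive axis. It stays below 1, but its steepened versions
    converge pointwise to the indicator of the positive axis, and dominated convergence asks for
    nothing more. *)
Definition step (t : R) : R := flat 1 t.

Lemma step01 t : 0 <= step t <= 1.
Proof.
rewrite /step /flat; case: ifPn => t0; last by rewrite lexx ler01.
rewrite hornerC mul1r expR_ge0/= -expR0 ler_expR oppr_le0 invr_ge0 ltW//.
Qed.

Lemma step_le0 t : t <= 0 -> step t = 0.
Proof. by rewrite /step /flat leNgt => /negbTE ->. Qed.

Lemma nice_step (a c : R) i : nice (fun x : 'rV[R]_m => step (a * x 0 i + c)).
Proof.
by split=> [k||x]; [exact: Ck_flat|exact: line_diff_flat|exact: step01].
Qed.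

Lemma cvg_step t : 0 < t -> step (n.+1%:R * t) @[n --> \oo] --> (1 : R).
Proof.
move=> t0.
have -> : (fun n : nat => step (n.+1%:R * t)) = (fun n : nat => expR (- t^-1 * n.+1%:R^-1)).
  apply/funext => n; rewrite /step /flat ifT ?mulr_gt0// hornerC mul1r invfM.
  by congr expR; rewrite mulNr mulrC.
have h : - t^-1 * n.+1%:R^-1 @[n --> \oo] --> - t^-1 * (0 : R).
  by apply: cvgM; [exact: cvg_cst|exact: cvg_harmonic].
have E : expR (- t^-1 * 0) = 1 by rewrite mulr0 expR0.
rewrite -[X in _ --> X]E.
by apply: continuous_cvg => //; exact: continuous_expR.
Qed.

End smooth.

(** * Density of test functions in the unit ball of L^oo *)

Section integrable_EFin.
Context d (T : measurableType d) (R : realType) (mu : {measure set T -> \bar R}).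
Variables (D : set T) (mD : measurable D).
Implicit Types f g : T -> R.

Lemma integrableD_EFin f g : mu.-integrable D (EFin \o f) ->
  mu.-integrable D (EFin \o g) -> mu.-integrable D (EFin \o (fun x => f x + g x)).
Proof. by move=> h1 h2; have := integrableD mD h1 h2; exact: eq_integrable. Qed.

Lemma integrableB_EFin f g : mu.-integrable D (EFin \o f) ->
  mu.-integrable D (EFin \o g) -> mu.-integrable D (EFin \o (fun x => f x - g x)).
Proof. by move=> h1 h2; have := integrableB mD h1 h2; exact: eq_integrable. Qed.

Lemma integrableZl_EFin (k : R) f : mu.-integrable D (EFin \o f) ->
  mu.-integrable D (EFin \o (fun x => k * f x)).
Proof. by move=> h1; have := integrableZl mD k h1; exact: eq_integrable. Qed.

Lemma integrable_sum_EFin (I : finType) (F : I -> T -> R) :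
  (forall i, mu.-integrable D (EFin \o F i)) ->
  mu.-integrable D (EFin \o (fun x => \sum_i F i x)).
Proof.
move=> h; have := @integrable_sum _ _ _ mu D mD _ (index_enum I) xpredT (fun i => EFin \o F i).
move=> /(_ (fun i _ => h i)); apply: eq_integrable => // x _.
by rewrite /= sumEFin.
Qed.

Lemma Rintegral_sum (I : finType) (F : I -> T -> R) :
  (forall i, mu.-integrable D (EFin \o F i)) ->
  \int[mu]_(x in D) (\sum_i F i x) = \sum_i \int[mu]_(x in D) F i x.
Proof.
move=> iF; rewrite /Rintegral; under eq_integral do rewrite -sumEFin.
by rewrite integral_sum// sum_fine// => i _; exact: (integrable_fin_num mD (iF i)).
Qed.

End integrable_EFin.

(** * Smooth cutoffs exhausting an open set *)

Section cutoff.
Context {R : realType} (m : nat).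
Implicit Types (x c : 'rV[R]_m) (psi : 'rV[R]_m -> R).

Lemma hausdorff_rV : hausdorff_space 'rV[R]_m.
Proof. exact: norm_hausdorff. Qed.

Definition cube c (r : R) : set 'rV[R]_m := [set x | forall i, `|x 0 i - c 0 i| <= r].

Lemma compact_cube c (r : R) : compact (cube c r).
Proof.
have := @rV_compact R m (fun i => `[c 0 i - r, c 0 i + r]%classic)
  (fun i => @segment_compact _ _ _).
congr compact; apply/seteqP; split=> x /= h i; have := h i; rewrite in_itv/= ler_distl//.
Qed.

Lemma test_function_supp (D K : set 'rV[R]_m) psi : smooth psi -> compact K ->
  K `<=` D -> (forall x, psi x != 0 -> K x) -> test_function D psi.
Proof.
move=> spsi cK KD psiK.
have cl : closure [set x | psi x != 0] `<=` K.
  have /closure_id -> : closed K by apply: compact_closed => //; exact: hausdorff_rV.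
  exact: closureS.
split => //; last exact: subset_trans KD.
by apply: (subclosed_compact _ cK) => //; exact: closed_closure.
Qed.

Lemma open_cubes (A : set 'rV[R]_m) : open A ->
  exists (c : nat -> 'rV[R]_m) (r : nat -> R),
    (forall k, 0 < r k -> cube (c k) (r k) `<=` A) /\
    forall x, A x -> exists2 k, 0 < r k & forall i, `|x 0 i - c k 0 i| < r k.
Proof.
move=> oA.
pose q (u : 'rV[rat]_m * nat) : 'rV[R]_m := \row_i ratr (u.1 0 i).
pose good (u : 'rV[rat]_m * nat) := cube (q u) u.2.+1%:R^-1 `<=` A.
pose u0 k : 'rV[rat]_m * nat := if @unpickle ('rV[rat]_m * nat)%type k is Some u then u else (0, 0%N).
(* Radius 0 is a dummy value marking the indices whose cube is not contained in [A]; this explains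
   the tests [0 < r k]. *)
exists (fun k => q (u0 k)), (fun k => if pselect (good (u0 k)) then (u0 k).2.+1%:R^-1 else 0).
split=> [k|x Ax]; first by case: pselect => // ?; rewrite ltxx.
have [e /= e0 eA] := (nbhs_ballP _ _).1 (oA _ Ax).
have e20 : 0 < e / 2 by rewrite divr_gt0.
have [k _ /(_ k (leqnn k)) /= ke] := near_infty_natSinv_lt (PosNum e20).
have k0 : 0 < k.+1%:R^-1 :> R by rewrite invr_gt0.
have /choice[y hy] i : exists y : rat, `|x 0 i - ratr y| < k.+1%:R^-1.
  have : x 0 i - k.+1%:R^-1 < x 0 i + k.+1%:R^-1.
    by rewrite ltrBlDr -addrA ltrDl addr_gt0.
  move=> /rat_in_itvoo[y]; rewrite in_itv/= => /andP[q1 q2]; exists y.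
  by rewrite distrC ltr_distl q1 q2.
pose u : 'rV[rat]_m * nat := (\row_i y i, k).
have gu : good u.
  move=> z h; apply: eA; apply/ball_rV; split => // i.
  have := h i; have := hy i; rewrite /q /u/= !mxE => h1 h2.
  rewrite (le_lt_trans (ler_distD (ratr (y i)) _ _))// [e]splitr.
  rewrite ltr_leD//; first exact: lt_trans ke.
  by rewrite distrC (le_trans h2)// ltW.
exists (pickle u); rewrite /u0 pickleK; first by case: pselect.
by case: pselect => [?|//] i; rewrite /q /u/= !mxE; exact: hy.
Qed.

(** One steep step for each face of the cube; as [j] grows this tends to 1 inside. The value 0 for a
    nonpositive radius makes the dummy cubes of [open_cubes] harmless. *)
Definition cubebump (j : nat) c (r : R) x : R :=
  if 0 < r then
    \prod_i (step (j.+1%:R * x 0 i + j.+1%:R * (r - c 0 i)) *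
             step (- j.+1%:R * x 0 i + j.+1%:R * (r + c 0 i)))
  else 0.

Lemma nice0 : nice (fun _ : 'rV[R]_m => 0).
Proof. by have := nice_compl (@nice1 R m); under eq_fun do rewrite subrr. Qed.

Lemma nice_cubebump j c r : nice (cubebump j c r).
Proof.
rewrite /cubebump; case: (0 < r); last exact: nice0.
by apply: nice_prod => i; apply: niceM; exact: nice_step.
Qed.

Lemma cubebump_supp j c r x : cubebump j c r x != 0 -> 0 < r /\ forall i, `|x 0 i - c 0 i| < r.
Proof.
rewrite /cubebump; case: ifPn => [r0 /prodf_neq0 h|]; last by rewrite eqxx.
split=> // i; have := h i isT; rewrite mulf_eq0 negb_or => /andP[h1 h2].
rewrite ltr_distl; apply/andP; split.
  rewrite ltNge; apply: contra h1 => xi; rewrite step_le0// -mulrDr.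
  by rewrite pmulr_rle0//; lra.
rewrite ltNge; apply: contra h2 => xi; rewrite step_le0// mulNr -mulrN -mulrDr.
by rewrite pmulr_rle0//; lra.
Qed.

Lemma cvg_prod1 (I : finType) (F : I -> nat -> R) :
  (forall i, F i n @[n --> \oo] --> (1 : R)) -> \prod_i F i n @[n --> \oo] --> (1 : R).
Proof.
move=> h; rewrite (_ : (fun n => _) = \big[(fun f g n => f n * g n)/(fun=> 1)]_i F i).
  elim/big_ind : _ => [|f g hf hg|i _]; [exact: cvg_cst| |exact: h].
  by rewrite -[X in _ --> X](mulr1 1); exact: cvgM.
apply/funext => n; elim/big_rec2: _ => // i f y _ ->; done.
Qed.

Lemma cvg_cubebump c r x : 0 < r -> (forall i, `|x 0 i - c 0 i| < r) ->
  cubebump j c r x @[j --> \oo] --> (1 : R).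
Proof.
move=> r0 h; rewrite /cubebump r0; apply: cvg_prod1 => i.
have := h i; rewrite ltr_distl => /andP[h1 h2].
rewrite -[X in _ --> X](mulr1 1); apply: cvgM.
  under eq_fun do rewrite -mulrDr; apply: cvg_step; lra.
under eq_fun do rewrite mulNr -mulrN -mulrDr; apply: cvg_step; lra.
Qed.

(** The function 1 - prod (1 - bump) over the first [j] cubes is a smooth form of the indicator of
    their union: its support lies in finitely many compact cubes, and at each point of [A] a single
    bump tending to 1 drives the product to 0. *)
Lemma cutoffs (A : set 'rV[R]_m) : open A -> exists chi : nat -> 'rV[R]_m -> R,
  [/\ forall j, nice (chi j), forall j, exists K : set 'rV[R]_m, [/\ compact K, K `<=` A &
      forall x, chi j x != 0 -> K x] &
      forall x, A x -> chi j x @[j --> \oo] --> (1 : R)].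
Proof.
move=> oA; have [c [r [cA covA]]] := open_cubes oA.
pose P j x := \prod_(k < j) (1 - cubebump j (c k) (r k) x).
have nP j : nice (P j) by apply: nice_prod => k; apply: nice_compl; exact: nice_cubebump.
exists (fun j x => 1 - P j x); split=> [j|j|x Ax]; first exact: nice_compl.
  exists (\big[setU/set0]_(k < j) (if pselect (0 < r k) then
     cube (c k) (r k) else set0)); split.
  - elim/big_ind : _ => [|B C cB cC|k _]; [exact: compact0|exact: compactU|].
    by case: pselect => ?; [exact: compact_cube|exact: compact0].
  - elim/big_ind : _ => [//|B C BA CA|k _]; first by rewrite subUset.
    by case: pselect => [r0|?]; [exact: cA|exact: sub0set].
  - move=> x; apply: contra_neqP; rewrite -bigcup_seq => nx.
    rewrite /P big1 ?subrr// => k _; have [->|/cubebump_supp[r0 h]] := eqVneq (cubebump j (c k) (r k) x) 0.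
      by rewrite subr0.
    exfalso; apply: nx; exists k => /=; first by rewrite mem_index_enum.
    by case: pselect => // ? i /=; rewrite ltW.
have [k r0 hk] := covA _ Ax.
have B1 := cvg_cubebump r0 hk.
apply: (@squeeze_cvgr _ _ _ _ (fun j => cubebump j (c k) (r k) x) (cst 1)) => //; last exact: cvg_cst.
near=> j; have [_ _ /(_ x) /andP[P0 _]] := nP j.
rewrite lerBlDr lerDl P0 andbT lerBrDr addrC -lerBrDr.
have kj : (k < j)%N by near: j; exact: nbhs_infty_gt.
rewrite /P (bigD1 (Ordinal kj))//=.
have b01 i : 0 <= 1 - cubebump j (c i) (r i) x <= 1.
  by have [_ _ /(_ x)] := nice_compl (nice_cubebump j (c i) (r i)).
rewrite ler_piMr//; first by case/andP: (b01 k).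
by apply: prodr_ile1 => i _; exact: b01.
Unshelve. all: by end_near. Qed.

End cutoff.

Section density.
Context {R : realType} (m : nat).
Local Notation mu := (@lebesgue_rV R m).
Variables (D : set 'rV[R]_m) (w : 'rV[R]_m -> R).
Hypothesis mD : measurable D.
Hypothesis w0 : forall x, 0 <= w x.
Hypothesis iw : mu.-integrable D (EFin \o w).

Let mw : measurable_fun D w.
Proof. by move/integrableP : iw => [/measurable_EFinP]. Qed.

(* The L^1(w) closure of the nice functions. *)
Let approx (u : 'rV[R]_m -> R) := [/\ measurable_fun [set: 'rV[R]_m] u,
  (forall x, 0 <= u x <= 1) &
  forall e : R, 0 < e -> exists2 phi, nice phi &
    (\int[mu]_(x in D) (w x * `|u x - phi x|)%:E <= e%:E)%E].

Lemma measurable_continuous_rV (f : 'rV[R]_m -> R) :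
  continuous f -> measurable_fun [set: 'rV[R]_m] f.
Proof.
move=> cf; apply: (measurability _ (RGenOpens.measurableE R)).
move=> _ [_ [a [b ->]] <-]; rewrite setTI.
have : open (f @^-1` `]a, b[) by apply: open_comp => // x _; exact: cf.
by move=> o; rewrite measurable_rV_open; exact: sub_sigma_algebra.
Qed.

Lemma measurable_nice (f : 'rV[R]_m -> R) : nice f -> measurable_fun [set: 'rV[R]_m] f.
Proof. by move=> [/(_ 0%N) /Ck_continuous cf _ _]; exact: measurable_continuous_rV. Qed.

Let approx_nice phi : nice phi -> approx phi.
Proof.
move=> nphi; split; [exact: measurable_nice|by case: nphi|move=> e e0].
exists phi => //; under eq_integral do rewrite subrr normr0 mulr0.
by rewrite integral0 lee_fin ltW.
Qed.

Let m1 (u v : 'rV[R]_m -> R) : measurable_fun [set: 'rV[R]_m] u ->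
  measurable_fun [set: 'rV[R]_m] v -> measurable_fun D (fun x => (w x * `|u x - v x|)%:E).
Proof.
move=> mu_ mv; apply/measurable_EFinP; apply: measurable_funM => //.
apply: (measurableT_comp (@normr_measurable _ _)); apply: measurable_funB.
  exact: measurable_funTS.
exact: measurable_funTS.
Qed.

Let approx_compl u : approx u -> approx (fun x => 1 - u x).
Proof.
move=> [mu_ u01 h]; split; first exact: measurable_funB.
  by move=> x; have := u01 x; lra.
move=> e /h[phi nphi H]; exists (fun x => 1 - phi x); first exact: nice_compl.
apply: le_trans H; rewrite le_eqVlt; apply/orP; left; apply/eqP.
by apply: eq_integral => x _; congr (_ * _)%:E; rewrite distrC; congr `|_|; ring.
Qed.

Let approxM u v : approx u -> approx v -> approx (fun x => u x * v x).
Proof.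
move=> [mu_ u01 hu] [mv v01 hv]; split; first exact: measurable_funM.
  by move=> x; have /andP[? ?] := u01 x; have /andP[? ?] := v01 x; rewrite mulr_ge0//= mulr_ile1.
move=> e e0; have e20 : 0 < e / 2 by rewrite divr_gt0.
have [phi nphi Hphi] := hu _ e20; have [psi npsi Hpsi] := hv _ e20.
exists (fun x => phi x * psi x); first exact: niceM.
rewrite [e]splitr EFinD; apply: le_trans (leeD Hphi Hpsi).
have mphi := measurable_nice nphi; have mpsi := measurable_nice npsi.
rewrite -ge0_integralD//; first last.
- exact: m1.
- by move=> x _; rewrite lee_fin mulr_ge0.
- exact: m1.
- by move=> x _; rewrite lee_fin mulr_ge0.
apply: ge0_le_integral => //.
- by move=> x _; rewrite lee_fin mulr_ge0.
- by apply: m1; exact: measurable_funM.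
- by apply: emeasurable_funD; exact: m1.
move=> x _; rewrite -EFinD lee_fin -mulrDr ler_wpM2l//.
have /andP[? ?] := u01 x; have /andP[? ?] := v01 x.
have [_ _ /(_ x) /andP[? ?]] := nphi; have [_ _ /(_ x) /andP[? ?]] := npsi.
have -> : u x * v x - phi x * psi x = (u x - phi x) * v x + phi x * (v x - psi x) by ring.
rewrite (le_trans (ler_normD _ _))// lerD// normrM.
  by rewrite ler_piMr// ger0_norm.
by rewrite ler_piMl// ger0_norm.
Qed.

(** Dominated convergence, with [w] as the dominating function since all values lie in [0, 1]. Half
    of [e] goes to the limit, half to the nice function approximating [u_ n]. *)
Let approx_lim u (u_ : nat -> 'rV[R]_m -> R) : (forall n, approx (u_ n)) ->
  (forall x, u_ n x @[n --> \oo] --> u x) -> approx u.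
Proof.
move=> au uu.
have mu_ : measurable_fun [set: 'rV[R]_m] u.
  apply: (measurable_fun_cvg (h := u_)) => [n|x _]; last exact: uu.
  by case: (au n).
have u01 x : 0 <= u x <= 1.
  apply/andP; split.
    apply: (cvgr_to_ge (uu x)).
    by apply: nearW => n; have [_ /(_ x) /andP[]] := au n.
  apply: (cvgr_to_le (uu x)).
  by apply: nearW => n; have [_ /(_ x) /andP[]] := au n.
split => // e e0; have e20 : 0 < e / 2 by rewrite divr_gt0.
have mau n : measurable_fun [set: 'rV[R]_m] (u_ n) by case: (au n).
have H : ((fun n => \int[mu]_(x in D) (w x * `|u x - u_ n x|)%:E) @ \oo --> 0)%E.
  have /= := @dominated_convergence _ _ _ mu D mD
    (fun n x => (w x * `|u x - u_ n x|)%:E) (cst 0%E) (EFin \o w)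
    (fun n => m1 mu_ (mau n)) (measurable_cst _).
  case=> [|||_ _].
  - apply/aeW => x Dx; apply: cvg_EFin; first exact: nearW.
    rewrite -(mulr0 (w x)); apply: cvgM; first exact: cvg_cst.
    rewrite -(@normr0 _ R) -(subrr (u x)); apply: cvg_norm.
    by apply: cvgB; [exact: cvg_cst|exact: uu].
  - exact: iw.
  - apply/aeW => x n Dx; rewrite lee_fin ger0_norm ?mulr_ge0// ler_piMr//.
    by have := u01 x; have [_ /(_ x) ? _] := au n; rewrite ler_norml; lra.
  - by rewrite integral0.
have [n Hn] : exists n, (\int[mu]_(x in D) (w x * `|u x - u_ n x|)%:E <= (e / 2)%:E)%E.
  have := H; move/fine_cvgP => [[N _ fN]].
  move/cvgrPdist_le => /(_ _ e20)[M _ hM]; exists (maxn N M).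
  have f1 := fN (maxn N M) (leq_maxl _ _).
  have := hM (maxn N M) (leq_maxr _ _); rewrite /= sub0r normrN => h.
  by rewrite -(fineK f1) lee_fin (le_trans (ler_norm _)).
have [phi nphi hphi] : exists2 phi, nice phi &
    (\int[mu]_(x in D) (w x * `|u_ n x - phi x|)%:E <= (e / 2)%:E)%E.
  by have [_ _] := au n; apply.
exists phi => //; rewrite [e]splitr EFinD; apply: le_trans (leeD Hn hphi).
have mphi := measurable_nice nphi.
rewrite -ge0_integralD//; first last.
- exact: m1.
- by move=> x _; rewrite lee_fin mulr_ge0.
- exact: m1.
- by move=> x _; rewrite lee_fin mulr_ge0.
apply: ge0_le_integral => //.
- by move=> x _; rewrite lee_fin mulr_ge0.
- exact: m1.
- by apply: emeasurable_funD; exact: m1.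
move=> x _; rewrite -EFinD lee_fin -mulrDr ler_wpM2l//.
exact: ler_distD.
Qed.

(** The sets with an approximable indicator form a sigma-algebra: complements through 1 - u,
    countable unions as limits of 1 - prod (1 - u_k), which uses stability under products. *)
Let approx_indic E : measurable E -> approx (\1_E).
Proof.
pose S := [set E | approx (\1_E)].
have ap0 : approx (\1_set0).
  by rewrite indic0; exact/approx_nice/nice0.
have SC A : S A -> S (~` A).
  move=> /approx_compl; rewrite /S/=.
  rewrite (_ : (fun x => _) = \1_(~` A))//; apply/funext => x.
  by rewrite !indicE in_setC; case: (x \in A); rewrite /= ?subrr ?subr0.
have SU (F : (set 'rV[R]_m)^nat) : (forall n, S (F n)) -> S (\bigcup_k F k).
  move=> SF; apply: (@approx_lim _ (fun n x => 1 - \prod_(k < n) (1 - \1_(F k) x))) => [n|x].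
    apply: approx_compl.
    elim: n => [|n IH]; first by under eq_fun do rewrite big_ord0; exact/approx_nice/nice1.
    under eq_fun do rewrite big_ord_recr/=.
    by apply: approxM => //; apply: approx_compl; exact: SF.
  have [[k _ Fkx]|nF] := pselect ((\bigcup_k F k) x).
    apply: cvg_near_cst; near=> n.
    have kn : (k < n)%N by near: n; exact: nbhs_infty_gt.
    rewrite (bigD1 (Ordinal kn))//= !indicE !mem_set//; last by exists k.
    by rewrite subrr mul0r subr0.
  rewrite indicE memNset//; apply: cvg_near_cst; near=> n.
  rewrite big1 ?subrr// => i _; rewrite indicE memNset ?subr0// => Fix.
  by apply: nF; exists (i : nat).
(* Coordinate half-spaces are limits of steepening steps, and they generate the product
   sigma-algebra. *)
have Sray i (a : R) : S ((fun x : 'rV[R]_m => x 0 i) @^-1` `]a, +oo[).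
  apply: (@approx_lim _ (fun n x => step (n.+1%:R * x 0 i + n.+1%:R * - a))) => [n|x].
    by apply: approx_nice; exact: nice_step.
  under eq_fun do rewrite -mulrDr.
  rewrite indicE; have [ax|xa] := ltP a (x 0 i).
    by rewrite mem_set /= ?in_itv/= ?ax//; apply: cvg_step; rewrite subr_gt0.
  rewrite memNset/= ?in_itv/= ?andbT; last by apply/negP; rewrite -leNgt.
  apply: cvg_near_cst; near=> n; rewrite step_le0//.
  by rewrite pmulr_rle0// subr_le0.
suff : measurable `<=` S by apply.
apply: smallest_sub.
  split=> [//|A|]; last exact: SU.
  by rewrite setTD; exact: SC.
move=> A; rewrite -bigcup_seq => -[i _ [B mB <-]]; rewrite setTI.
have mB' : (@RGenOInfty.G R).-sigma.-measurable B by rewrite -RGenOInfty.measurableE.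
suff : (@RGenOInfty.G R).-sigma.-measurable `<=` [set Y | S ((fun x : 'rV[R]_m => x 0 i) @^-1` Y)].
  by apply.
apply: smallest_sub.
  split=> [|C|F SF].
  - by rewrite /= preimage_set0.
  - by move=> /SC; rewrite preimage_setC setTD.
  - by rewrite /= preimage_bigcup; exact: SU.
by move=> C [a ->]; exact: Sray.
Unshelve. all: by end_near. Qed.

Lemma indic_nice_approx E (e : R) : measurable E -> 0 < e -> exists2 phi, nice phi &
    (\int[mu]_(x in D) (w x * `|\1_E x - phi x|)%:E <= e%:E)%E.
Proof. by move=> /approx_indic[_ _]; apply. Qed.

End density.

Section test_density.
Context {R : realType} (m : nat).
Local Notation mu := (@lebesgue_rV R m).

Lemma measurable_open_rV (D : set 'rV[R]_m) : open D -> measurable D.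
Proof. by move=> oD; rewrite measurable_rV_open; exact: sub_sigma_algebra. Qed.

Lemma integrable_mul_bounded (D : set 'rV[R]_m) (g psi : 'rV[R]_m -> R) (M : R) :
  measurable D -> mu.-integrable D (EFin \o g) ->
  measurable_fun D psi -> (forall x, D x -> `|psi x| <= M) ->
  mu.-integrable D (EFin \o (fun x => g x * psi x)).
Proof.
move=> mD ig mpsi psiM.
have mg : measurable_fun D g by move/integrableP : ig => [/measurable_EFinP].
apply: (@le_integrable _ _ _ _ _ mD _ (fun x => `|M|%:E * (EFin \o g) x)%E).
- by apply/measurable_EFinP; exact: measurable_funM.
- move=> x Dx /=; rewrite lee_fin !normrM normr_id mulrC ler_wpM2r//.
  by rewrite (le_trans (psiM _ Dx))// ler_norm.
- exact: integrableZl.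
Qed.

(** [psi] imitates the sign of [g]: an approximate indicator of the set where [g] is nonnegative,
    rescaled to [-1, 1] and multiplied by a cutoff with compact support in [D]. *)
Lemma test_density (D : set 'rV[R]_m) (g : 'rV[R]_m -> R) (e : R) :
  open D -> mu.-integrable D (EFin \o g) -> 0 < e ->
  exists psi, [/\ test_function D psi, line_diff psi, forall x, `|psi x| <= 1 &
    \int[mu]_(x in D) `|g x| <= \int[mu]_(x in D) (g x * psi x) + e].
Proof.
move=> oD ig e0; have mD := measurable_open_rV oD.
have mg : measurable_fun D g by move/integrableP : ig => [/measurable_EFinP].
have iw := integrable_norm ig.
have mE : measurable (D `&` [set x | 0 <= g x]).
  by have := mg mD `[0, +oo[%classic (measurable_itv _); congr measurable;
    apply/seteqP; split => x /=; rewrite in_itv/= andbT.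
(* A quarter of [e]: the error of [phi] counts twice, because it enters through 2 phi - 1, and the
   error of the cutoff once. *)
have e30 : 0 < e / 4 by rewrite divr_gt0.
have [phi nphi hphi] := indic_nice_approx mD (fun x => normr_ge0 (g x)) iw mE e30.
have [chi [nchi suppchi cvgchi]] := cutoffs oD.
have mphi := measurable_nice nphi.
have mchi j := measurable_nice (nchi j).
have [j hj] : exists j, \int[mu]_(x in D) (`|g x| * (1 - chi j x)) <= e / 4.
  have mf j : measurable_fun D (fun x => (`|g x| * (1 - chi j x))%:E).
    apply/measurable_EFinP/measurable_funM; first exact: measurableT_comp.
    by apply: measurable_funB => //; exact: measurable_funTS.
  have /= := @dominated_convergence _ _ _ mu D mD
    (fun j x => (`|g x| * (1 - chi j x))%:E) (cst 0%E) (EFin \o (fun x => `|g x|)) mf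
    (measurable_cst _).
  case=> [|||_ _].
  - apply/aeW => x Dx; apply: cvg_EFin; first exact: nearW.
    rewrite -(mulr0 `|g x|); apply: cvgM; first exact: cvg_cst.
    rewrite -(subrr 1); apply: cvgB; [exact: cvg_cst|exact: cvgchi].
  - exact: iw.
  - apply/aeW => x j Dx; have [_ _ /(_ x) ?] := nchi j.
    by rewrite lee_fin normrM normr_id ler_piMr// ler_norml; lra.
  rewrite integral0 => /fine_cvgP[_ /cvgrPdist_le /(_ _ e30)[M _ hM]].
  exists M; have := hM _ (leqnn M); rewrite /= sub0r normrN => h.
  exact: le_trans (ler_norm _) h.
have [K [cK KD chiK]] := suppchi j.
have [sphi lphi phi01] := nphi; have [schi lchi chi01] := nchi j.
(* This is 2 phi - 1, written as a sum so that [CkD] and [line_diffD] apply. *)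
pose p x := phi x + (phi x + -1).
have sp : smooth p by move=> k; do 2! apply: CkD => //; exact: Ck_cst.
have spp : smooth (fun x => phi x + -1) by move=> k; apply: CkD => //; exact: Ck_cst.
have lp : line_diff p.
  do 2! (apply: line_diffD => //).
    by move=> k; exact: Ck_cst.
  exact: line_diff_cst.
have spsi : smooth (fun x => p x * chi j x) by move=> k; exact: CkM.
have psi1 x : `|p x * chi j x| <= 1.
  rewrite normrM mulr_ile1//.
    by rewrite /p ler_norml; have := phi01 x; lra.
  by rewrite ler_norml; have := chi01 x; lra.
exists (fun x => p x * chi j x); split => //.
- apply: (@test_function_supp _ _ D K) => // x; rewrite mulf_eq0 negb_or => /andP[_].
  exact: chiK.
- exact: line_diffM.
have mpsi : measurable_fun D (fun x => p x * chi j x).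
  apply: measurable_funTS; apply: measurable_continuous_rV.
  exact: (Ck_continuous (spsi 0%N)).
have i1 : mu.-integrable D (EFin \o (fun x => g x * (p x * chi j x))).
  exact: (@integrable_mul_bounded _ _ _ 1).
have i2 : mu.-integrable D (EFin \o (fun x => `|g x| * (1 - chi j x))).
  apply: (@integrable_mul_bounded _ _ _ 1) => //.
    by apply: measurable_funB => //; exact: measurable_funTS.
  by move=> x _; rewrite ler_norml; have := chi01 x; lra.
have i3 : mu.-integrable D (EFin \o (fun x => `|g x| * `|\1_(D `&` [set x | 0 <= g x]) x - phi x|)).
  apply: (@integrable_mul_bounded _ _ _ 1) => //.
    apply: measurableT_comp => //; apply: measurable_funB; last exact: measurable_funTS.
    by apply: measurable_indic.
  move=> x _; rewrite normr_id ler_norml indicE; have := phi01 x.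
  by case: (_ \in _) => /=; lra.
have h3 : \int[mu]_(x in D) (`|g x| * `|\1_(D `&` [set x | 0 <= g x]) x - phi x|) <= e / 4.
  by rewrite -lee_fin /Rintegral fineK//; exact: integrable_fin_num.
(* A pointwise bound: the loss in replacing the exact sign by [psi] is at most [|g|] times (1 - chi)
   plus twice the error of [phi]. *)
apply: (@le_trans _ _ (\int[mu]_(x in D) (g x * (p x * chi j x) +
    (`|g x| * (1 - chi j x) + 2 * (`|g x| * `|\1_(D `&` [set x | 0 <= g x]) x - phi x|))))).
  apply: le_Rintegral => //.
    by apply: integrableD_EFin => //; apply: integrableD_EFin => //; exact: integrableZl_EFin.
  move=> x Dx; rewrite indicE.
  have := phi01 x; have := chi01 x; rewrite /p.
  have [gx|gx] := leP 0 (g x).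
    rewrite mem_set//= (ger0_norm gx) => /andP[c0 c1] /andP[p0 p1].
    rewrite ger0_norm ?subr_ge0//.
    have : 0 <= g x * ((1 - phi x) * (1 - chi j x)) by rewrite !mulr_ge0// subr_ge0.
    by move=> h; nra.
  rewrite memNset/=; last by case => _ /=; rewrite leNgt gx.
  rewrite (ltr0_norm gx) => /andP[c0 c1] /andP[p0 p1].
  rewrite sub0r normrN ger0_norm//.
  have : 0 <= - g x * (phi x * (1 - chi j x)) by rewrite !mulr_ge0// ?subr_ge0// oppr_ge0 ltW.
  by move=> h; nra.
rewrite RintegralD//; last first.
  by apply: integrableD_EFin => //; exact: integrableZl_EFin.
rewrite lerD2l RintegralD//; last exact: integrableZl_EFin.
rewrite RintegralZl//.
by lra.
Qed.

End test_density.

(** * Difference estimate and Poincare inequality *)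

Section test_functions.
Context {R : realType} (m : nat).
Local Notation mu := (@lebesgue_rV R m).
Implicit Types (D : set 'rV[R]_m) (psi phi : 'rV[R]_m -> R) (v x : 'rV[R]_m).

Lemma smooth_partial i psi : smooth psi -> smooth (partial i psi).
Proof. by move=> s k; have [_ /(_ i)[]] := s k.+1. Qed.

Lemma smooth_derivable i psi x : smooth psi -> derivable psi x (delta_mx 0 i).
Proof. by move=> s; have [_ /(_ i)[+ _]] := s 1%N; exact. Qed.

Lemma smooth_continuous psi : smooth psi -> continuous psi.
Proof. by move=> s; exact: (Ck_continuous (s 0%N)). Qed.

Lemma test_function_partial D i psi : test_function D psi -> test_function D (partial i psi).
Proof.
move=> [s cK KD]; apply: (test_function_supp (smooth_partial i s) cK KD) => x.
apply: contra_neqP => nK.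
have oC : open (~` closure [set x | psi x != 0]).
  by apply: closed_openC; exact: closed_closure.
have h : \near x, (fun=> 0) x = psi x.
  have := oC _ nK; apply: filterS => y ny.
  by apply/esym/eqP/negPn/negP => py; apply: ny; exact: subset_closure.
by rewrite /partial -(near_eq_derive _ h) derive_cst.
Qed.

Lemma test_function_bounded D psi : test_function D psi ->
  exists2 M, 0 <= M & forall x, `|psi x| <= M.
Proof.
move=> [s cK _]; have cpsi := smooth_continuous s.
have : bounded_set (psi @` closure [set x | psi x != 0]).
  apply: compact_bounded; apply: continuous_compact cK.
  exact: continuous_subspaceT.
move=> [M [_ /(_ (M + 1))]]; rewrite ltrDl ltr01 => /(_ isT) hM.
exists (Num.max (M + 1) 0); first by rewrite le_max lexx orbT.
move=> x; have [->|px] := eqVneq (psi x) 0; first by rewrite normr0 le_max lexx orbT.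
by rewrite le_max (hM (psi x))//; exists x => //; exact: subset_closure.
Qed.

Lemma test_function_supp0 D psi x : test_function D psi -> ~ D x -> psi x = 0.
Proof.
move=> [_ _ h] nD; apply/eqP/negPn/negP => px; apply: nD.
by apply: h; exact: subset_closure.
Qed.

Lemma test_functionS D D' psi : D `<=` D' -> test_function D psi -> test_function D' psi.
Proof. by move=> DD [s c h]; split => //; exact: subset_trans DD. Qed.

Lemma continuous_shift_rV psi v : continuous psi -> continuous (fun x => psi (x - v)).
Proof.
move=> cpsi x; apply: (@continuous_comp _ _ _ (fun x : 'rV[R]_m => x - v) psi); last exact: cpsi.
by apply: (@cvgB _ _ _ _ (nbhs_filter x)); [exact: cvg_id|exact: cvg_cst].
Qed.

Lemma derive_shift_rV psi v w x : 'D_w (fun x => psi (x - v)) x = 'D_w psi (x - v).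
Proof.
rewrite /derive; set g1 := fun h => h^-1 *: _; set g2 := fun h => h^-1 *: _.
by suff -> : g1 = g2 by []; apply/funext => h; rewrite /g1 /g2 /= addrA.
Qed.

Lemma Ck_shift k psi v : Ck k psi -> Ck k (fun x => psi (x - v)).
Proof.
elim: k psi => [|k IH] psi.
  by case=> c _; split => //; exact: continuous_shift_rV.
case=> c h; split; first exact: continuous_shift_rV.
move=> i; have [d ck] := h i; split.
  move=> x; have := d (x - v); rewrite /derivable.
  by under [in X in _ -> X]eq_fun do rewrite /= -addrA.
rewrite (_ : partial i _ = fun x => partial i psi (x - v)); first exact: IH.
by apply/funext => x; rewrite /partial derive_shift_rV.
Qed.

Lemma test_function_shift D D' psi v : test_function D psi ->
  (forall x, D x -> D' (x + v)) -> test_function D' (fun x => psi (x - v)).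
Proof.
move=> [s cK KD] DD'.
apply: (@test_function_supp _ _ D' ((fun x => x + v) @` closure [set x | psi x != 0])).
- by move=> k; exact: Ck_shift.
- apply: continuous_compact cK; apply: continuous_subspaceT => x.
  by apply: (@cvgD _ _ _ _ (nbhs_filter x)); [exact: cvg_id|exact: cvg_cst].
- by move=> _ [x Kx <-]; apply: DD'; exact: KD.
- move=> x px; exists (x - v); last by rewrite subrK.
  exact: subset_closure.
Qed.

Lemma measurable_test D psi : test_function D psi -> measurable_fun [set: 'rV[R]_m] psi.
Proof. by move=> [s _ _]; apply: measurable_continuous_rV; exact: smooth_continuous. Qed.

Lemma integrable_test D E (g : 'rV[R]_m -> R) psi : measurable E ->
  mu.-integrable E (EFin \o g) -> test_function D psi ->
  mu.-integrable E (EFin \o (fun x => g x * psi x)).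
Proof.
move=> mE ig tp; have [M _ hM] := test_function_bounded tp.
apply: (@integrable_mul_bounded _ _ _ _ _ M) => //.
exact: measurable_funTS (measurable_test tp).
Qed.

End test_functions.

Section difference.
Context {R : realType} (m : nat).
Local Notation mu := (@lebesgue_rV R m).
Variables (U : set 'rV[R]_m) (h : 'rV[R]_m -> R) (dh : 'I_m -> 'rV[R]_m -> R).
Hypothesis oU : open U.
Hypothesis ih : mu.-integrable U (EFin \o h).
Hypothesis idh : forall i, mu.-integrable U (EFin \o dh i).
Hypothesis hdh : forall i, weak_partial U i h (dh i).

Let mU : measurable U. Proof. exact: measurable_open_rV. Qed.

(* The derivative in [s] of [int h(x) psi(x - s v) dx] is moved onto [h] by the
   definition of the weak derivative; the mean value theorem then bounds the increment. *)
Lemma weak_partial_line_bound (A B : set 'rV[R]_m) (v : 'rV[R]_m) psi :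
  measurable B -> B `<=` U ->
  (forall x s, 0 <= s <= 1 -> A x -> B (x + s *: v)) ->
  test_function A psi -> line_diff psi -> (forall x, `|psi x| <= 1) ->
  `| \int[mu]_(x in U) (h x * psi (x - v)) - \int[mu]_(x in U) (h x * psi x) | <=
  \sum_i `|v 0 i| * \int[mu]_(x in B) `|dh i x|.
Proof.
move=> mB BU AB tpsi lpsi psi1.
pose f (s : R) x := h x * psi (x - s *: v).
pose dpsi x := \sum_i v 0 i * partial i psi x.
have tp i : test_function A (partial i psi) by exact: test_function_partial.
have [M M0 hM] : exists2 M, 0 <= M & forall x, `|dpsi x| <= M.
  have /choice[N hN] : forall i, exists M, forall x, `|partial i psi x| <= M.
    by move=> i; have [M _ ?] := test_function_bounded (tp i); exists M.
  exists (\sum_i `|v 0 i * N i|); first exact: sumr_ge0.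
  move=> x; rewrite (le_trans (ler_norm_sum _ _ _))//; apply: ler_sum => i _.
  by rewrite !normrM ler_wpM2l// (le_trans (hN i x))// ler_norm.
have df (s : R) x : is_derive s 1 (f ^~ x) (h x * - dpsi (x - s *: v)).
  have D : is_derive s 1 (fun t : R => psi (t *: - v + x)) (- dpsi (x - s *: v)).
    apply: is_derive_line_shift.
    suff -> : - dpsi (x - s *: v) = \sum_i (- v) 0 i * partial i psi (s *: - v + x) by exact: lpsi.
    rewrite -sumrN; apply: eq_bigr => i _; rewrite mxE mulNr scalerN addrC; done.
  have -> : f ^~ x = (fun t => h x *: psi (t *: - v + x)).
    by apply/funext => t; rewrite /f scalerN addrC.
  exact: is_deriveZ.
have mshift s : measurable_fun [set: 'rV[R]_m] (fun x => psi (x - s *: v)).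
  by apply: measurable_continuous_rV; apply: continuous_shift_rV; apply: smooth_continuous; case: tpsi.
have intf s : mu.-integrable U (EFin \o f s).
  apply: (@integrable_mul_bounded _ _ _ _ _ 1) => //.
  exact: measurable_funTS.
pose F s := \int[mu]_(x in U) f s x.
pose dF s := \int[mu]_(x in U) (h x * - dpsi (x - s *: v)).
(* Differentiation under the integral sign, with dominating function [M * |h|], as [M] bounds the
   directional derivative of [psi]. *)
have DF (s : R) : is_derive s 1 F (dF s).
  have Is : `]s - 1, s + 1[%classic s by rewrite /= in_itv/= ltrBlDr !ltrDl !ltr01.
  have derf t x : `]s - 1, s + 1[%classic t -> U x -> derivable (f ^~ x) t 1.
    by move=> _ _; exact: (@ex_derive _ _ _ _ _ _ _ (df t x)).
  have iG : mu.-integrable U (EFin \o (fun x => M * `|h x|)).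
    apply: integrableZl_EFin => //; exact: integrable_norm.
  have G0 x : 0 <= M * `|h x| by rewrite mulr_ge0.
  have dE t x : partial1of2 f t x = h x * - dpsi (x - t *: v).
    by rewrite partial1of2E (@derive_val _ _ _ _ _ _ _ (df t x)).
  have Gub t x : `]s - 1, s + 1[%classic t -> U x -> `|partial1of2 f t x| <= M * `|h x|.
    by move=> _ _; rewrite dE normrM normrN mulrC ler_wpM2r.
  split.
    exact: (derivable_under_integral mU Is (fun t _ => intf t) derf G0 iG Gub).
  rewrite -derive1E.
  rewrite (differentiation_under_integral mU Is (fun t _ => intf t) derf G0 iG Gub).
  by apply: eq_Rintegral => x _; rewrite dE.
(* For [s] in [0, 1] the translate of [psi] is a test function on [B], so that the weak derivatives
   can be used and their integrals restricted to [B]. *)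
have bdF s : 0 <= s <= 1 -> `|dF s| <= \sum_i `|v 0 i| * \int[mu]_(x in B) `|dh i x|.
  move=> s01.
  have tU i : test_function U (fun x => partial i psi (x - s *: v)).
    by apply: (test_function_shift (tp i)) => x Ax; apply: BU; exact: AB.
  have tUB : test_function B (fun x => psi (x - s *: v)).
    by apply: (test_function_shift tpsi) => x Ax; exact: AB.
  have -> : dF s = \sum_i v 0 i * \int[mu]_(x in U) (dh i x * psi (x - s *: v)).
    rewrite /dF.
    transitivity (\int[mu]_(x in U) (\sum_i (- v 0 i) * (h x * partial i psi (x - s *: v)))).
      apply: eq_Rintegral => x _; rewrite /dpsi mulrN mulr_sumr -sumrN.
      by apply: eq_bigr => i _; ring.
    have iT i : mu.-integrable U (EFin \o (fun x => (- v 0 i) * (h x * partial i psi (x - s *: v)))).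
      by apply: integrableZl_EFin => //; exact: (integrable_test _ _ (tU i)).
    transitivity (\sum_i \int[mu]_(x in U) ((- v 0 i) * (h x * partial i psi (x - s *: v)))). exact: Rintegral_sum.
    apply: eq_bigr => i _; rewrite RintegralZl//; last exact: (integrable_test _ _ (tU i)).
    have [_ _ /(_ (fun x => psi (x - s *: v)))] := hdh i.
    have E : partial i (fun x => psi (x - s *: v)) = fun x => partial i psi (x - s *: v).
      by apply/funext => x; rewrite /partial derive_shift_rV.
    by rewrite E => ->; [rewrite mulrNN|exact: test_functionS tUB].
  rewrite (le_trans (ler_norm_sum _ _ _))//; apply: ler_sum => i _.
  rewrite normrM ler_wpM2l//.
  have iB : mu.-integrable B (EFin \o dh i) by exact: integrableS (idh i).
  have -> : \int[mu]_(x in U) (dh i x * psi (x - s *: v)) =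
      \int[mu]_(x in B) (dh i x * psi (x - s *: v)).
    rewrite Rintegral_mkcond [RHS]Rintegral_mkcond; apply: eq_Rintegral => x _.
    rewrite !patchE; case: (boolP (x \in B)) => [/set_mem Bx|/negP nB].
      by rewrite mem_set//; exact: BU.
    case: ifPn => // _; rewrite (test_function_supp0 tUB) ?mulr0//.
    by move=> Bx; apply: nB; exact: mem_set.
  rewrite (le_trans (le_normr_Rintegral _ _))//.
    exact: (integrable_test _ iB tUB).
  apply: le_Rintegral => //.
  - exact/integrable_norm/(integrable_test _ iB tUB).
  - exact: integrable_norm.
  - by move=> x _; rewrite normrM ler_piMr.
have cF : {within `[0, 1], continuous F}.
  apply: continuous_subspaceT => x; apply/differentiable_continuous/derivable1_diffP.
  exact: (@ex_derive _ _ _ _ _ _ _ (DF x)).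
have [c c01] := @MVT_segment R F dF 0 1 ler01 (fun x _ => DF x) cF.
rewrite subr0 mulr1 => E.
have -> : \int[mu]_(x in U) (h x * psi (x - v)) = F 1 by rewrite /F /f scale1r.
have -> : \int[mu]_(x in U) (h x * psi x) = F 0.
  by rewrite /F /f scale0r; apply: eq_Rintegral => x _; rewrite subr0.
by rewrite E; apply: bdF.
Qed.

(** Extension by zero makes all translates integrable on the whole space; the estimates below
    compare values of [H] only at points of [U]. *)
Let H := h \_ U.

Let mH : measurable_fun [set: 'rV[R]_m] H.
Proof.
by apply/(measurable_restrictT _ mU); move/integrableP : ih => [/measurable_EFinP].
Qed.

Let iH : mu.-integrable setT (EFin \o H).
Proof.
have /integrable_mkcond -/(_ mU) := ih; rewrite /H.
by rewrite (_ : (EFin \o h) \_ U = EFin \o (h \_ U))//; exact: restrict_EFin.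
Qed.

(* Duality: test against [psi] nearly realizing the L^1 norm. *)
Lemma translation_bound (A B : set 'rV[R]_m) (v : 'rV[R]_m) :
  open A -> measurable B -> B `<=` U ->
  (forall x s, 0 <= s <= 1 -> A x -> B (x + s *: v)) ->
  \int[mu]_(x in A) `|H (x + v) - H x| <=
  \sum_i `|v 0 i| * \int[mu]_(x in B) `|dh i x|.
Proof.
move=> oA mB BU AB; have mA := measurable_open_rV oA.
have AU : A `<=` U.
  by move=> x Ax; apply: BU; have := AB x 0; rewrite lexx ler01 scale0r addr0; exact.
have mshift : measurable_fun [set: 'rV[R]_m] (fun x => x + v).
  by have := measurable_affine_rV 1 v; under eq_fun do rewrite scale1r.
have iHv : mu.-integrable setT (EFin \o (fun x => H (x + v))).
  apply/integrableP; split.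
    by apply/measurable_EFinP; exact: (measurableT_comp mH).
  rewrite (integral_shift v (f := fun x => `|(H x)%:E|%E)); last first.
    by apply: measurableT_comp => //; exact/measurable_EFinP.
  by case/integrableP : iH.
have ig : mu.-integrable A (EFin \o (fun x => H (x + v) - H x)).
  by apply: integrableS (integrableB_EFin _ iHv iH).
apply/ler_addgt0Pr => e e0.
have [psi [tpsi lpsi psi1 hpsi]] := test_density oA ig e0.
apply: (le_trans hpsi); rewrite lerD2r.
apply: le_trans (weak_partial_line_bound mB BU AB tpsi lpsi psi1).
apply: le_trans (ler_norm _); rewrite le_eqVlt; apply/orP; left; apply/eqP.
have psiA x : ~ A x -> psi x = 0 by exact: (test_function_supp0 tpsi).
have i1 := integrable_test measurableT iHv tpsi.
have i2 := integrable_test measurableT iH tpsi.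
transitivity (\int[mu]_(x in setT) (H (x + v) * psi x - H x * psi x)).
  rewrite Rintegral_mkcond; apply: eq_Rintegral => x _; rewrite patchE.
  case: (boolP (x \in A)) => [_|/negP nA]; first by ring.
  by rewrite psiA ?mulr0 ?subrr// => Ax; apply: nA; exact: mem_set.
rewrite RintegralB//; congr (_ - _).
  rewrite [RHS]Rintegral_mkcond /Rintegral; congr fine.
  rewrite -[RHS](integral_shift v); last first.
    apply/measurable_EFinP; apply/(measurable_restrictT _ mU); apply: measurable_funM.
      by move/integrableP : ih => [/measurable_EFinP].
    apply: measurable_funTS; apply: measurable_continuous_rV; apply: continuous_shift_rV.
    by apply: smooth_continuous; case: tpsi.
  apply: eq_integral => x _; rewrite /H !patchE addrK.
  by case: ifPn; rewrite ?mul0r.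
rewrite [RHS]Rintegral_mkcond; apply: eq_Rintegral => x _; rewrite /H !patchE.
by case: ifPn; rewrite ?mul0r.
Qed.

Let eball_convex (c x y : 'rV[R]_m) r s : 0 <= s <= 1 -> eball c r x -> eball c r y ->
  eball c r (x + s *: (y - x)).
Proof.
move=> /andP[s0 s1]; rewrite /eball/= => xr yr.
have -> : x + s *: (y - x) - c = (1 - s) *: (x - c) + s *: (y - c).
  by apply/rowP => i; rewrite !mxE; ring.
rewrite (le_lt_trans (enormD _ _))// !enormZ !ger0_norm ?subr_ge0//.
have [->|sn1] := eqVneq s 1; first by rewrite subrr mul0r mul1r add0r.
have {}s1 : s < 1 by rewrite lt_neqAle sn1.
nra.
Qed.

(** The displacements between points of the ball fill a ball of radius 2 r: its relative volume is
    [2 ^+ m], and 2 r bounds their length. The strict inequality is what the argument by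
    contradiction uses up. *)
Lemma poincare (c : 'rV[R]_m) (r K : R) : 0 < r -> eball c r `<=` U ->
  2 ^+ m * (2 * r) * \sum_i \int[mu]_(x in eball c r) `|dh i x| < K ->
  exists a : R, (\int[mu]_(x in eball c r) (`|h x - a|)%:E <= K%:E)%E.
Proof.
move=> r0 BU; set B := eball c r; set I := \sum_i _ => IK.
have mB : measurable B by exact: measurable_eball.
have oB : open B by exact: open_eball.
have I0 : 0 <= I by apply: sumr_ge0 => i _; exact: Rintegral_ge0.
(* Otherwise no [a = h x] with [x] in the ball works; averaging over [x] contradicts
   [translation_bound]. *)
apply: contrapT => /forallNP nK.
have {nK} hK a : (K%:E <= \int[mu]_(x in B) (`|h x - a|)%:E)%E.
  by rewrite ltW// ltNge; apply/negP; exact: nK.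
(* The double integral over pairs of points of the ball is written in terms of a point and a
   displacement, so that [translation_bound] applies for each fixed displacement. *)
pose G (p : 'rV[R]_m * 'rV[R]_m) : \bar R :=
  (\1_B p.1 * \1_B (p.1 + p.2) * `|H (p.1 + p.2) - H p.1|)%:E.
have madd : measurable_fun [set: 'rV[R]_m * 'rV[R]_m] (fun p => p.1 + p.2).
  apply: measurable_fun_rV => i; under eq_fun do rewrite mxE.
  by apply: measurable_funD; apply: (measurableT_comp (measurable_coor i)).
have m1B : measurable_fun [set: 'rV[R]_m] (\1_B : _ -> R) by exact: measurable_indic.
have mG : measurable_fun [set: 'rV[R]_m * 'rV[R]_m] G.
  apply/measurable_EFinP; apply: measurable_funM.
    apply: measurable_funM; first exact: (measurableT_comp m1B).
    exact: (measurableT_comp m1B madd).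
  apply: measurableT_comp => //; apply: measurable_funB.
    exact: (measurableT_comp mH madd).
  exact: (measurableT_comp mH).
have G0 p : (0 <= G p)%E by rewrite lee_fin !mulr_ge0.
have mhB (a : R) : measurable_fun B (fun x => (`|h x - a|)%:E).
  apply/measurable_EFinP; apply: measurableT_comp; first exact: normr_measurable.
  apply: measurable_funB; last exact: measurable_cst.
  by apply: (measurable_funS mU BU); move/integrableP : ih => [/measurable_EFinP].
have L1 : (K%:E * mu B <= \int[mu]_x \int[mu]_v G (x, v))%E.
  rewrite -integral_cst// (integral_mkcond B); apply: ge0_le_integral.
  - exact: measurableT.
  - move=> x _; rewrite patchE; case: ifPn => // _; rewrite lee_fin.
    by rewrite (le_trans _ (ltW IK))// !mulr_ge0// ltW.
  - exact: ((measurable_restrictT _ mB).1 (measurable_cst _)).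
  - exact: measurable_tonelli_rV.
  move=> x _; rewrite patchE; case: ifPn => xB; last by apply: integral_ge0 => y _; exact: G0.
  apply: (le_trans (hK (H x))); rewrite (integral_mkcond B).
  have mp := (measurable_restrictT _ mB).1 (mhB (H x)).
  rewrite -[leLHS](integral_shift x mp).
  apply: ge0_le_integral.
  - exact: measurableT.
  - by move=> y _; rewrite patchE; case: ifPn => // _; rewrite lee_fin.
  - by apply: (measurableT_comp mp); have := measurable_affine_rV 1 x;
      under eq_fun do rewrite scale1r.
  - exact: (measurableT_comp mG (pair1_measurable x)).
  move=> y _; rewrite patchE; case: ifPn => yB; last exact: G0.
  rewrite lee_fin /= !indicE xB (addrC x y) yB !mul1r /H !patchE !mem_set//.
    by apply: BU; exact: set_mem.
  by apply: BU; exact: set_mem.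
have Q1 : (\int[mu]_v \int[mu]_x G (x, v) <= (2 ^+ m * (2 * r) * I)%:E * mu B)%E.
  have E0 : ((2 ^+ m * (2 * r) * I)%:E * mu B =
      \int[mu]_(v in eball 0 (2 * r)) (2 * r * I)%:E)%E.
    rewrite integral_cst; last exact: measurable_eball.
    rewrite !lebesgue_eball ?mulr_gt0// -!EFinM; congr EFin.
    by rewrite exprMn; ring.
  rewrite E0 {E0} (integral_mkcond (eball 0 (2 * r))); apply: ge0_le_integral.
  - exact: measurableT.
  - by move=> v _; apply: integral_ge0 => y _; exact: G0.
  - exact: (measurable_fun_fubini_tonelli_G (m1 := lam m) G mG G0).
  - exact: ((measurable_restrictT _ (measurable_eball _ _)).1 (measurable_cst _)).
  move=> v _; rewrite patchE.
  (* Points for which both ends of the displacement lie in [B]; by convexity the whole segment does,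
     as [translation_bound] requires. *)
  pose A := [set x | B x /\ B (x + v)].
  have mshift : measurable_fun [set: 'rV[R]_m] (fun x => x + v).
    by have := measurable_affine_rV 1 v; under eq_fun do rewrite scale1r.
  have oA : open A.
    rewrite (_ : A = B `&` (fun x => x + v) @^-1` B)//; apply: openI => //.
    apply: open_comp => // x _.
    by apply: (@cvgD _ _ _ _ (nbhs_filter x)); [exact: cvg_id|exact: cvg_cst].
  have mA := measurable_open_rV oA.
  have GA x : G (x, v) = ((EFin \o (fun x => `|H (x + v) - H x|)) \_ A) x.
    rewrite patchE /G/= !indicE; case: (boolP (x \in A)) => [/set_mem[Bx Bxv]|nA].
      by rewrite !mem_set// !mul1r.
    case: (boolP (x \in B)) => [/set_mem Bx|_]; last by rewrite !mul0r.
    case: (boolP (x + v \in B)) => [/set_mem Bxv|_]; last by rewrite mulr0 mul0r.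
    by exfalso; move/negP : nA; apply; apply/mem_set.
  under eq_integral do rewrite GA.
  rewrite -integral_mkcond.
  case: ifPn => [/set_mem vr|/negP nvr]; last first.
    have -> : A = set0.
      rewrite -subset0 => x [Bx Bxv]; apply: nvr; apply/mem_set; rewrite /eball/= subr0.
      have -> : v = (x + v - c) - (x - c) by apply/rowP => i; rewrite !mxE; ring.
      rewrite (le_lt_trans (enormD _ _))// enormN mulrDl mul1r.
      by move: Bx Bxv; rewrite /B /eball/=; lra.
    by rewrite integral_set0.
  have AB x s : 0 <= s <= 1 -> A x -> B (x + s *: v).
    move=> s01 [Bx Bxv]; have := eball_convex s01 Bx Bxv.
    by rewrite [x + v]addrC addrK.
  have TB := translation_bound oA mB BU AB.
  have iHA : mu.-integrable A (EFin \o (fun x => `|H (x + v) - H x|)).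
    apply: integrable_norm; apply: integrableS (integrableB_EFin _ _ iH) => //.
    apply/integrableP; split; first by apply/measurable_EFinP; exact: (measurableT_comp mH).
    rewrite (integral_shift v (f := fun x => `|(H x)%:E|%E)).
      by case/integrableP : iH.
    by apply: measurableT_comp => //; exact/measurable_EFinP.
  rewrite -(fineK (integrable_fin_num mA iHA)) lee_fin.
  apply: (le_trans TB); rewrite /I mulr_sumr; apply: ler_sum => i _.
  rewrite ler_wpM2r ?Rintegral_ge0// (le_trans (coord_le_enorm _ _))//.
  by move: vr; rewrite /eball/= subr0 => /ltW.
have := le_trans L1 (eq_ind_r (fun z => z <= _)%E Q1 (tonelli_rV mG G0)).
rewrite lebesgue_eball// -!EFinM lee_fin ler_pM2r ?leNgt ?IK//.
by rewrite mulr_gt0 ?bvol_gt0// exprn_gt0.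
Qed.

End difference.

(** * Approximation of functions with small mean oscillation on small balls *)

Section oscillation.
Context {R : realType} (m : nat).
Local Notation mu := (@lebesgue_rV R m).
Implicit Types (f g h k : 'rV[R]_m -> R) (x y z : 'rV[R]_m) (r e c : R).

Definition evol r : R := r ^+ m * bvol m.

Lemma evol_gt0 r : 0 < r -> 0 < evol r.
Proof. by move=> r0; rewrite mulr_gt0 ?bvol_gt0 ?exprn_gt0. Qed.

Lemma le_evol r r' : 0 < r -> r <= r' -> evol r <= evol r'.
Proof.
by move=> r0 rr; rewrite ler_pM2r ?bvol_gt0// lerXn2r// nnegrE ltW// (lt_le_trans r0).
Qed.

Lemma evol2 r : evol (2 * r) = 2 ^+ m * evol r.
Proof. by rewrite /evol exprMn mulrA. Qed.

Lemma mu_eball x r : 0 < r -> mu (eball x r) = (evol r)%:E.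
Proof. exact: lebesgue_eball. Qed.

(** Any reference constant is allowed in place of the average: sums and compositions with
    1-Lipschitz functions then need no computation of averages. The return to the average costs a
    factor 2, in [average_dist]. *)
Definition osc_le h x r e := exists c : R,
  (\int[mu]_(y in eball x r) (`|h y - c|)%:E <= (e * evol r)%:E)%E.

Lemma measurable_absB f (D : set 'rV[R]_m) c : measurable_fun [set: 'rV[R]_m] f ->
  measurable_fun D (fun y => (`|f y - c|)%:E).
Proof.
move=> mf; apply/measurable_EFinP; apply: measurableT_comp; first exact: normr_measurable.
apply: measurable_funB; last exact: measurable_cst.
exact: measurable_funTS.
Qed.

Lemma ge0_le_integral_rV (D : set 'rV[R]_m) f g : measurable D ->
  measurable_fun D f -> measurable_fun D g -> (forall y, D y -> 0 <= f y) ->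
  (forall y, D y -> f y <= g y) ->
  (\int[mu]_(y in D) (f y)%:E <= \int[mu]_(y in D) (g y)%:E)%E.
Proof.
move=> mD mf mg f0 fg; apply: ge0_le_integral.
- exact: mD.
- by move=> y Dy; rewrite lee_fin f0.
- exact/measurable_EFinP.
- exact/measurable_EFinP.
- by move=> y Dy; rewrite lee_fin fg.
Qed.

Lemma integrable_bounded_rV (f : 'rV[R]_m -> R) (D : set 'rV[R]_m) (M : R) : measurable D ->
  (mu D < +oo)%E -> measurable_fun D f -> (forall x, `|f x| <= M) ->
  mu.-integrable D (EFin \o f).
Proof.
move=> mD fD mf fM; apply: measurable_bounded_integrable => //.
exists M; split; first by rewrite num_real.
by move=> N MN y _ /=; rewrite (le_trans (fM y))// ltW.
Qed.

Lemma osc_le_trans h x r e e' : 0 < r -> e <= e' -> osc_le h x r e -> osc_le h x r e'.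
Proof.
move=> r0 ee [c hc]; exists c; rewrite (le_trans hc)// lee_fin.
by rewrite ler_pM2r// evol_gt0.
Qed.

Lemma osc_le_ext h h' x r e : (forall y, eball x r y -> h y = h' y) ->
  osc_le h x r e -> osc_le h' x r e.
Proof.
move=> hh [c hc]; exists c; apply: le_trans hc; rewrite le_eqVlt; apply/orP; left.
by apply/eqP/eq_integral => y /set_mem yB; rewrite hh.
Qed.

Lemma osc_le_dominated f h x r e : measurable_fun [set: 'rV[R]_m] f ->
  measurable_fun [set: 'rV[R]_m] h -> (forall c, exists c', forall y, `|h y - c'| <= `|f y - c|) ->
  osc_le f x r e -> osc_le h x r e.
Proof.
move=> mf mh H [c hc]; have [c' Hc'] := H c; exists c'; apply: le_trans hc.
apply: ge0_le_integral.
- exact: measurable_eball.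
- by move=> y _; rewrite lee_fin.
- exact: measurable_absB.
- exact: measurable_absB.
- by move=> y _; rewrite lee_fin.
Qed.

Lemma osc_leD f g x r e e' : measurable_fun [set: 'rV[R]_m] f ->
  measurable_fun [set: 'rV[R]_m] g -> osc_le f x r e -> osc_le g x r e' ->
  osc_le (fun y => f y + g y) x r (e + e').
Proof.
move=> mf mg [c hc] [c' hc']; exists (c + c').
rewrite mulrDl EFinD; apply: le_trans (leeD hc hc').
rewrite -ge0_integralD; last first.
- exact: measurable_absB.
- by move=> y _; rewrite lee_fin.
- exact: measurable_absB.
- by move=> y _; rewrite lee_fin.
- exact: measurable_eball.
apply: ge0_le_integral.
- exact: measurable_eball.
- by move=> y _; rewrite lee_fin.
- by apply: measurable_absB; exact: measurable_funD.
- by apply: emeasurable_funD; exact: measurable_absB.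
move=> y _; rewrite -EFinD lee_fin.
have -> : f y + g y - (c + c') = (f y - c) + (g y - c') by ring.
exact: ler_normD.
Qed.

(** A product rule: the reference constant is c (1 - eta x), with the cutoff frozen at the centre.
    Freezing it multiplies the oscillation of [eta] by [|c|], hence the bound required of [c]. *)
Lemma osc_le_mul_compl k (eta : 'rV[R]_m -> R) x r c M e e' : measurable_fun [set: 'rV[R]_m] k ->
  measurable_fun [set: 'rV[R]_m] eta -> (forall y, 0 <= eta y <= 1) -> `|c| <= M ->
  (\int[mu]_(y in eball x r) (`|k y - c|)%:E <= (e * evol r)%:E)%E ->
  (\int[mu]_(y in eball x r) (`|eta y - eta x|)%:E <= (e' * evol r)%:E)%E ->
  osc_le (fun y => k y * (1 - eta y)) x r (e + M * e').
Proof.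
move=> mk meta eta01 cM.
have M0 : 0 <= M by exact: le_trans cM.
have mabs (f : 'rV[R]_m -> R) (a : R) : measurable_fun [set: 'rV[R]_m] f ->
    measurable_fun (eball x r) (fun y => `|f y - a|).
  by move=> mf; apply/measurable_EFinP; exact: measurable_absB.
have H : (\int[mu]_(y in eball x r) (`|k y * (1 - eta y) - c * (1 - eta x)|)%:E <=
    \int[mu]_(y in eball x r) (`|k y - c|)%:E +
    M%:E * \int[mu]_(y in eball x r) (`|eta y - eta x|)%:E)%E.
  rewrite -ge0_integralZl_EFin; first last.
  - exact: M0.
  - exact: measurable_absB.
  - by move=> y _; rewrite lee_fin.
  - exact: measurable_eball.
  rewrite -ge0_integralD; first last.
  - by apply: measurable_funeM; exact: measurable_absB.
  - by move=> y _; rewrite mule_ge0// lee_fin.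
  - exact: measurable_absB.
  - by move=> y _; rewrite lee_fin.
  - exact: measurable_eball.
  apply: ge0_le_integral_rV.
  - exact: measurable_eball.
  - by apply: (mabs (fun y => k y * (1 - eta y))); apply: measurable_funM => //; exact: measurable_funB.
  - by apply: measurable_funD; [exact: mabs|apply: measurable_funM => //; exact: mabs].
  - by move=> y _.
  move=> y _.
  have -> : k y * (1 - eta y) - c * (1 - eta x) = (k y - c) * (1 - eta y) - c * (eta y - eta x) by ring.
  rewrite (le_trans (ler_normB _ _))// !normrM lerD//.
    by rewrite ler_piMr// ler_norml; have := eta01 y; lra.
  by rewrite ler_wpM2r.
move=> h1 h2; exists (c * (1 - eta x)); apply: (le_trans H).
rewrite mulrDl EFinD -mulrA EFinM; apply: leeD; first exact: h1.
rewrite EFinM; move: h2; apply: lee_wpmul2l; by rewrite lee_fin.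
Qed.

(** On balls of radius at least [r0] the reference constant 0 is enough: a small L^1 norm is divided
    by a volume bounded from below. *)
Lemma osc_le_integral h (D : set 'rV[R]_m) x r r0 e : measurable D -> 
  measurable_fun [set: 'rV[R]_m] h -> 0 <= e -> 0 < r0 -> r0 <= r -> eball x r `<=` D ->
  (\int[mu]_(y in D) (`|h y|)%:E <= (e * evol r0)%:E)%E -> osc_le h x r e.
Proof.
move=> mD mh e0 r00 rr BD H; exists 0.
have -> : (\int[mu]_(y in eball x r) `|h y - 0|%:E = \int[mu]_(y in eball x r) `|h y|%:E)%E.
  by apply: eq_integral => y _; rewrite subr0.
apply: (@le_trans _ _ (e * evol r0)%:E); last by rewrite lee_fin ler_wpM2l// le_evol.
apply: le_trans H; apply: ge0_subset_integral => //; first exact: measurable_eball.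
by apply/measurable_EFinP; apply: measurableT_comp => //; exact: measurable_funTS.
Qed.

End oscillation.

(** * Truncation *)

Section truncation.
Context {R : realType} (m : nat).
Local Notation mu := (@lebesgue_rV R m).

Definition trunc (M t : R) : R := Num.max (- M) (Num.min M t).

Lemma truncP M t : 0 <= M -> [\/ t <= - M /\ trunc M t = - M,
  - M <= t <= M /\ trunc M t = t | M <= t /\ trunc M t = M].
Proof.
move=> M0; rewrite /trunc; have [Mt|tM] := leP M t.
  by rewrite max_r ?ge0_cp//; constructor 3.
have [Mt|tM'] := leP (- M) t; first by constructor 2; rewrite (ltW tM).
by constructor 1; rewrite ltW.
Qed.

Lemma trunc_le M t : 0 <= M -> `|trunc M t| <= M.
Proof. by move=> M0; rewrite ler_norml; have [] := truncP t M0 => -[? ->]; lra. Qed.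

Lemma trunc_id M t : `|t| <= M -> trunc M t = t.
Proof.
rewrite ler_norml /trunc => /andP[h1 h2]; rewrite min_r//; exact: max_r.
Qed.

Lemma trunc_lip M t c : 0 <= M -> `|trunc M t - trunc M c| <= `|t - c|.
Proof.
move=> M0; have h1 := ler_norm (t - c); have h2 := ler_norm (c - t).
rewrite distrC in h2; rewrite ler_norml.
by have [] := truncP t M0 => -[? ->]; have [] := truncP c M0 => -[? ->]; lra.
Qed.

Lemma trunc_compl_lip M t c : 0 <= M -> `|(t - trunc M t) - (c - trunc M c)| <= `|t - c|.
Proof.
move=> M0; have h1 := ler_norm (t - c); have h2 := ler_norm (c - t).
rewrite distrC in h2; rewrite ler_norml.
by have [] := truncP t M0 => -[? ->]; have [] := truncP c M0 => -[? ->]; lra.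
Qed.

Lemma measurable_trunc M (h : 'rV[R]_m -> R) : measurable_fun [set: 'rV[R]_m] h ->
  measurable_fun [set: 'rV[R]_m] (fun y => trunc M (h y)).
Proof.
by move=> mh; apply: measurable_maxr => //; exact: measurable_minr.
Qed.

Lemma trunc_approx (U : set 'rV[R]_m) (h : 'rV[R]_m -> R) (e : R) :
  measurable U -> mu.-integrable U (EFin \o h) -> 0 < e ->
  exists n : nat, (\int[mu]_(y in U) (`|h y - trunc n.+1%:R (h y)|)%:E <= e%:E)%E.
Proof.
move=> mU ih e0; have ihn := integrable_norm ih.
have mh : measurable_fun U h by case/integrableP : ih => /measurable_EFinP.
have md n : measurable_fun U (fun y => (`|h y - trunc n%:R (h y)|)%:E).
  apply/measurable_EFinP; apply: measurableT_comp; first exact: normr_measurable.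
  by apply: measurable_funB => //; apply: measurable_maxr => //; exact: measurable_minr.
have /= := @dominated_convergence _ _ _ mu U mU
  (fun n y => (`|h y - trunc n%:R (h y)|)%:E) (cst 0%E) (EFin \o (fun y => `|h y|)) md
  (measurable_cst _).
case=> [|||_ _].
- apply/aeW => x Ux; apply: cvg_near_cst; near=> n.
  rewrite trunc_id ?subrr ?normr0//.
  near: n; exact: nbhs_infty_ger.
- exact: ihn.
- apply/aeW => x n Ux; rewrite lee_fin normr_id.
  have := @trunc_compl_lip n%:R (h x) 0 (ler0n _ _).
  by rewrite (@trunc_id _ 0) ?normr0 ?ler0n// !subr0.
rewrite integral0 => /fine_cvgP[[N _ fN]] /cvgrPdist_le /(_ _ e0)[M _ hM].
exists (maxn N M); have NM : (maxn N M <= (maxn N M).+1)%N by [].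
have f1 := fN _ (leq_trans (leq_maxl N M) NM).
have := hM _ (leq_trans (leq_maxr N M) NM); rewrite /= sub0r normrN => hh.
by rewrite -(fineK f1) lee_fin (le_trans (ler_norm _)).
Unshelve. all: by end_near. Qed.

(** Small balls impose nothing on the level, since t -> t - trunc M t is 1-Lipschitz and so does not
    increase oscillation. Only the large balls determine [M]. *)
Lemma truncation (U : set 'rV[R]_m) (h : 'rV[R]_m -> R) (e r0 : R) :
  measurable U -> measurable_fun [set: 'rV[R]_m] h -> mu.-integrable U (EFin \o h) ->
  0 < e -> 0 < r0 ->
  (forall x r, 0 < r < r0 -> eball x r `<=` U -> osc_le h x r e) ->
  exists2 M, 0 < M & forall x r, 0 < r -> eball x r `<=` U ->
    osc_le (fun y => h y - trunc M (h y)) x r e.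
Proof.
move=> mU mh ih e0 r00 osc.
have er0 : 0 < e * evol m r0 by rewrite mulr_gt0 ?evol_gt0.
have [n hn] := trunc_approx mU ih er0.
exists n.+1%:R => // x r rp BU.
have mht : measurable_fun [set: 'rV[R]_m] (fun y => h y - trunc n.+1%:R (h y)).
  by apply: measurable_funB => //; exact: measurable_trunc.
have [rr|rr] := ltP r r0.
  apply: (osc_le_dominated mh mht).
    by move=> c; exists (c - trunc n.+1%:R c) => y; exact: trunc_compl_lip.
  by apply: osc => //; rewrite rp.
exact: (osc_le_integral mU mht (ltW e0) r00 rr BU).
Qed.

End truncation.

(** * Logarithmic cutoff near the complement *)

Section cutoff.
Context {R : realType} (m : nat).
Local Notation mu := (@lebesgue_rV R m).
Variables (U : set 'rV[R]_m) (z0 : 'rV[R]_m).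
Hypothesis oU : open U.
Hypothesis Uz0 : ~ U z0.

Let dists (x : 'rV[R]_m) := [set enorm (y - x) | y in ~` U].

(** The point [z0] outside [U] keeps the set of distances nonempty, so that [inf] is a true
    infimum. *)
Definition cdist x : R := inf (dists x).

Let dists0 x : dists x !=set0.
Proof. by exists (enorm (z0 - x)); exists z0. Qed.

Let dists_lb x : lbound (dists x) 0.
Proof. by move=> _ [y _ <-]; exact: enorm_ge0. Qed.

Lemma cdist_le x y : ~ U y -> cdist x <= enorm (y - x).
Proof. by move=> Uy; apply: ge_inf; [exists 0; exact: dists_lb|exists y]. Qed.

Lemma cdist_ge x r : eball x r `<=` U -> r <= cdist x.
Proof.
move=> BU; apply: lb_le_inf => // _ [y Uy <-]; rewrite leNgt; apply/negP => yr.
exact/Uy/BU.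
Qed.

Lemma cdist_gt0 x : U x -> 0 < cdist x.
Proof.
move=> Ux; have [r r0 /cdist_ge] := (open_eballP U).1 oU x Ux.
exact: lt_le_trans.
Qed.

Lemma cdist_lip x y : cdist x <= cdist y + enorm (y - x).
Proof.
rewrite -lerBlDr; apply: lb_le_inf => // _ [w Uw <-]; rewrite lerBlDr.
by rewrite (le_trans (cdist_le x Uw))// enorm_triangle.
Qed.

Lemma continuous_cdist : continuous cdist.
Proof.
move=> x; apply/(@cvgrPdist_lt _ _ _ (nbhs x) (nbhs_filter x)) => e e0.
have : nbhs x (eball x e) by apply: open_nbhs_nbhs; split; [exact: open_eball|exact: mem_eball].
apply: filterS => y; rewrite /eball/= => yx; rewrite (le_lt_trans _ yx)// ler_norml.
by have := cdist_lip x y; have := cdist_lip y x; rewrite (enormBC x y); lra.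
Qed.

Definition clamp (t : R) : R := Num.max 0 (Num.min 1 t).

Lemma clampP t : [\/ t <= 0 /\ clamp t = 0, 0 <= t <= 1 /\ clamp t = t | 1 <= t /\ clamp t = 1].
Proof.
rewrite /clamp; have [Mt|tM] := leP 1 t.
  by rewrite max_r ?ler01//; constructor 3.
have [Mt|tM'] := leP 0 t; first by constructor 2; rewrite (ltW tM).
by constructor 1; rewrite ltW.
Qed.

Lemma clamp_lip t c : `|clamp t - clamp c| <= `|t - c|.
Proof.
have h1 := ler_norm (t - c); have h2 := ler_norm (c - t).
rewrite distrC in h2; rewrite ler_norml.
by have [] := clampP t => -[? ->]; have [] := clampP c => -[? ->]; lra.
Qed.

Lemma clamp01 t : 0 <= clamp t <= 1.
Proof. by have [] := clampP t => -[? ->]; lra. Qed.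

Lemma dist01 (a b : R) : 0 <= a <= 1 -> 0 <= b <= 1 -> `|a - b| <= 1.
Proof. by rewrite ler_norml; lra. Qed.

Lemma bernoulli_1B (s : R) (k : nat) : 0 <= s <= 1 -> 1 - k%:R * s <= (1 - s) ^+ k.
Proof.
move=> /andP[s0 s1]; elim: k => [|k IH]; first by rewrite mul0r subr0 expr0.
rewrite exprS -natr1; apply: (@le_trans _ _ ((1 - s) * (1 - k%:R * s))).
  have : 0 <= k%:R * s * s by rewrite !mulr_ge0.
  nra.
by rewrite ler_wpM2l// subr_ge0.
Qed.

(* [1 + ep * ln (dist x / rho)], clamped to [0, 1], has mean oscillation of order
   [ep] on every ball contained in [U], whatever its size. *)
Definition logcut (ep rho : R) x : R :=
  if 0 < cdist x then clamp (1 + ep * (ln (cdist x) - ln rho)) else 0.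

Lemma logcut01 ep rho x : 0 <= logcut ep rho x <= 1.
Proof. by rewrite /logcut; case: ifPn => _; [exact: clamp01|rewrite lexx ler01]. Qed.

Lemma logcut_far ep rho x : 0 < ep -> 0 < rho -> rho <= cdist x -> logcut ep rho x = 1.
Proof.
move=> ep0 rho0 h; have c0 : 0 < cdist x by exact: lt_le_trans h.
rewrite /logcut c0; have : 0 <= ep * (ln (cdist x) - ln rho).
  by rewrite mulr_ge0 ?(ltW ep0)// subr_ge0 ler_ln.
by have [] := clampP (1 + ep * (ln (cdist x) - ln rho)) => -[? ->]; lra.
Qed.

(** The threshold is where 1 + ep (ln dist - ln rho) reaches 0. Vanishing on a whole layer, and not
    just outside [U], later disposes of the small balls that leave [U]. *)
Lemma logcut_near ep rho x : 0 < ep -> 0 < rho -> cdist x <= rho * expR (- ep^-1) ->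
  logcut ep rho x = 0.
Proof.
move=> ep0 rho0 h; rewrite /logcut; case: ifPn => // c0.
have : ep * (ln (cdist x) - ln rho) <= -1.
  rewrite -ler_pdivlMl// mulrN1 lerBlDl.
  rewrite -[X in _ + X]expRK -lnM ?posrE ?expR_gt0// ler_ln// posrE.
  by rewrite mulr_gt0 ?expR_gt0.
by have [] := clampP (1 + ep * (ln (cdist x) - ln rho)) => -[? ->]; lra.
Qed.

Lemma measurable_logcut ep rho : measurable_fun [set: 'rV[R]_m] (logcut ep rho).
Proof.
have mc : measurable_fun [set: 'rV[R]_m] cdist.
  by apply: measurable_continuous_rV; exact: continuous_cdist.
apply: measurable_fun_ifT => //.
- by apply: measurable_fun_ltr.
- apply: measurable_maxr => //; apply: measurable_minr => //.
  apply: measurable_funD => //; apply: measurable_funM => //; apply: measurable_funB => //.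
  exact: (measurableT_comp (@measurable_ln R)).
Qed.

(* On the concentric ball of radius [(1 - s) r] the distance varies by a factor at most
   [1 / s]; the remaining shell has relative volume at most [m s]. *)
Lemma logcut_osc (ep rho s r : R) x : 0 < ep -> 0 < s <= 2^-1 -> 0 < r -> eball x r `<=` U ->
  (\int[mu]_(y in eball x r) (`|logcut ep rho y - logcut ep rho x|)%:E <=
   ((ep * ln s^-1 + m%:R * s) * evol m r)%:E)%E.
Proof.
move=> ep0 /andP[s0 s2] r0 BU.
have rx := cdist_ge BU.
have cx : 0 < cdist x by exact: lt_le_trans rx.
have s1 : s < 1 by rewrite (le_lt_trans s2)// invf_lt1 ?ltr1n.
have r'0 : 0 < (1 - s) * r by rewrite mulr_gt0// subr_gt0.
have si : 2 <= s^-1 by rewrite -[2]invrK lef_pV2// posrE invr_gt0.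
have ls0 : 0 <= ln s^-1 by rewrite ln_ge0// (le_trans _ si)// ler1n.
have mB := measurable_eball x r; have mB' := measurable_eball x ((1 - s) * r).
have B'B : eball x ((1 - s) * r) `<=` eball x r.
  by apply: sub_eball; rewrite ler_piMl// ltW// gtrBl.
apply: (@le_trans _ _ (\int[mu]_(y in eball x r)
   (ep * ln s^-1 + \1_(eball x r `\` eball x ((1 - s) * r)) y)%:E)%E).
  apply: ge0_le_integral_rV => //.
  - apply: measurableT_comp; first exact: normr_measurable.
    apply: measurable_funB; last exact: measurable_cst.
    exact: measurable_funTS (measurable_logcut _ _).
  - apply: measurable_funD; first exact: measurable_cst.
    by apply: measurable_funTS; apply: measurable_indic; exact: measurableD.
  move=> y yB; rewrite indicE; have [yB'|nyB'] := pselect (eball x ((1 - s) * r) y).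
    have yx : enorm (y - x) < (1 - s) * r by exact: yB'.
    have ys : s * cdist x <= cdist y.
      have := cdist_lip x y; have : (1 - s) * r <= (1 - s) * cdist x.
        by rewrite ler_wpM2l// subr_ge0 ltW.
      lra.
    (* Here [s <= 2^-1] enters: the distance at [y] is at most twice the distance at the centre. *)
    have y2 : cdist y <= s^-1 * cdist x.
      have := cdist_lip y x; rewrite enormBC.
      have : 2 * cdist x <= s^-1 * cdist x by rewrite ler_pM2r.
      have : (1 - s) * r <= r by rewrite ler_piMl// ltW// gtrBl.
      lra.
    have cy : 0 < cdist y by rewrite (lt_le_trans _ ys)// mulr_gt0.
    rewrite /logcut cx cy (le_trans (clamp_lip _ _))//.
    rewrite (_ : _ - _ = ep * (ln (cdist y) - ln (cdist x))); last by ring.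
    rewrite normrM gtr0_norm// memNset ?addr0; last by case.
    rewrite ler_wpM2l ?(ltW ep0)// ler_norml lerBrDr lerBlDr.
    rewrite -lnM ?posrE ?invr_gt0// ler_ln ?posrE ?mulr_gt0 ?invr_gt0// y2 andbT.
    rewrite lnV ?posrE// opprK -lnM ?posrE// ler_ln ?posrE ?mulr_gt0//.
  rewrite mem_set//= (@le_trans _ _ 1)//.
    by apply: dist01; exact: logcut01.
  by rewrite lerDr mulr_ge0// ltW.
under eq_integral do rewrite EFinD.
rewrite ge0_integralD//; first last.
- apply/measurable_EFinP; apply: measurable_funTS; apply: measurable_indic.
  exact: measurableD.
- by move=> y _; rewrite lee_fin mulr_ge0// ltW.
rewrite integral_cst// integral_indic//; last exact: measurableD.
rewrite setIidl; last exact: subDsetl.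
have fA : (mu (eball x r) < +oo)%E by rewrite mu_eball// ltry.
have -> : (mu (eball x r `\` eball x ((1 - s) * r)) = (evol m r - evol m ((1 - s) * r))%:E)%E.
  rewrite measureD//; transitivity (mu (eball x r) - mu (eball x ((1 - s) * r)))%E.
    by congr (_ - mu _)%E; exact: setIidr.
  by rewrite (mu_eball x r0) (mu_eball x r'0).
rewrite (mu_eball x r0) -EFinM -EFinD lee_fin [leRHS]mulrDl lerD2l.
rewrite /evol exprMn.
(* Bernoulli's inequality bounds the relative volume 1 - (1 - s)^m of the shell by m s. *)
have := @bernoulli_1B s m; rewrite (ltW s0) (ltW s1) => /(_ isT) h.
have : 0 <= r ^+ m * bvol m by rewrite mulr_ge0 ?exprn_ge0 ?ltW ?bvol_gt0.
nra.
Qed.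

(** [s] and [ep] are chosen first, so that [M] times the oscillation of the cutoff is at most [e] on
    every ball. That bound does not involve [rho], which can then be shrunk until the layer where
    [eta] differs from 1 is negligible on balls of radius at least [r0]. *)
Lemma cutoff (k : 'rV[R]_m -> R) (M e r0 : R) :
  (mu U < +oo)%E -> measurable_fun [set: 'rV[R]_m] k -> 0 < M -> (forall x, `|k x| <= M) ->
  0 < e -> 0 < r0 ->
  (forall x r, 0 < r < r0 -> eball x r `<=` U -> osc_le k x r e) ->
  exists (eta : 'rV[R]_m -> R) (d : R), [/\ measurable_fun [set: 'rV[R]_m] eta, 0 < d, forall x, 0 <= eta x <= 1,
    forall x, cdist x <= d -> eta x = 0 &
    forall x r, 0 < r -> eball x r `<=` U -> osc_le (fun y => k y * (1 - eta y)) x r (2 * e)].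
Proof.
move=> Ufin mk M0 kM e0 r00 osc.
have mU := measurable_open_rV oU.
have [s [s0 s2 sM]] : exists s : R, [/\ 0 < s, s <= 2^-1 & M * (m%:R * s) <= e / 2].
  (* Using [m.+1] avoids a division by zero for [m = 0]. *)
  exists (Num.min 2^-1 (e / (2 * M * m.+1%:R))); set s := Num.min _ _.
  have s0 : 0 < s by rewrite lt_min invr_gt0 ltr0n/= divr_gt0// !mulr_gt0.
  split => //; first by rewrite ge_min lexx.
  rewrite (@le_trans _ _ (M * (m.+1%:R * (e / (2 * M * m.+1%:R)))))//.
    rewrite ler_wpM2l ?(ltW M0)// ler_pM// ?(ltW s0)// ?ler_nat//.
    by rewrite /s ge_min lexx orbT.
  rewrite le_eqVlt; apply/orP; left; apply/eqP; field.
  by rewrite (gt_eqF M0) nat1r pnatr_eq0.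
have ls0 : 0 < ln s^-1.
  by rewrite ln_gt0// invf_gt1// (le_lt_trans s2)// invf_lt1 ?ltr1n.
have [ep ep0 epM] : exists2 ep : R, 0 < ep & M * (ep * ln s^-1) <= e / 2.
  exists (e / (2 * M * ln s^-1)); first by rewrite divr_gt0// !mulr_gt0.
  by rewrite le_eqVlt; apply/orP; left; apply/eqP; field; rewrite !gt_eqF.
have er0 : 0 < 2 * e * evol m r0 by rewrite mulr_gt0 ?evol_gt0// mulr_gt0.
have mc : measurable_fun [set: 'rV[R]_m] cdist.
  by apply: measurable_continuous_rV; exact: continuous_cdist.
(* These layers have no common point in [U], where [cdist] is positive. Dominated convergence by a
   constant then uses the finite measure of [U]. *)
pose S (n : nat) : set 'rV[R]_m := cdist @^-1` `]-oo, n.+1%:R^-1[.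
have mS n : measurable (S n).
  by rewrite -[S n]setTI; apply: mc => //; exact: measurable_itv.
have SP n y : (y \in S n) = (cdist y < n.+1%:R^-1).
  by apply/idP/idP; rewrite inE /S/= in_itv.
have [n hn] : exists n : nat, forall t,
    (t <= \int[mu]_(y in U) (M * \1_(S n) y)%:E -> t <= (2 * e * evol m r0)%:E)%E.
  have mi n : measurable_fun U (fun y => (M * \1_(S n) y)%:E).
    apply/measurable_EFinP; apply: measurable_funM; first exact: measurable_cst.
    exact: measurable_indic.
  have /= := @dominated_convergence _ _ _ mu U mU
    (fun n y => (M * \1_(S n) y)%:E) (cst 0%E) (cst M%:E) mi
    (measurable_cst _).
  case=> [|||_ _].
  - apply/aeW => x Ux; apply: cvg_near_cst; near=> n.
    rewrite indicE SP ltNge ltW ?mulr0//.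
    near: n; exact: (near_infty_natSinv_lt (PosNum (cdist_gt0 Ux))).
  - by apply/integrableP; split => //; rewrite integral_cst//= lte_mul_pinfty// lee_fin ltW// normr_gt0 gt_eqF.
  - apply/aeW => x n Ux; rewrite lee_fin ger0_norm ?mulr_ge0 ?(ltW M0)//.
    by rewrite ler_piMr ?(ltW M0)// indicE; case: (_ \in _).
  rewrite integral0 => /fine_cvgP[[N _ fN]] /cvgrPdist_le /(_ _ er0)[N' _ hN'].
  exists (maxn N N').
  have f1 := fN _ (leq_maxl N N').
  have := hN' _ (leq_maxr N N'); rewrite /= sub0r normrN => hh t /le_trans; apply.
  by rewrite -(fineK f1) lee_fin (le_trans (ler_norm _)).
pose rho : R := n.+1%:R^-1.
have rho0 : 0 < rho by rewrite invr_gt0.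
exists (logcut ep rho), (rho * expR (- ep^-1)); split.
- exact: measurable_logcut.
- by rewrite mulr_gt0 ?expR_gt0.
- exact: logcut01.
- by move=> x; exact: logcut_near.
move=> x r rp BU; set eta := logcut ep rho.
have meta : measurable_fun [set: 'rV[R]_m] eta by exact: measurable_logcut.
have mke : measurable_fun [set: 'rV[R]_m] (fun y => k y * (1 - eta y)).
  by apply: measurable_funM => //; exact: measurable_funB.
have eta01 y : 0 <= eta y <= 1 by exact: logcut01.
have [rr|rr] := ltP r r0; last first.
  apply: (osc_le_integral mU mke _ r00 rr BU); first by rewrite mulr_ge0// ltW.
  apply: hn; apply: ge0_le_integral_rV => //.
  - apply: measurableT_comp; first exact: normr_measurable.
    exact: measurable_funTS.
  - apply: measurable_funM; first exact: measurable_cst.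
    exact: measurable_indic.
  move=> y Uy; rewrite indicE SP -/rho; have [yr|yr] := ltP (cdist y) rho.
    rewrite mulr1 normrM (le_trans _ (kM y))// ler_piMr//.
    by rewrite ler_norml; have := eta01 y; lra.
  by rewrite /eta logcut_far// subrr mulr0 normr0 mulr_ge0// ltW.
have : osc_le k x r e by apply: osc => //; rewrite rp.
(* The product rule needs a reference constant bounded by [M]; truncating it does not spoil the
   estimate, because [k] itself is bounded by [M]. *)
case=> c0; set c := trunc M c0.
have cM : `|c| <= M by apply: trunc_le; exact: ltW.
have /le_trans hc : (\int[mu]_(y in eball x r) (`|k y - c|)%:E <=
    \int[mu]_(y in eball x r) (`|k y - c0|)%:E)%E.
  apply: ge0_le_integral_rV.
  - exact: measurable_eball.
  - by apply/measurable_EFinP; exact: measurable_absB.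
  - by apply/measurable_EFinP; exact: measurable_absB.
  - by move=> y _.
  - by move=> y _; rewrite -{1}[k y](@trunc_id _ M)//; apply: trunc_lip; exact: ltW.
move=> /hc hc'.
apply: (@osc_le_trans _ _ _ _ _ (e + M * (ep * ln s^-1 + m%:R * s))) => //.
  rewrite mulrDr mulr2n mulrDl mul1r; lra.
exact: (osc_le_mul_compl mk meta eta01 cM hc' (logcut_osc rho ep0 (introT andP (conj s0 s2)) rp BU)).
Unshelve. all: by end_near. Qed.

End cutoff.

(** * Averages over balls of fixed radius *)

Section averaging.
Context {R : realType} (m : nat).
Local Notation mu := (@lebesgue_rV R m).
Variables (k : 'rV[R]_m -> R) (M : R).
Hypothesis mk : measurable_fun [set: 'rV[R]_m] k.
Hypothesis kM : forall x, `|k x| <= M.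

Let mB := @measurable_eball R m.

Let Bfin x r : 0 < r -> (mu (eball x r) < +oo)%E.
Proof. by move=> r0; rewrite mu_eball// ltry. Qed.

Let ik D : measurable D -> (mu D < +oo)%E -> mu.-integrable D (EFin \o k).
Proof.
by move=> mD fD; apply: (integrable_bounded_rV mD fD _ kM); exact: measurable_funTS.
Qed.

Let icst D c : measurable D -> (mu D < +oo)%E -> mu.-integrable D (EFin \o (fun=> c)).
Proof.
by move=> mD fD; apply: (@integrable_bounded_rV _ _ _ _ `|c|) => //; exact: measurable_cst.
Qed.

Let iabs x r c : 0 < r -> mu.-integrable (eball x r) (EFin \o (fun y => `|k y - c|)).
Proof.
move=> r0; apply: integrable_norm; apply: integrableB_EFin; first exact: mB.
  by apply: ik; [exact: mB|exact: Bfin].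
by apply: icst; [exact: mB|exact: Bfin].
Qed.

Definition ball_avg (rho : R) x : R := (evol m rho)^-1 * \int[mu]_(y in eball x rho) k y.

Lemma ball_avg_dist rho x c : 0 < rho ->
  `|ball_avg rho x - c| <= (evol m rho)^-1 * \int[mu]_(y in eball x rho) `|k y - c|.
Proof.
move=> r0; have v0 := evol_gt0 m r0.
have ic := icst c (mB x rho) (Bfin x r0).
have ikB := ik (mB x rho) (Bfin x r0).
have -> : ball_avg rho x - c = (evol m rho)^-1 * \int[mu]_(y in eball x rho) (k y - c).
  rewrite RintegralB// mulrBr Rintegral_cst// mu_eball//=.
  by rewrite mulrCA mulVf ?mulr1// gt_eqF.
rewrite normrM gtr0_norm ?invr_gt0// ler_wpM2l ?invr_ge0 ?(ltW v0)//.
apply: le_normr_Rintegral => //.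
exact: integrableB_EFin.
Qed.

Lemma ball_avg_near rho x y c : 0 < rho -> enorm (y - x) <= rho ->
  `|ball_avg rho y - c| <=
  (evol m rho)^-1 * \int[mu]_(y in eball x (2 * rho)) `|k y - c|.
Proof.
move=> r0 yx; apply: (le_trans (ball_avg_dist y c r0)).
rewrite ler_wpM2l ?invr_ge0 ?(ltW (evol_gt0 _ _))//.
have sub : eball y rho `<=` eball x (2 * rho).
  by apply: eball_sub; rewrite mulrDl mul1r lerD2r.
rewrite fine_le//.
- by apply: integrable_fin_num; [exact: measurable_eball|exact: iabs].
- by apply: integrable_fin_num; [exact: measurable_eball|apply: iabs; rewrite mulr_gt0].
apply: ge0_subset_integral => //; exact: measurable_absB.
Qed.

Lemma ball_avg_bounded rho x : 0 < rho -> `|ball_avg rho x| <= M.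
Proof.
move=> r0; rewrite -[ball_avg _ _]subr0 (le_trans (ball_avg_dist x 0 r0))//.
have v0 := evol_gt0 m r0.
rewrite ler_pdivrMl//; apply: (@le_trans _ _ (\int[mu]_(y in eball x rho) M)).
  apply: le_Rintegral => //.
  - exact: iabs.
  - by apply: icst; [exact: mB|exact: Bfin].
  - by move=> y _; rewrite subr0.
rewrite Rintegral_cst; last exact: measurable_eball.
by rewrite mu_eball//= mulrC.
Qed.

(** The ball [C] of radius rho + |x - y| about [x] contains both balls. Each integral differs from
    the one over [C] by at most [M] times the difference of the volumes, which tends to 0 with |x -
    y|. *)
Lemma ball_avg_lip rho x y : 0 < rho ->
  `|ball_avg rho x - ball_avg rho y| <=
  (evol m rho)^-1 * (2 * M * (evol m (rho + enorm (x - y)) - evol m rho)).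
Proof.
move=> r0; have v0 := evol_gt0 m r0; set d := enorm (x - y).
have d0 : 0 <= d by exact: enorm_ge0.
have rd : 0 < rho + d by rewrite ltr_wpDr.
pose C := eball x (rho + d).
have one z : eball z rho `<=` C ->
    `|\int[mu]_(u in C) k u - \int[mu]_(u in eball z rho) k u| <=
    M * (evol m (rho + d) - evol m rho).
  move=> zC; have mD : measurable (C `\` eball z rho) by exact: (measurableD (mB _ _) (mB _ _)).
  have muD : mu (C `\` eball z rho) = (evol m (rho + d) - evol m rho)%:E.
    rewrite (measureD (mB _ _) (mB _ _) (Bfin _ rd)).
    transitivity (mu C - mu (eball z rho))%E.
      by congr (_ - mu _)%E; exact: setIidr.
    by rewrite /C (mu_eball x rd) (mu_eball z r0).
  have fD : (mu (C `\` eball z rho) < +oo)%E by rewrite muD ltry.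
  have -> : \int[mu]_(u in C) k u = \int[mu]_(u in eball z rho) k u +
      \int[mu]_(u in C `\` eball z rho) k u.
    rewrite -Rintegral_setU//; first by rewrite setDUK.
    + by rewrite setDUK//; apply: ik; [exact: mB|exact: Bfin].
    + by apply/disj_setPS => u [? []].
  rewrite addrAC subrr add0r (le_trans (le_normr_Rintegral mD (ik mD fD)))//.
  have -> : M * (evol m (rho + d) - evol m rho) = \int[mu]_(u in C `\` eball z rho) M.
    by rewrite Rintegral_cst// muD.
  by apply: le_Rintegral => //; [exact/integrable_norm/ik|exact: icst].
have hx : `|\int[mu]_(u in C) k u - \int[mu]_(u in eball x rho) k u| <=
    M * (evol m (rho + d) - evol m rho).
  by apply: one; apply: sub_eball; rewrite lerDl.
have hy : `|\int[mu]_(u in C) k u - \int[mu]_(u in eball y rho) k u| <=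
    M * (evol m (rho + d) - evol m rho).
  by apply: one; apply: eball_sub; rewrite enormBC addrC.
rewrite /ball_avg -mulrBr normrM gtr0_norm ?invr_gt0// ler_wpM2l ?invr_ge0 ?(ltW v0)//.
have tri (a b P K : R) : `|P - a| <= K -> `|P - b| <= K -> `|a - b| <= K + K.
  by move=> ha hb; rewrite (le_trans (ler_distD P _ _))// distrC lerD.
rewrite -mulrA (_ : forall t : R, 2 * t = t + t); last by move=> t; ring.
exact: (tri _ _ _ _ hx hy).
Qed.

Lemma continuous_ball_avg rho : 0 < rho -> continuous (ball_avg rho).
Proof.
move=> r0 x; apply/(@cvgrPdist_le _ _ _ (nbhs x) (nbhs_filter x)) => e e0.
pose phi (d : R) := (evol m rho)^-1 * (2 * M * (evol m (rho + d) - evol m rho)).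
have cphi : phi d @[d --> (0 : R)] --> phi 0.
  rewrite /phi; apply: cvgM; first exact: cvg_cst.
  apply: cvgM; first exact: cvg_cst.
  apply: cvgB; last exact: cvg_cst.
  rewrite /evol; apply: cvgM; last exact: cvg_cst.
  apply: (@continuous_comp _ _ _ (fun d : R => rho + d) (fun t => t ^+ m)).
    by apply: cvgD; [exact: cvg_cst|exact: cvg_id].
  exact: exprn_continuous.
have phi0 : phi 0 = 0 by rewrite /phi addr0 subrr !mulr0.
move/cvgrPdist_le : cphi => /(_ _ e0) /nbhs_ballP[dl /= dl0 hdl].
have : nbhs x (eball x dl) by apply: open_nbhs_nbhs; split; [exact: open_eball|exact: mem_eball].
apply: filterS => y; rewrite /eball/= enormBC => xy.
apply: (le_trans (ball_avg_lip x y r0)); rewrite -/(phi _).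
have := hdl (enorm (x - y)); rewrite /ball/= sub0r normrN ger0_norm ?enorm_ge0// => /(_ xy).
by rewrite phi0 sub0r normrN; apply: le_trans; exact: ler_norm.
Qed.

Variables (e r1 : R).
Hypothesis e0 : 0 < e.
Hypothesis osc : forall x r, 0 < r < r1 -> osc_le k x r e.

(** The condition [2 * rho < r1] allows the hypothesis on doubled balls. In the constant, one
    [2 ^+ m] compares the radii 2 rho and rho, the other the radii r + rho <= 2 r and r; the factor
    2 adds the deviation of [k] to that of its average. *)
Lemma averaging rho : 0 < rho -> 2 * rho < r1 -> forall x r, 0 < r ->
  osc_le (fun y => k y - ball_avg rho y) x r (2 ^+ m * (2 ^+ m * 2) * e).
Proof.
move=> r0 rr1; have v0 := evol_gt0 m r0; set g := ball_avg rho.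
have mg : measurable_fun [set: 'rV[R]_m] g.
  by apply: measurable_continuous_rV; exact: continuous_ball_avg.
have mkg : measurable_fun [set: 'rV[R]_m] (fun y => k y - g y) by exact: measurable_funB.
have r20 : 0 < 2 * rho by rewrite mulr_gt0.
have r1' : rho < r1 by rewrite (le_lt_trans _ rr1)// ler_peMl ?(ltW r0)// ler1n.
have p1 : 1 <= 2 ^+ m :> R by rewrite exprn_ege1// ler1n.
(* One constant serves twice: it is close to [k] in mean on the doubled ball, and uniformly close to
   the averages at all centres within [rho] of [z]. *)
have near z : exists c, (\int[mu]_(y in eball z (2 * rho)) (`|k y - c|)%:E <= (2 ^+ m * e * evol m rho)%:E)%E
    /\ forall y, enorm (y - z) <= rho -> `|g y - c| <= 2 ^+ m * e.
  have [c hc] : osc_le k z (2 * rho) e by apply: osc; rewrite r20.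
  have hc' : (\int[mu]_(y in eball z (2 * rho)) (`|k y - c|)%:E <= (2 ^+ m * e * evol m rho)%:E)%E.
    by rewrite (le_trans hc)// lee_fin evol2 (mulrC _ e) mulrA.
  exists c; split => // y yz; apply: (le_trans (ball_avg_near c r0 yz)).
  rewrite ler_pdivrMl// [leRHS]mulrC -lee_fin /Rintegral fineK//.
  exact: (integrable_fin_num (mB _ _) (iabs _ _ r20)).
have mabsk z c r' : measurable_fun (eball z r') (fun y => `|k y - c|).
  by have /measurable_EFinP := measurable_absB c mk (D := eball z r').
have mabsg z c r' : measurable_fun (eball z r') (fun y => `|g y - c|).
  by have /measurable_EFinP := measurable_absB c mg (D := eball z r').
move=> x r rp; have [rr|rr] := ltP r rho.
  have [c1 hc1] : osc_le k x r e by apply: osc; rewrite rp (lt_trans rr).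
  have [c2 [_ hc2]] := near x.
  exists (c1 - c2).
  apply: (@le_trans _ _ (\int[mu]_(y in eball x r) (`|k y - c1| + 2 ^+ m * e)%:E)%E).
    apply: ge0_le_integral_rV => //.
    + by have /measurable_EFinP := measurable_absB (c1 - c2) mkg (D := eball x r).
    + by apply: measurable_funD => //; exact: measurable_cst.
    move=> y yB; have -> : k y - g y - (c1 - c2) = (k y - c1) - (g y - c2) by ring.
    rewrite (le_trans (ler_normB _ _))// lerD2l hc2// ltW//.
    exact: lt_trans yB rr.
  under eq_integral do rewrite EFinD.
  rewrite ge0_integralD; first last.
  - exact: measurable_cst.
  - by move=> y _; rewrite lee_fin !mulr_ge0 ?(ltW e0)// exprn_ge0.
  - exact/measurable_EFinP.
  - by move=> y _; rewrite lee_fin.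
  - exact: mB.
  rewrite integral_cst; last exact: mB.
  rewrite (mu_eball x rp) -EFinM; apply: (le_trans (leeD hc1 (lexx _))).
  rewrite -EFinD lee_fin -mulrDl ler_wpM2r ?(ltW (evol_gt0 _ _))//.
  have : 0 <= e * (2 ^+ m - 1) by rewrite mulr_ge0 ?(ltW e0)// subr_ge0.
  have : 0 <= e * ((2 ^+ m - 1) * (2 ^+ m - 1)).
    by rewrite !mulr_ge0 ?(ltW e0)// subr_ge0.
  nra.
(* For [rho <= r], integrate in [z] the estimates on the balls [eball z rho]. *)
exists 0.
pose S := [set p : 'rV[R]_m * 'rV[R]_m | enorm (p.2 - p.1) < rho].
have mS : measurable S.
  have md : measurable_fun [set: 'rV[R]_m * 'rV[R]_m] (fun p => p.2 - p.1).
    apply: measurable_fun_rV => i; under eq_fun do rewrite !mxE.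
    by apply: measurable_funB; apply: (measurableT_comp (measurable_coor i)).
  have -> : S = (fun p => p.2 - p.1) @^-1` eball 0 rho.
    by apply/seteqP; split => p; rewrite /S /eball/= subr0.
  by rewrite -[X in measurable X]setTI; exact: md.
have SE y z : ((y, z) \in S) = (y \in eball z rho).
  by apply/idP/idP; rewrite !inE /S /eball/= enormBC.
have SE' y z : ((y, z) \in S) = (z \in eball y rho).
  by apply/idP/idP; rewrite !inE /S /eball/=.
pose G (p : 'rV[R]_m * 'rV[R]_m) : \bar R :=
  (\1_(eball x r) p.1 * \1_S p * `|k p.1 - g p.1|)%:E.
have mG : measurable_fun [set: 'rV[R]_m * 'rV[R]_m] G.
  apply/measurable_EFinP; apply: measurable_funM.
    apply: measurable_funM; last exact: measurable_indic.
    have m1B : measurable_fun [set: 'rV[R]_m] (\1_(eball x r) : _ -> R).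
      exact: measurable_indic.
    exact: (measurableT_comp m1B).
  apply: measurableT_comp; first exact: normr_measurable.
  exact: (measurableT_comp mkg).
have G0 p : (0 <= G p)%E by rewrite lee_fin !mulr_ge0.
have L1 : ((evol m rho)%:E * \int[mu]_(y in eball x r) (`|k y - g y - 0|)%:E <=
    \int[mu]_y \int[mu]_z G (y, z))%E.
  rewrite -ge0_integralZl; first last.
  - by rewrite lee_fin ltW.
  - by move=> y _; rewrite lee_fin.
  - exact: measurable_absB.
  - exact: mB.
  rewrite (integral_mkcond (eball x r)); apply: ge0_le_integral.
  - exact: measurableT.
  - by move=> y _; rewrite patchE; case: ifPn => // _; rewrite mule_ge0// lee_fin ltW.
  - apply: (measurable_restrictT _ (mB x r)).1.
    by apply: measurable_funeM; exact: measurable_absB.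
  - exact: measurable_tonelli_rV.
  move=> y _; rewrite patchE; case: ifPn => yB; last by apply: integral_ge0 => z _; exact: G0.
  rewrite (@eq_integral _ _ _ mu setT (fun z => (`|k y - g y|)%:E * (\1_(eball y rho) z)%:E)%E); last first.
    by move=> z _; rewrite /G/= !indicE yB SE' mul1r -EFinM mulrC.
  rewrite ge0_integralZl_EFin; first last.
  - exact: normr_ge0.
  - by apply/measurable_EFinP; exact: measurable_indic.
  - by move=> z _; rewrite lee_fin.
  - exact: measurableT.
  by rewrite integral_indic// setIT mu_eball// subr0 muleC.
have Q1 : (\int[mu]_z \int[mu]_y G (y, z) <= (2 * (2 ^+ m * e * evol m rho) * (2 ^+ m * evol m r))%:E)%E.
  pose K := 2 * (2 ^+ m * e * evol m rho).
  have K0 : 0 <= K.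
    apply: mulr_ge0 => //; apply: mulr_ge0; last exact: ltW.
    by apply: mulr_ge0; [exact: exprn_ge0|exact: ltW].
  apply: (@le_trans _ _ (\int[mu]_(z in eball x (r + rho)) K%:E)%E); last first.
    rewrite integral_cst; last exact: mB.
    rewrite mu_eball ?addr_gt0// -EFinM lee_fin ler_wpM2l//.
    by rewrite -evol2 le_evol ?addr_gt0// mulrDl mul1r lerD2l.
  rewrite (integral_mkcond (eball x (r + rho))); apply: ge0_le_integral.
  - exact: measurableT.
  - by move=> z _; apply: integral_ge0 => y _; exact: G0.
  - exact: (measurable_fun_fubini_tonelli_G (m1 := lam m) G mG G0).
  - exact: ((measurable_restrictT _ (mB _ _)).1 (measurable_cst _)).
  move=> z _; rewrite patchE; case: ifPn => [_|/negP nz]; last first.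
    rewrite integral0_eq// => y _; rewrite /G/= !indicE SE.
    case: (boolP (y \in eball x r)) => [/set_mem yx|_]; last by rewrite !mul0r.
    case: (boolP (y \in eball z rho)) => [/set_mem yz|_]; last by rewrite mulr0 mul0r.
    exfalso; apply: nz; apply/mem_set; rewrite /eball/=.
    rewrite (le_lt_trans (enorm_triangle z y x))// addrC ltrD//.
    by rewrite enormBC.
  have [c [hc1 hc2]] := near z.
  apply: (@le_trans _ _ (\int[mu]_(y in eball z rho) (`|k y - c| + 2 ^+ m * e)%:E)%E).
    rewrite (integral_mkcond (eball z rho)); apply: ge0_le_integral.
    + exact: measurableT.
    + by move=> y _; exact: G0.
    + exact: (measurableT_comp mG (pair2_measurable z)).
    + apply: (measurable_restrictT _ (mB z rho)).1; apply/measurable_EFinP.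
      by apply: measurable_funD => //; exact: measurable_cst.
    move=> y _; rewrite patchE /G/= !indicE SE; case: ifPn => yz; last by rewrite mulr0 mul0r.
    rewrite mulr1 lee_fin; apply: (@le_trans _ _ `|k y - g y|).
      by case: (_ \in _); rewrite ?mul1r// mul0r.
    have -> : k y - g y = (k y - c) - (g y - c) by ring.
    rewrite (le_trans (ler_normB _ _))// lerD2l hc2// ltW//.
    exact: set_mem yz.
  under eq_integral do rewrite EFinD.
  rewrite ge0_integralD; first last.
  - exact: measurable_cst.
  - by move=> y _; rewrite lee_fin !mulr_ge0 ?(ltW e0)// exprn_ge0.
  - exact/measurable_EFinP.
  - by move=> y _; rewrite lee_fin.
  - exact: mB.
  rewrite integral_cst; last exact: mB.
  rewrite (mu_eball z r0) -EFinM.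
  have sub : eball z rho `<=` eball z (2 * rho).
    by apply: sub_eball; rewrite ler_peMl ?(ltW r0)// ler1n.
  have hc3 : (\int[mu]_(y in eball z rho) (`|k y - c|)%:E <= (2 ^+ m * e * evol m rho)%:E)%E.
    apply: le_trans hc1; apply: ge0_subset_integral => //.
    exact: measurable_absB.
  apply: (le_trans (leeD hc3 (lexx _))).
  by rewrite -EFinD lee_fin /K mulrDl mul1r.
have := le_trans L1 (eq_ind_r (fun z => z <= _)%E Q1 (tonelli_rV mG G0)).
rewrite -lee_pdivlMl// -EFinM => h; apply: (le_trans h).
rewrite lee_fin le_eqVlt; apply/orP; left; apply/eqP; field.
by rewrite gt_eqF.
Qed.

End averaging.

(** * Approximation by bounded continuous functions *)

Section vmo_approx.
Context {R : realType} (m : nat).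
Local Notation mu := (@lebesgue_rV R m).

Lemma vmo_approx (U : set 'rV[R]_m) (z0 : 'rV[R]_m) (h : 'rV[R]_m -> R) :
  open U -> ~ U z0 -> (mu U < +oo)%E -> measurable_fun [set: 'rV[R]_m] h ->
  mu.-integrable U (EFin \o h) ->
  (forall e, 0 < e -> exists2 r0, 0 < r0 &
    forall x r, 0 < r < r0 -> eball x r `<=` U -> osc_le h x r e) ->
  forall e, 0 < e -> exists (g : 'rV[R]_m -> R) (M : R),
    [/\ continuous g, forall x, `|g x| <= M &
    forall x r, 0 < r -> eball x r `<=` U -> osc_le (fun y => h y - g y) x r e].
Proof.
move=> oU Uz0 Ufin mh ih small e e0.
have mU := measurable_open_rV oU.
(* The first 3 is one share for truncation and two for the cutoff; the rest is the constant of
   [averaging], applied to [l], whose oscillation is at most 3 shares. *)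
pose K : R := 3 + 2 ^+ m * (2 ^+ m * 2) * 3.
have K0 : 0 < K by rewrite ltr_wpDr// !mulr_ge0// exprn_ge0.
pose e' := e / K; have e'0 : 0 < e' by rewrite divr_gt0.
have [r0 r00 osch] := small e' e'0.
have [M M0 tr] := truncation mU mh ih e'0 r00 osch.
pose k y := trunc M (h y).
have mk : measurable_fun [set: 'rV[R]_m] k by exact: measurable_trunc.
have kM x : `|k x| <= M by apply: trunc_le; exact: ltW.
have osck x r : 0 < r < r0 -> eball x r `<=` U -> osc_le k x r e'.
  move=> rr BU; apply: (osc_le_dominated mh mk _ (osch x r rr BU)) => c.
  by exists (trunc M c) => y; apply: trunc_lip; exact: ltW.
have [eta [d [meta d0 eta01 etad cut]]] := cutoff oU Uz0 Ufin mk M0 kM e'0 r00 osck.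
pose l y := k y * eta y.
have ml : measurable_fun [set: 'rV[R]_m] l by exact: measurable_funM.
have m1 : measurable_fun [set: 'rV[R]_m] (fun y => k y * (1 - eta y)).
  by apply: measurable_funM => //; exact: measurable_funB.
have m1N : measurable_fun [set: 'rV[R]_m] (fun y => - (k y * (1 - eta y))).
  exact: measurableT_comp.
have lM x : `|l x| <= M.
  rewrite normrM (le_trans _ (kM x))// ler_piMr//.
  by rewrite ler_norml; have := eta01 x; lra.
(* A ball of radius below d / 2 that leaves [U] lies within distance [d] of the complement, where
   [eta], and with it [l], vanishes. So [l] has small oscillation on all small balls of the whole
   space. *)
pose r1 := Num.min r0 (d / 2).
have oscl x r : 0 < r < r1 -> osc_le l x r (3 * e').
  move=> /andP[rp]; rewrite lt_min => /andP[rr0 rd].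
  have [BU|/existsNP[y /not_implyP[yB yU]]] := pselect (eball x r `<=` U).
    have cN : osc_le (fun y => - (k y * (1 - eta y))) x r (2 * e').
      apply: (osc_le_dominated m1 m1N _ (cut x r rp BU)) => c.
      by exists (- c) => y; rewrite -opprD normrN.
    have := osc_leD mk m1N (osck x r (introT andP (conj rp rr0)) BU) cN.
    rewrite (_ : e' + 2 * e' = 3 * e'); last by ring.
    by apply: osc_le_ext => y _; rewrite /l; ring.
  exists 0; rewrite (@eq_integral _ _ _ mu (eball x r) (fun=> 0%E)).
    by rewrite integral0 lee_fin mulr_ge0 ?(ltW (evol_gt0 _ _))// mulr_ge0// ltW.
  move=> z /set_mem zB; rewrite /l etad ?mulr0 ?subr0 ?normr0//.
  rewrite (le_trans (cdist_le _ yU))// (le_trans (enorm_triangle _ x _))//.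
  move: yB zB; rewrite /eball/= (enormBC x z); lra.
pose rho := r1 / 3.
have r10 : 0 < r1 by rewrite lt_min r00 divr_gt0.
have rho0 : 0 < rho by rewrite divr_gt0.
have rhor : 2 * rho < r1 by rewrite /rho; lra.
have e30 : 0 < 3 * e' by rewrite mulr_gt0.
have av := averaging ml lM e30 oscl rho0 rhor.
have cg := continuous_ball_avg ml lM rho0.
exists (ball_avg l rho), M; split => // [x|x r rp BU]; first exact: ball_avg_bounded.
have mg := measurable_continuous_rV cg.
have mhk : measurable_fun [set: 'rV[R]_m] (fun y => h y - k y) by exact: measurable_funB.
have mlg : measurable_fun [set: 'rV[R]_m] (fun y => l y - ball_avg l rho y).
  exact: measurable_funB.
have o1 := osc_leD mhk m1 (tr x r rp BU) (cut x r rp BU).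
have o2 := osc_leD (measurable_funD mhk m1) mlg o1 (av x r rp).
apply: (osc_le_trans rp _ (osc_le_ext _ o2)).
  have -> : e' + 2 * e' + 2 ^+ m * (2 ^+ m * 2) * (3 * e') = e' * K by rewrite /K; ring.
  by rewrite /e' divfK// gt_eqF.
by move=> y _; rewrite /l/=; ring.
Qed.

End vmo_approx.

(** * Weak derivatives on cylinders *)

Section slices.
Context {R : realType} (n : nat).
Implicit Types (psi : 'rV[R]_n.+1 -> R) (x : 'rV[R]_n) (t : R).

Lemma col'_append x t : col' ord_max (append x t) = x.
Proof. by apply/rowP => i; rewrite !mxE liftK. Qed.

Lemma append_last x t : append x t 0 ord_max = t.
Proof. by rewrite mxE unlift_none. Qed.

Lemma append_col' (y : 'rV[R]_n.+1) : append (col' ord_max y) (y 0 ord_max) = y.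
Proof. by apply/rowP => i; rewrite !mxE; case: unliftP => [j ->|->] //=; rewrite mxE. Qed.

Lemma append_line x t : append x t = t *: delta_mx 0 ord_max + append x 0.
Proof.
apply/rowP => i; rewrite !mxE; case: unliftP => [j ->|->] /=.
  by rewrite eq_sym (negbTE (neq_lift _ _)) mulr0 add0r.
by rewrite eqxx mulr1 addr0.
Qed.

Lemma append_slice (a t : R) i x :
  append (a *: delta_mx 0 i + x) t = a *: delta_mx 0 (lift ord_max i) + append x t.
Proof.
apply/rowP => j; rewrite !mxE; case: unliftP => [k ->|->] /=.
  by rewrite !mxE (inj_eq lift_inj).
by rewrite (negbTE (neq_lift _ _)) mulr0 add0r.
Qed.

Lemma continuous_append t : continuous (fun x => append x t).
Proof.
move=> x; apply/(@cvg_ballP _ _ _ _ (nbhs_filter x)) => e e0.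
apply/nbhs_ballP; exists e => // y /= [_ hxy].
apply/ball_rV; split=> // i; rewrite !mxE; case: unliftP => [k _|_] /=.
  exact: (hxy 0 k).
by rewrite subrr normr0.
Qed.

Lemma continuous_col' : continuous (col' ord_max : 'rV[R]_n.+1 -> 'rV[R]_n).
Proof.
move=> x; apply/(@cvg_ballP _ _ _ _ (nbhs_filter x)) => e e0.
apply/nbhs_ballP; exists e => // y /= [_ hxy].
by split=> // i j; rewrite !mxE.
Qed.

Lemma measurable_col' : measurable_fun [set: 'rV[R]_n.+1] (col' ord_max : _ -> 'rV[R]_n).
Proof.
apply: measurable_fun_rV => i; under eq_fun do rewrite mxE.
exact: measurable_coor.
Qed.

Lemma Ck_slice k psi t : Ck k psi -> Ck k (fun x => psi (append x t)).
Proof.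
have C f : continuous f -> continuous (fun x => f (append x t) : R).
  by move=> cf x; apply: continuous_comp; [exact: continuous_append|exact: cf].
elim: k psi => [|k IH] psi; first by case=> c _; split => //; exact: C.
case=> c h; split; first exact: C.
move=> i; have [d ck] := h (lift ord_max i).
have E x a : psi (append (a *: delta_mx 0 i + x) t) = psi (a *: delta_mx 0 (lift ord_max i) + append x t).
  by rewrite append_slice.
split.
  move=> x; have := d (append x t); rewrite /derivable.
  by under [in X in _ -> X]eq_fun do rewrite /= E.
rewrite (_ : partial i _ = fun x => partial (lift ord_max i) psi (append x t)).
  exact: IH.
apply/funext => x; rewrite /partial /derive.
by under [in LHS]eq_fun do rewrite /= E.
Qed.

Lemma partial_slice psi t i x :
  partial i (fun x => psi (append x t)) x = partial (lift ord_max i) psi (append x t).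
Proof.
rewrite /partial /derive.
by under [in LHS]eq_fun do rewrite /= append_slice.
Qed.

Lemma is_derive_append psi x t : smooth psi ->
  is_derive t 1 (fun s => psi (append x s)) (partial ord_max psi (append x t)).
Proof.
move=> s; rewrite (_ : (fun s => _) = fun h => psi (h *: delta_mx 0 ord_max + append x 0)).
  apply: is_derive_line_shift; rewrite -append_line.
  exact/derivableP/smooth_derivable.
by apply/funext => h; rewrite append_line.
Qed.

Lemma continuous_append_r psi x : smooth psi -> continuous (fun t => psi (append x t)).
Proof.
move=> s t; apply/differentiable_continuous/derivable1_diffP.
exact: (@ex_derive _ _ _ _ _ _ _ (is_derive_append x t s)).
Qed.

(** The endpoints are arbitrary because, besides the cylinder over []-d, d[], short cylinders around
    balls at any height are needed. *)
Definition cyl (A : set 'rV[R]_n) (a b : R) : set 'rV[R]_n.+1 :=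
  [set y | A (col' ord_max y) /\ a < y 0 ord_max < b].

Lemma cyl_append A a b x t : cyl A a b (append x t) <-> A x /\ a < t < b.
Proof. by rewrite /cyl/= col'_append append_last. Qed.

Lemma measurable_cyl A a b : measurable A -> measurable (cyl A a b).
Proof.
move=> mA; have -> : cyl A a b = col' ord_max @^-1` A `&`
    (fun y : 'rV[R]_n.+1 => y 0 ord_max) @^-1` `]a, b[%classic.
  by apply/seteqP; split => y; rewrite /cyl/= in_itv.
apply: measurableI; rewrite -[X in measurable X]setTI; first exact: measurable_col'.
exact: measurable_coor.
Qed.

Lemma open_cyl A a b : open A -> open (cyl A a b).
Proof.
move=> oA; have -> : cyl A a b = col' ord_max @^-1` A `&`
    (fun y : 'rV[R]_n.+1 => y 0 ord_max) @^-1` `]a, b[%classic.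
  by apply/seteqP; split => y; rewrite /cyl/= in_itv.
apply: openI; apply: open_comp => //; first by move=> y _; exact: continuous_col'.
  by move=> y _; exact: coord_continuous.
Qed.

Lemma test_function_slice A a b psi t : test_function (cyl A a b) psi ->
  test_function A (fun x => psi (append x t)).
Proof.
move=> [s cK KD].
apply: (@test_function_supp _ _ A (col' ord_max @` closure [set x | psi x != 0])).
- by move=> k; exact: Ck_slice.
- apply: continuous_compact cK; apply: continuous_subspaceT; exact: continuous_col'.
- by move=> _ [y Ky <-]; have [] := KD _ Ky.
- by move=> x px; exists (append x t); [exact: subset_closure|exact: col'_append].
Qed.

Lemma cyl_patchE A a b (F : 'rV[R]_n.+1 -> \bar R) x t :
  (F \_ (cyl A a b)) (append x t) =
  ((fun x => ((fun t => F (append x t)) \_ `]a, b[%classic) t) \_ A) x.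
Proof.
rewrite !patchE; case: (boolP (x \in A)) => [/set_mem Ax|nA]; last first.
  rewrite ifF//; apply/negP => /set_mem /cyl_append[Ax _].
  by move/negP : nA; apply; exact: mem_set.
case: ifPn => [/set_mem /cyl_append[_ h]|nC]; first by rewrite mem_set//= in_itv.
rewrite ifF//; apply/negP => /set_mem /=; rewrite in_itv/= => h.
by move/negP : nC; apply; apply/mem_set/cyl_append.
Qed.

Local Notation mu := (@lebesgue_rV R _).

(** Around a ball of radius r the factor b - a is 2 r: this is the gain of one power of the
    radius. *)
Lemma ge0_integral_cyl A a b (w : 'rV[R]_n -> \bar R) : a < b -> measurable A ->
  measurable_fun A w -> (forall x, (0 <= w x)%E) ->
  (\int[mu]_(y in cyl A a b) w (col' ord_max y) = (b - a)%:E * \int[mu]_(x in A) w x)%E.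
Proof.
move=> ab mA mw w0.
have mw' := (measurable_restrictT _ mA).1 mw.
have w0' x : (0 <= (w \_ A) x)%E by rewrite patchE; case: ifP.
have mC := measurable_cyl a b mA.
rewrite integral_mkcond [X in (_ * X)%E]integral_mkcond ge0_integral_rVS; first last.
- by move=> y; rewrite patchE; case: ifP.
- have -> : (fun y => w (col' ord_max y)) \_ (cyl A a b) =
      (fun y => (w \_ A) (col' ord_max y)) \_ (cyl A a b).
    apply/funext => y; rewrite !patchE; case: ifPn => // /set_mem[Ay _].
    by rewrite mem_set.
  apply/(measurable_restrictT _ mC); apply: measurable_funTS.
  exact: (measurableT_comp mw' measurable_col').
rewrite -ge0_integralZl_EFin ?subr_ge0 ?(ltW ab)//; apply: eq_integral => x _.
under eq_integral do rewrite cyl_patchE.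
rewrite [in RHS]patchE; case: ifPn => xA.
  rewrite (@eq_integral _ _ _ lebesgue_measure setT ((cst (w x)) \_ `]a, b[%classic)); last first.
    by move=> t _; rewrite !patchE xA col'_append.
  rewrite -integral_mkcond integral_cst//= lebesgue_measure_itv/= lte_fin ab.
  by rewrite muleC EFinB.
by rewrite mule0; apply: integral0_eq => t _; rewrite patchE (negbTE xA).
Qed.

End slices.

Section weak_partials.
Context {R : realType} (m : nat).
Local Notation mu := (@lebesgue_rV R m).
Implicit Types (D : set 'rV[R]_m) (g dg h dh : 'rV[R]_m -> R).

Lemma integrable_L1loc D g : measurable D -> mu.-integrable D (EFin \o g) -> L1loc D g.
Proof.
move=> mD ig; split; first by move/integrableP : ig => [/measurable_EFinP].
move=> K cK KD; apply: (integrableS mD _ KD ig).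
rewrite -(setCK K); apply: measurableC; apply: measurable_open_rV.
by apply: closed_openC; apply: compact_closed => //; exact: hausdorff_rV.
Qed.

(** With a single vanishing integral, the definition becomes additive in the pair [(g, dg)] and can
    be verified slice by slice. *)
Lemma weak_partial_zero D i g dg : measurable D -> mu.-integrable D (EFin \o g) ->
  mu.-integrable D (EFin \o dg) ->
  (forall psi, test_function D psi ->
    \int[mu]_(x in D) (g x * partial i psi x + dg x * psi x) = 0) <->
  weak_partial D i g dg.
Proof.
move=> mD ig idg.
have H psi : test_function D psi -> \int[mu]_(x in D) (g x * partial i psi x + dg x * psi x) =
    \int[mu]_(x in D) (g x * partial i psi x) + \int[mu]_(x in D) (dg x * psi x).
  move=> tp; rewrite RintegralD//; last exact: (integrable_test _ idg tp).
  exact: (integrable_test _ ig (test_function_partial i tp)).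
split=> [h|[_ _ h] psi tp]; last by rewrite H// h// addrC subrr.
split; [exact: integrable_L1loc|exact: integrable_L1loc|move=> psi tp].
by apply/eqP; rewrite -addr_eq0 -H// h.
Qed.

Lemma weak_partialD D i g dg h dh : measurable D ->
  mu.-integrable D (EFin \o g) -> mu.-integrable D (EFin \o dg) ->
  mu.-integrable D (EFin \o h) -> mu.-integrable D (EFin \o dh) ->
  weak_partial D i g dg -> weak_partial D i h dh ->
  weak_partial D i (fun x => g x + h x) (fun x => dg x + dh x).
Proof.
move=> mD ig idg ih idh /(weak_partial_zero i mD ig idg) wg /(weak_partial_zero i mD ih idh) wh.
apply/weak_partial_zero => //; [exact: integrableD_EFin|exact: integrableD_EFin|].
move=> psi tp.
transitivity (\int[mu]_(x in D) ((g x * partial i psi x + dg x * psi x) +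
  (h x * partial i psi x + dh x * psi x))).
  by apply: eq_Rintegral => x _; ring.
have tp' := test_function_partial i tp.
rewrite RintegralD//; first by rewrite wg// wh// addr0.
- by apply: integrableD_EFin => //; [exact: integrable_test ig tp'|exact: integrable_test idg tp].
- by apply: integrableD_EFin => //; [exact: integrable_test ih tp'|exact: integrable_test idh tp].
Qed.

End weak_partials.

(** * Products of a function of the base and a function of the height *)

Section cylinder_partials.
Context {R : realType} (n : nat).
Local Notation mu := (@lebesgue_rV R _).
Variables (A : set 'rV[R]_n) (a b : R).
Hypothesis ab : a < b.
Hypothesis mA : measurable A.
Implicit Types (g dg : 'rV[R]_n -> R).
Local Notation C := (cyl A a b).
Local Notation p := (col' ord_max).

Lemma measurable_fun_cyl (w : 'rV[R]_n -> \bar R) :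
  measurable_fun A w -> measurable_fun C (fun y => w (p y)).
Proof.
move=> mw; apply: (eq_measurable_fun (fun y => (w \_ A) (p y))).
  by move=> y /set_mem[Ay _]; rewrite patchE mem_set.
have mw' := (measurable_restrictT _ mA).1 mw.
apply: measurable_funTS; exact: (measurableT_comp mw' (@measurable_col' R n)).
Qed.

Lemma integrable_cyl (tau : R -> R) M g : mu.-integrable A (EFin \o g) ->
  measurable_fun [set: R] tau -> (forall t, a < t < b -> `|tau t| <= M) ->
  mu.-integrable C (EFin \o (fun y => g (p y) * tau (y 0 ord_max))).
Proof.
move=> ig mt tM; have mC := measurable_cyl a b mA.
have [mg Ig] := integrableP _ _ _ ig.
apply: (@integrable_mul_bounded _ _ _ _ _ M) => //.
- apply/integrableP; split; first exact: (measurable_fun_cyl mg).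
  have -> : (\int[mu]_(y in C) `|(EFin \o (fun y => g (p y))) y| =
      \int[mu]_(y in C) (fun x => `|(EFin \o g) x|) (p y))%E by [].
  rewrite (ge0_integral_cyl ab mA (w := fun x => `|(EFin \o g) x|%E))//.
    by rewrite lte_mul_pinfty// lee_fin subr_ge0 ltW.
  exact: measurableT_comp.
- apply: measurable_funTS; apply: (measurableT_comp mt); exact: measurable_coor.
- by move=> y [_ ty]; exact: tM.
Qed.

Lemma EFin_Rintegral_cyl h : mu.-integrable C (EFin \o h) ->
  (\int[mu]_(y in C) h y)%:E =
    (\int[mu]_x \int[lebesgue_measure]_t ((EFin \o h) \_ C) (append x t))%E /\
  (\int[mu]_(y in C) h y)%:E =
    (\int[lebesgue_measure]_t \int[mu]_x ((EFin \o h) \_ C) (append x t))%E.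
Proof.
have mC := measurable_cyl a b mA.
move=> ih; rewrite /Rintegral fineK; last exact: integrable_fin_num.
have /integrable_mkcond -/(_ mC) ih' := ih.
by rewrite integral_mkcond; have := integral_rVS ih'.
Qed.

(** At a fixed height [tau t] is a constant factor and the slice of [psi] is a test function on [A],
    so the inner integral over the base already vanishes. *)
Lemma weak_partial_cyl_lift (tau : R -> R) M i g dg : mu.-integrable A (EFin \o g) ->
  mu.-integrable A (EFin \o dg) -> weak_partial A i g dg ->
  measurable_fun [set: R] tau -> (forall t, a < t < b -> `|tau t| <= M) ->
  weak_partial C (lift ord_max i) (fun y => g (p y) * tau (y 0 ord_max))
    (fun y => dg (p y) * tau (y 0 ord_max)).
Proof.
move=> ig idg /(weak_partial_zero i mA ig idg) wg mt tM.
have mC := measurable_cyl a b mA.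
have ig' := integrable_cyl ig mt tM; have idg' := integrable_cyl idg mt tM.
apply/weak_partial_zero => // psi tp.
have tp' := test_function_partial (lift ord_max i) tp.
set h := fun y => _.
have ih : mu.-integrable C (EFin \o h).
  by apply: integrableD_EFin => //; [exact: integrable_test ig' tp'|exact: integrable_test idg' tp].
apply: EFin_inj; rewrite (EFin_Rintegral_cyl ih).2.
apply: integral0_eq => t _.
have ts := test_function_slice t tp.
pose hs x := g x * partial i (fun x => psi (append x t)) x + dg x * psi (append x t).
have ihs : mu.-integrable A (EFin \o hs).
  apply: integrableD_EFin => //; last exact: integrable_test idg ts.
  exact: integrable_test ig (test_function_partial i ts).
have [tab|tab] := boolP (a < t < b); last first.
  apply: integral0_eq => x _; rewrite patchE; case: ifPn => // /set_mem/cyl_append[_].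
  by rewrite (negbTE tab).
rewrite (@eq_integral _ _ _ mu setT ((EFin \o (fun x => tau t * hs x)) \_ A)).
  rewrite -integral_mkcond.
  have E : (\int[mu]_(x in A) (tau t * hs x)%:E = (\int[mu]_(x in A) (tau t * hs x))%:E)%E.
    by rewrite /Rintegral fineK//; apply: integrable_fin_num => //; exact: integrableZl_EFin.
  by rewrite /comp/= E RintegralZl// wg// mulr0.
move=> x _; rewrite cyl_patchE !patchE; case: ifPn => // xA.
rewrite ifT; last by rewrite mem_set//= in_itv.
rewrite /h/= /hs partial_slice !col'_append !append_last; congr EFin.
by ring.
Qed.

(** Over a fixed base point the integrand is the derivative in t of g x * tau t * psi, and the
    fundamental theorem of calculus gives 0. Affine [tau] covers both summands of the extension. *)
Lemma weak_partial_cyl_last (c0 c1 : R) g : mu.-integrable A (EFin \o g) ->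
  weak_partial C ord_max (fun y => g (p y) * (c0 + c1 * y 0 ord_max))
    (fun y => g (p y) * c1).
Proof.
move=> ig; have mC := measurable_cyl a b mA.
pose tau t := c0 + c1 * t : R.
have mt : measurable_fun [set: R] tau.
  by apply: measurable_funD; [exact: measurable_cst|exact: measurable_funM].
have tM t : a < t < b -> `|tau t| <= `|c0| + `|c1| * (`|a| + `|b|).
  move=> /andP[at_ tb]; rewrite (le_trans (ler_normD _ _))// lerD2l normrM ler_wpM2l//.
  rewrite ler_norml; apply/andP; split.
    by have := ler_norm (- a); have := normr_ge0 b; rewrite normrN; lra.
  by have := ler_norm b; have := normr_ge0 a; lra.
have ig' := integrable_cyl ig mt tM.
have idg' : mu.-integrable C (EFin \o (fun y => g (p y) * c1)).
  by apply: (@integrable_cyl (fun=> c1) `|c1|) => //; exact: measurable_cst.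
apply/weak_partial_zero => // psi tp.
have sp : smooth psi by case: tp.
have tp' := test_function_partial ord_max tp.
set h := fun y => _.
have ih : mu.-integrable C (EFin \o h).
  by apply: integrableD_EFin => //; [exact: integrable_test ig' tp'|exact: integrable_test idg' tp].
apply: EFin_inj; rewrite (EFin_Rintegral_cyl ih).1.
apply: integral0_eq => x _.
have [xA|xA] := boolP (x \in A); last first.
  by apply: integral0_eq => t _; rewrite cyl_patchE patchE (negbTE xA).
pose th t := g x * (tau t * psi (append x t)).
pose dth t := g x * (tau t * partial ord_max psi (append x t) + c1 * psi (append x t)).
have Dth (t : R) : is_derive t 1 th (dth t).
  have Dp := is_derive_append x t sp.
  have Dt : is_derive t 1 tau c1.
    have D : is_derive t 1 (fun t : R => c0 + c1 *: t) (0 + c1 *: 1).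
      exact: is_deriveD.
    by rewrite add0r /GRing.scale/= mulr1 in D.
  have D : is_derive t 1 th (g x *: (tau t *: partial ord_max psi (append x t) + psi (append x t) *: c1)).
    exact: (is_deriveZ (g x) (is_deriveM Dt Dp)).
  by move: D; rewrite /dth /GRing.scale/= [c1 * _]mulrC.
rewrite (@eq_integral _ _ _ lebesgue_measure setT ((EFin \o dth) \_ `]a, b[%classic)); last first.
  move=> t _; rewrite cyl_patchE [LHS]patchE xA !patchE; case: ifPn => // tab.
  by rewrite /h/= /dth col'_append append_last; congr EFin; rewrite /tau; ring.
have cth : continuous th.
  move=> t; apply/differentiable_continuous/derivable1_diffP.
  exact: (@ex_derive _ _ _ _ _ _ _ (Dth t)).
have cdth : continuous dth.
  move=> t; apply: cvgM; first exact: cvg_cst.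
  apply: cvgD; apply: cvgM; last 2 first.
  - exact: cvg_cst.
  - exact: continuous_append_r.
  - apply: cvgD; first exact: cvg_cst.
    by apply: cvgM; [exact: cvg_cst|exact: cvg_id].
  - apply: continuous_append_r; exact: smooth_partial.
(* [psi] vanishes off the open cylinder, in particular at the heights [a] and [b]. *)
have th0 t : ~~ (a < t < b) -> th t = 0.
  move=> tab; rewrite /th (test_function_supp0 tp) ?mulr0// => /cyl_append[_].
  by rewrite (negbTE tab).
rewrite -integral_mkcond -(integral_itv_bndoo true false); last first.
  by apply/measurable_EFinP; apply: measurable_funTS; exact: continuous_measurable_fun.
rewrite (@continuous_FTC2 R dth th a b ab).
- by rewrite !th0 ?ltxx ?andbF// -EFinB subrr.
- exact: continuous_subspaceT.
- split.
  + by move=> t _; exact: (@ex_derive _ _ _ _ _ _ _ (Dth t)).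
  + by apply: cvg_at_right_filter; exact: cth.
  + by apply: cvg_at_left_filter; exact: cth.
- by move=> t _; rewrite derive1E (@derive_val _ _ _ _ _ _ _ (Dth t)).
Qed.

End cylinder_partials.

(** * Uniqueness of weak gradients and determinants *)

Section uniqueness.
Context {R : realType} (m : nat).
Local Notation mu := (@lebesgue_rV R m).
Implicit Types (D : set 'rV[R]_m) (g dg : 'rV[R]_m -> R).

Lemma integral_test_supp D E g psi : measurable D -> measurable E -> E `<=` D ->
  test_function E psi ->
  \int[mu]_(x in D) (g x * psi x) = \int[mu]_(x in E) (g x * psi x).
Proof.
move=> mD mE ED tp; rewrite Rintegral_mkcond [RHS]Rintegral_mkcond.
apply: eq_Rintegral => x _; rewrite !patchE.
case: (boolP (x \in E)) => [/set_mem Ex|nE]; first by rewrite mem_set//; exact: ED.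
case: ifPn => // _; rewrite (test_function_supp0 tp) ?mulr0// => Ex.
by move/negP : nE; apply; exact: mem_set.
Qed.

(** Weak derivatives are only locally integrable, so the comparison runs over countably many open
    cubes with closure in [D]. On each, the difference integrates to 0 against every test function,
    and [test_density] makes its L^1 norm arbitrarily small. *)
Lemma weak_partial_unique D i g dg dg' : open D ->
  weak_partial D i g dg -> weak_partial D i g dg' ->
  {ae mu, forall x, D x -> dg x = dg' x}.
Proof.
move=> oD [_ [_ Ld] h] [_ [_ Ld'] h'].
have mD := measurable_open_rV oD.
have [c [r [cD cov]]] := open_cubes oD.
have oB k : open (ball (c k) (r k)) by exact: ball_open.
have Bc k : ball (c k) (r k) `<=` cube (c k) (r k).
  by move=> x /ball_rV[_ hx] j; rewrite distrC ltW.
have one k : {ae mu, forall x, ball (c k) (r k) x -> dg x = dg' x}.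
  have [rk|rk] := ltP 0 (r k); last first.
    by apply: aeW => x /ball_rV[]; rewrite ltNge rk.
  pose B : set 'rV[R]_m := ball (c k) (r k).
  have mB : measurable B by apply: measurable_open_rV; exact: oB.
  have BD : B `<=` D by move=> x /Bc /(cD k rk).
  have mcube : measurable (cube (c k) (r k)).
    rewrite -(setCK (cube _ _)); apply: measurableC; apply: measurable_open_rV.
    by apply: closed_openC; apply: compact_closed; [exact: hausdorff_rV|exact: compact_cube].
  have icB f : (forall K, compact K -> K `<=` D -> mu.-integrable K (EFin \o f)) ->
      mu.-integrable B (EFin \o f).
    move=> Lf; apply: (integrableS mcube mB (Bc k)).
    by apply: Lf; [exact: compact_cube|exact: cD].
  have id := icB _ Ld; have id' := icB _ Ld'.
  have iB : mu.-integrable B (EFin \o (fun x => dg x - dg' x)) by exact: integrableB_EFin.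
  have small (e : R) : 0 < e -> \int[mu]_(x in B) `|dg x - dg' x| <= e.
    move=> e0; have [psi [tp _ _]] := test_density (oB k) iB e0.
    have -> : \int[mu]_(x in B) ((dg x - dg' x) * psi x) = 0; last by rewrite add0r.
    transitivity (\int[mu]_(x in B) (dg x * psi x - dg' x * psi x)).
      by apply: eq_Rintegral => x _; rewrite mulrBl.
    rewrite RintegralB//; [|exact: integrable_test id tp|exact: integrable_test id' tp].
    rewrite -!(integral_test_supp _ mD mB BD tp).
    have tD := test_functionS BD tp.
    by apply/eqP; rewrite subr_eq0; apply/eqP/oppr_inj; rewrite -h// -h'.
  have I0 : (\int[mu]_(x in B) `|(dg x - dg' x)%:E| = 0)%E.
    have E : (\int[mu]_(x in B) (`|dg x - dg' x|)%:E = (\int[mu]_(x in B) `|dg x - dg' x|)%:E)%E.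
      by rewrite /Rintegral fineK//; apply: integrable_fin_num => //; exact: integrable_norm.
    rewrite [LHS]E; congr EFin; apply/eqP; rewrite eq_le Rintegral_ge0// andbT.
    by apply/ler_addgt0Pr => e e0; rewrite add0r; exact: small.
  have mdd : measurable_fun B (EFin \o (fun x => dg x - dg' x)) by case/integrableP : iB.
  have := (ae_eq_integral_abs mu mB mdd).1 I0.
  apply: filterS => x hx Bx; move: (hx Bx) => /= -[] /eqP.
  by rewrite subr_eq0 => /eqP.
have := ae_foralln one; apply: filterS => x hx Dx.
have [k rk xk] := cov x Dx; apply: (hx k); apply/ball_rV; split => // j.
by rewrite distrC.
Qed.

End uniqueness.

(** * Integrability of determinants *)

Section determinant.
Context {R : realType} (m : nat).
Local Notation mu := (@lebesgue_rV R m).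

(** The product is at most the k-th power of the largest factor, which is one of the summands; this
    takes the place of the generalized Holder inequality. *)
Lemma prod_le_sum_exp k (a : 'I_k -> R) : (0 < k)%N -> (forall i, 0 <= a i) ->
  \prod_i a i <= \sum_i a i ^+ k.
Proof.
case: k a => // k a _ a0.
pose i0 := [arg max_(i > ord0) a i]%O.
have ai0 i : a i <= a i0 by rewrite /i0; case: Order.TotalTheory.arg_maxP => // j _; exact.
apply: (@le_trans _ _ (a i0 ^+ k.+1)).
  rewrite (_ : a i0 ^+ k.+1 = \prod_(i < k.+1) a i0); last by rewrite prodr_const card_ord.
  by apply: ler_prod => i _; rewrite a0 ai0.
by rewrite (bigD1 i0)//= lerDl; apply: sumr_ge0 => i _; exact: exprn_ge0.
Qed.

Lemma lift_ord_max k (i : 'I_k) : lift ord_max i = widen_ord (leqnSn k) i.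
Proof. by apply/val_inj; rewrite /= /bump leqNgt ltn_ord. Qed.

Lemma measurable_det k (D : set 'rV[R]_m) (a : 'rV[R]_m -> 'M[R]_k) :
  (forall i j, measurable_fun D (fun x => a x i j)) ->
  measurable_fun D (fun x => \det (a x)).
Proof.
move=> ma; apply: measurable_sum => s; apply: measurable_funM; first exact: measurable_cst.
by apply: measurable_prod => i _; exact: ma.
Qed.

Lemma integrable_det k (D : set 'rV[R]_m) (a : 'rV[R]_m -> 'M[R]_k.+1) :
  (0 < k)%N -> measurable D -> (forall i j, measurable_fun D (fun x => a x i j)) ->
  (forall i j, mu.-integrable D (EFin \o (fun x => `|a x (lift ord_max i) j| ^+ k))) ->
  (forall x j, D x -> `|a x ord_max j| <= 1) ->
  mu.-integrable D (fun x => (\det (a x))%:E).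
Proof.
move=> k0 mD ma ia a1.
pose g x := \sum_(s : {perm 'I_k.+1}) \sum_i `|a x (lift ord_max i) (s (lift ord_max i))| ^+ k.
apply: (@le_integrable _ _ _ _ _ mD _ (EFin \o g)).
- by apply/measurable_EFinP; exact: measurable_det.
- move=> x Dx /=; rewrite lee_fin; apply: le_trans (ler_norm _).
  rewrite (le_trans (ler_norm_sum _ _ _))//; apply: ler_sum => s _.
  rewrite normrM normrX normrN1 expr1n mul1r normr_prod big_ord_recr/=.
  rewrite (le_trans (ler_piMr _ (a1 x _ Dx)))//; first exact: prodr_ge0.
  under eq_bigr do rewrite -lift_ord_max.
  exact: prod_le_sum_exp.
- apply: integrable_sum_EFin => // s; exact: integrable_sum_EFin.
Qed.

End determinant.

(** * Small oscillation of Sobolev functions on cylinders *)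

Section small_oscillation.
Context {R : realType}.
Local Notation mu := (@lebesgue_rV R _).

(** Truncation at level [n.+1] leaves a remainder of integral at most e / 2, while the truncated
    part contributes at most [n.+1] times the measure of [A]. *)
Lemma integral_abs_continuity m (D : set 'rV[R]_m) (v : 'rV[R]_m -> R) (e : R) :
  measurable D -> mu.-integrable D (EFin \o v) -> 0 < e ->
  exists2 dl, 0 < dl & forall A, measurable A -> A `<=` D -> (mu A <= dl%:E)%E ->
    (\int[mu]_(y in A) (`|v y|)%:E <= e%:E)%E.
Proof.
move=> mD iv e0; have e20 : 0 < e / 2 by rewrite divr_gt0.
have mv : measurable_fun D v by case/integrableP : iv => /measurable_EFinP.
have [n hn] := trunc_approx mD iv e20.
exists (e / 2 / n.+1%:R) => [|A mA AD muA]; first by rewrite divr_gt0.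
have mvA : measurable_fun A v by exact: measurable_funS mv.
have md : measurable_fun D (fun y => `|v y - trunc n.+1%:R (v y)|).
  apply: measurableT_comp; first exact: normr_measurable.
  by apply: measurable_funB => //; apply: measurable_maxr => //; exact: measurable_minr.
have mdA : measurable_fun A (fun y => `|v y - trunc n.+1%:R (v y)|) by exact: measurable_funS md.
apply: (@le_trans _ _ (\int[mu]_(y in A) (`|v y - trunc n.+1%:R (v y)| + n.+1%:R)%:E)%E).
  apply: ge0_le_integral_rV => //.
  - exact: measurableT_comp.
  - by apply: measurable_funD => //; exact: measurable_cst.
  move=> y _; rewrite -{1}(subrK (trunc n.+1%:R (v y)) (v y)) (le_trans (ler_normD _ _))//.
  by rewrite lerD2l trunc_le.
under eq_integral do rewrite EFinD.
rewrite ge0_integralD//; first last.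
- exact/measurable_EFinP.
rewrite integral_cst// [e]splitr EFinD; apply: leeD.
  apply: le_trans hn; apply: ge0_subset_integral => //; exact/measurable_EFinP.
apply: (@le_trans _ _ (n.+1%:R%:E * (e / 2 / n.+1%:R)%:E)%E).
  by apply: lee_wpmul2l.
by rewrite -EFinM lee_fin mulrC divfK.
Qed.

(** If w exceeds d / r, then r w / d is at least 1, and multiplying w by its n-th power only
    increases it. This pointwise bound stands in for the Holder inequality. *)
Lemma le_scaled_power (d r w : R) n : 0 < d -> 0 < r -> 0 <= w ->
  w <= d / r + (r / d) ^+ n * w ^+ n.+1.
Proof.
move=> d0 r0 w0; have dr : 0 < d / r by rewrite divr_gt0.
have [h|h] := leP w (d / r).
  by rewrite (le_trans h)// lerDl mulr_ge0// exprn_ge0// divr_ge0// ltW.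
apply: (@le_trans _ _ ((r / d) ^+ n * w ^+ n.+1)); last by rewrite lerDr ltW.
rewrite exprSr mulrA -exprMn ler_peMl// exprn_ege1//.
by rewrite mulrAC ler_pdivlMr// mul1r -ler_pdivrMl// mulrC ltW.
Qed.

Lemma small_ball_integral n (O : set 'rV[R]_n.+1) (w : 'rV[R]_n.+1 -> R) (e : R) :
  open O -> (forall x, 0 <= w x) -> measurable_fun O w ->
  mu.-integrable O (EFin \o (fun x => w x ^+ n.+1)) -> 0 < e ->
  exists2 r0, 0 < r0 & forall x r, 0 < r < r0 -> eball x r `<=` O ->
    (\int[mu]_(y in eball x r) (w y)%:E <= (e * r ^+ n)%:E)%E.
Proof.
move=> oO w0 mw iw e0; have mO := measurable_open_rV oO.
have b0 : 0 < bvol n.+1 :> R by exact: bvol_gt0.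
(* With this value the constant term d / r integrates over the ball to exactly e / 2 * r^n. *)
pose d := e / 2 / bvol n.+1; have d0 : 0 < d by rewrite !divr_gt0.
(* The factor [d ^+ n] compensates the denominator of [(r / d) ^+ n]. *)
have e1 : 0 < d ^+ n * (e / 2) by rewrite mulr_gt0 ?divr_gt0// exprn_gt0.
have [dl dl0 H] := integral_abs_continuity mO iw e1.
(* Radii below 1 satisfy r^(n+1) <= r, so a linear condition on r keeps the measure of the ball
   below [dl]. *)
exists (Num.min 1 (dl / bvol n.+1)) => [|x r /andP[r0]]; first by rewrite lt_min ltr01 divr_gt0.
rewrite lt_min => /andP[r1 rdl BO]; set B := eball x r.
have mB : measurable B by exact: measurable_eball.
have mwB : measurable_fun B w by exact: measurable_funS mw.
have muB : (mu B <= dl%:E)%E.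
  rewrite lebesgue_eball// lee_fin -ler_pdivlMr//; apply: le_trans (ltW rdl).
  by rewrite exprS ler_piMr ?(ltW r0)// exprn_ile1// ltW.
have rd0 : 0 <= (r / d) ^+ n by rewrite exprn_ge0// divr_ge0// ltW.
have mwn : measurable_fun B (fun y => w y ^+ n.+1) by exact: measurable_funX.
apply: (@le_trans _ _ (\int[mu]_(y in B) (d / r + (r / d) ^+ n * w y ^+ n.+1)%:E)%E).
  apply: ge0_le_integral_rV => //.
    by apply: measurable_funD; [exact: measurable_cst|exact: measurable_funM].
  by move=> y _; exact: le_scaled_power.
under eq_integral do rewrite EFinD.
rewrite ge0_integralD//; first last.
- by apply/measurable_EFinP; exact: measurable_funM.
- by move=> y _; rewrite lee_fin mulr_ge0// exprn_ge0.
- by move=> y _; rewrite lee_fin divr_ge0 ?(ltW d0)// ltW.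
rewrite integral_cst//.
under [in X in (_ + X)%E]eq_integral do rewrite EFinM.
rewrite ge0_integralZl_EFin//; first last.
- exact/measurable_EFinP.
- by move=> y _; rewrite lee_fin exprn_ge0.
rewrite (_ : e * r ^+ n = e / 2 * r ^+ n + e / 2 * r ^+ n); last by field.
rewrite EFinD; apply: leeD.
  rewrite /B lebesgue_eball// -EFinM lee_fin le_eqVlt; apply/orP; left; apply/eqP.
  by rewrite /d exprS; field; rewrite !gt_eqF.
apply: (@le_trans _ _ (((r / d) ^+ n)%:E * (d ^+ n * (e / 2))%:E)%E); last first.
  rewrite -EFinM lee_fin expr_div_n le_eqVlt; apply/orP; left; apply/eqP.
  by field; rewrite expf_neq0// gt_eqF.
apply: lee_wpmul2l; first by rewrite lee_fin.
apply: le_trans (H B mB BO muB); rewrite le_eqVlt; apply/orP; left; apply/eqP.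
by apply: eq_integral => y _; rewrite ger0_norm// exprn_ge0.
Qed.

Lemma enorm_append0 n (z : 'rV[R]_n) : enorm (append z 0) = enorm z.
Proof.
rewrite /enorm /dotv big_ord_recr/= append_last mulr0 addr0; congr Num.sqrt.
by apply: eq_bigr => i _; rewrite -lift_ord_max mxE liftK.
Qed.

Lemma enorm_col' n (v : 'rV[R]_n.+1) : enorm (col' ord_max v) <= enorm v.
Proof.
rewrite ler_wsqrtr// /dotv [leRHS]big_ord_recr/= -[leLHS]addr0 lerD ?sqr_ge0//.
  by apply: ler_sum => i _; rewrite !mxE lift_ord_max.
Qed.

Lemma eball_cyl n (x : 'rV[R]_n.+1) r :
  eball x r `<=` cyl (eball (col' ord_max x) r) (x 0 ord_max - r) (x 0 ord_max + r).
Proof.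
move=> y; rewrite /eball/= => xy; split.
  apply: le_lt_trans xy; apply: le_trans (enorm_col' _).
  by rewrite le_eqVlt; apply/orP; left; apply/eqP; congr enorm; apply/rowP => i; rewrite !mxE.
by have := le_lt_trans (coord_le_enorm (y - x) ord_max) xy; rewrite !mxE ltr_distl.
Qed.

Lemma eball_col'_sub n (O : set 'rV[R]_n) a b x r : eball x r `<=` cyl O a b ->
  eball (col' ord_max x) r `<=` O.
Proof.
move=> BU z; rewrite /eball/= => zx.
have /BU/cyl_append[] // : eball x r (append z (x 0 ord_max)).
rewrite /eball/= -{2}(append_col' x).
suff -> : append z (x 0 ord_max) - append (col' ord_max x) (x 0 ord_max) =
  append (z - col' ord_max x) 0 by rewrite enorm_append0.
by apply/rowP => i; rewrite !mxE; case: unliftP => [j _|_] /=; rewrite ?mxE ?subrr.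
Qed.

Lemma small_osc_cyl n (O : set 'rV[R]_n.+1) a b (h : 'rV[R]_n.+2 -> R)
    (dh : 'I_n.+2 -> 'rV[R]_n.+2 -> R) (w : 'rV[R]_n.+1 -> R) :
  open O -> mu.-integrable (cyl O a b) (EFin \o h) ->
  (forall i, mu.-integrable (cyl O a b) (EFin \o dh i)) ->
  (forall i, weak_partial (cyl O a b) i h (dh i)) ->
  (forall x, 0 <= w x) -> measurable_fun O w ->
  mu.-integrable O (EFin \o (fun x => w x ^+ n.+1)) ->
  (forall i y, cyl O a b y -> `|dh i y| <= w (col' ord_max y)) ->
  forall e, 0 < e -> exists2 r0, 0 < r0 & forall x r, 0 < r < r0 ->
    eball x r `<=` cyl O a b -> osc_le h x r e.
Proof.
move=> oO ih idh hdh w0 mw iw dhw e e0.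
have oU : open (cyl O a b) by exact: open_cyl.
have mO := measurable_open_rV oO; have mU := measurable_open_rV oU.
have b0 : 0 < bvol n.+2 :> R by exact: bvol_gt0.
(* The factors [2 ^+ n.+2 * 2] come from [poincare], [n.+2] is the number of partial derivatives,
   and the last 2 belongs to the height 2 r of the cylinder around the ball. *)
pose k : R := 2 ^+ n.+2 * 2 * n.+2%:R * 2.
have k0 : 0 < k by apply: mulr_gt0 => //; apply: mulr_gt0 => //; apply: mulr_gt0 => //; exact: exprn_gt0.
(* The additional 2 in the denominator yields the strict inequality in the hypothesis of
   [poincare]. *)
pose e' := e * bvol n.+2 / (k * 2); have ebk : 0 < e * bvol n.+2 by apply: mulr_gt0.
have e'0 : 0 < e' by apply: divr_gt0 => //; apply: mulr_gt0.
have [r0 r00 H] := small_ball_integral oO w0 mw iw e'0.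
exists r0 => // x r rr BU; have /andP[rp _] := rr.
set B := eball x r; set p := col' ord_max x.
have mB : measurable B by exact: measurable_eball.
have pO := eball_col'_sub BU.
have one i : (\int[mu]_(y in B) (`|dh i y|)%:E <= (2 * r * (e' * r ^+ n))%:E)%E.
  pose W := cyl (eball p r) (x 0 ord_max - r) (x 0 ord_max + r).
  have mW : measurable W by apply: measurable_cyl; exact: measurable_eball.
  have mwp : measurable_fun (eball p r) (EFin \o w).
    by apply/measurable_EFinP; exact: measurable_funS mw.
  have mwW : measurable_fun W (fun y => (w (col' ord_max y))%:E).
    by apply: (measurable_fun_cyl _ mwp); exact: measurable_eball.
  apply: (@le_trans _ _ (\int[mu]_(y in W) (w (col' ord_max y))%:E)%E).
    apply: (@le_trans _ _ (\int[mu]_(y in B) (w (col' ord_max y))%:E)%E).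
      apply: ge0_le_integral_rV => //.
      - apply: measurableT_comp; first exact: normr_measurable.
        by case/integrableP : (idh i) => /measurable_EFinP + _; apply: measurable_funS.
      - by apply/measurable_EFinP; exact: measurable_funS (@eball_cyl _ x r) mwW.
      - by move=> y /BU; exact: dhw.
    by apply: ge0_subset_integral => //; [move=> y _; rewrite lee_fin|exact: eball_cyl].
  rewrite (ge0_integral_cyl _ _ mwp)//; first last.
  - exact: measurable_eball.
  - by rewrite ltrD2l; lra.
  rewrite (_ : x 0 ord_max + r - (x 0 ord_max - r) = 2 * r); last by ring.
  rewrite [in leRHS]EFinM; apply: lee_wpmul2l; last exact: H.
  by rewrite lee_fin mulr_ge0// ltW.
have one' i : \int[mu]_(y in B) `|dh i y| <= 2 * r * (e' * r ^+ n).
  rewrite -lee_fin /Rintegral fineK//; apply: integrable_fin_num => //.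
  by apply: integrable_norm; exact: integrableS (idh i).
apply: (poincare oU ih idh hdh rp BU).
have S : \sum_i \int[mu]_(y in B) `|dh i y| <= n.+2%:R * (2 * r * (e' * r ^+ n)).
  rewrite (le_trans (ler_sum _ (fun i _ => one' i)))//.
  by rewrite sumr_const card_ord -[leLHS]mulr_natl.
apply: (@le_lt_trans _ _ (2 ^+ n.+2 * (2 * r) * (n.+2%:R * (2 * r * (e' * r ^+ n))))).
  by rewrite ler_wpM2l// mulr_ge0 ?exprn_ge0// mulr_ge0// ltW.
have -> : 2 ^+ n.+2 * (2 * r) * (n.+2%:R * (2 * r * (e' * r ^+ n))) = k * e' * r ^+ n.+2.
  by rewrite /k !exprS; ring.
have -> : e * evol n.+2 r = e * bvol n.+2 * r ^+ n.+2 by rewrite /evol mulrCA mulrC.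
rewrite ltr_pM2r; last exact: exprn_gt0.
have -> : k * e' = e * bvol n.+2 / 2 by rewrite /e'; field; rewrite gt_eqF.
move: ebk.
lra.
Qed.

End small_oscillation.

(** * Mean oscillation *)

Section euclidean.
Context {R : realType} (m : nat).
Local Notation mu := (@lebesgue_rV R m).
Implicit Types (U : set 'rV[R]_m) (x y : 'rV[R]_m).

(** If some [y] in the ball were outside [U], the infimum [s0] of the parameters at which the
    segment from [x] to [y] is outside [U] would give a boundary point at distance less than [r]
    from [x]. *)
Lemma eball_sub_boundary U x r : open U -> U x ->
  (r%:E < eucl_dist x (boundary U))%E -> eball x r `<=` U.
Proof.
move=> oU Ux rd y xy; apply: contrapT => Uy.
pose v := y - x; pose p (s : R) := x + s *: v.
pose S := [set s : R | 0 <= s /\ ~ U (p s)].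
have S1 : S 1 by split; rewrite ?ler01// /p scale1r addrC subrK.
have iS : has_inf S by split; [exists 1|exists 0 => s []].
pose s0 := inf S.
have s00 : 0 <= s0 by apply: lb_le_inf; [exists 1|move=> s []].
have s01 : s0 <= 1 by apply: ge_inf => //; exists 0 => s [].
(* Step sizes are divided by 1 + |v|, which is positive without knowing that [v] is nonzero. *)
have v1 : 0 < 1 + enorm v by rewrite ltr_pwDl// enorm_ge0.
have dp s t : enorm (p s - p t) = `|s - t| * enorm v.
  by rewrite -enormZ; congr enorm; rewrite /p scalerBl; apply/rowP => i; rewrite !mxE; ring.
have step d s : 0 < d -> `|s - s0| <= d / (1 + enorm v) -> eball (p s0) d (p s).
  move=> d0 h; rewrite /eball/= dp.
  apply: (@le_lt_trans _ _ (d / (1 + enorm v) * enorm v)); first by rewrite ler_wpM2r// enorm_ge0.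
  by rewrite mulrAC ltr_pdivrMr// ltr_pM2l// ltrDr.
have nUz : ~ U (p s0).
  move=> Uz; have [d d0 dU] := (open_eballP U).1 oU _ Uz.
  have e0 : 0 < d / (1 + enorm v) by rewrite divr_gt0.
  have [s Ss hs] := inf_adherent e0 iS.
  have ss : s0 <= s by apply: ge_inf => //; exists 0 => t [].
  apply: Ss.2; apply: dU; apply: step => //.
  by rewrite ger0_norm ?subr_ge0// lerBlDr addrC ltW.
have s0p : 0 < s0.
  rewrite lt_neqAle s00 andbT; apply/eqP => E; apply: nUz.
  by rewrite -E /p scale0r addr0.
have cUz : closure U (p s0).
  move=> B /nbhs_interior; rewrite nbhsE => -[B' [oB' B'z] B'B].
  have [d d0 dB] := (open_eballP B').1 oB' _ B'z.
  (* A parameter just below [s0] is still in [U]; the maximum with 0 keeps it on the segment. *)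
  pose s := Num.max 0 (s0 - d / (1 + enorm v)).
  have e0 : 0 < d / (1 + enorm v) by rewrite divr_gt0.
  have s_ge0 : 0 <= s by rewrite le_max lexx.
  have ss0 : s < s0 by rewrite gt_max s0p ltrBlDr ltrDl.
  exists (p s); split.
    apply: contrapT => nU; have : s0 <= s by apply: ge_inf => //; exists 0 => t [].
    by rewrite leNgt ss0.
  apply: interior_subset; apply: B'B; apply: dB; apply: step => //.
  rewrite distrC ger0_norm ?subr_ge0 ?(ltW ss0)// lerBlDr -lerBlDl.
  by rewrite le_max lexx orbT.
have bz : boundary U (p s0) by split => // /interior_subset.
have : (eucl_dist x (boundary U) <= (enorm (x - p s0))%:E)%E.
  by apply: ereal_inf_lbound; exists (p s0).
apply/negP; rewrite -ltNge; apply: le_lt_trans rd; rewrite lee_fin.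
have -> : x - p s0 = - (s0 *: v) by rewrite /p opprD addrA subrr add0r.
by rewrite enormN enormZ ger0_norm// ltW// (le_lt_trans _ xy)// ler_piMl// enorm_ge0.
Qed.

Lemma bounded_coord U : bounded_set U ->
  exists2 M, 0 < M & forall x, U x -> forall i, `|x 0 i| <= M.
Proof.
move=> -[M [_ hM]]; exists (`|M| + 1) => [|x Ux i]; first by rewrite ltr_pwDr.
have M1 : M < `|M| + 1 by rewrite ltr_pwDr// ler_norm.
have := hM _ M1 x Ux => /= xM.
apply/ler_addgt0Pr => e e0.
have : ball 0 (`|M| + 1 + e) x.
  by rewrite -ball_normE /ball_/= sub0r normrN (le_lt_trans xM)// ltrDl.
by move=> /ball_rV[_ /(_ i)]; rewrite mxE sub0r normrN => /ltW.
Qed.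

Lemma coord_bounded_lty U M : measurable U -> 0 <= M ->
  (forall x, U x -> forall i, `|x 0 i| <= M) -> (mu U < +oo)%E.
Proof.
move=> mU M0 UM; pose c : 'rV[R]_m := const_mx M.
apply: (@le_lt_trans _ _ (mu [set x | forall i, (- c) 0 i <= x 0 i <= c 0 i])).
  apply: le_measure; rewrite ?inE//; first exact: measurable_box.
  by move=> x Ux i; rewrite !mxE -ler_norml; exact: UM.
by rewrite lebesgue_rV_box ?ltry// => i; rewrite !mxE; lra.
Qed.

End euclidean.

(** * From scalar oscillation bounds to BMO and VMO *)

Section mean_oscillations.
Context {R : realType} (m k : nat).
Local Notation mu := (@lebesgue_rV R m).
Implicit Types (U : set 'rV[R]_m) (h : 'rV[R]_m -> 'rV[R]_k).

(** The average itself is within [e] of the reference constant [c], whence the factor 2. *)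
Lemma average_dist (f : 'rV[R]_m -> R) x r e : 0 < r ->
  mu.-integrable (eball x r) (EFin \o f) -> osc_le f x r e ->
  (\int[mu]_(y in eball x r) (`|f y - (evol m r)^-1 * \int[mu]_(y in eball x r) f y|)%:E <=
   (2 * e * evol m r)%:E)%E.
Proof.
move=> r0 iF [c hc]; set B := eball x r; set a := _ * _.
have mB : measurable B by exact: measurable_eball.
have muB : mu B = (evol m r)%:E by exact: mu_eball.
have v0 : 0 < evol m r := evol_gt0 m r0.
have mf : measurable_fun B f by case/integrableP : iF => /measurable_EFinP.
have icst (d : R) : mu.-integrable B (EFin \o (fun=> d)).
  by apply: (@integrable_bounded_rV _ _ _ _ `|d|) => //; rewrite muB ltry.
have mabs d : measurable_fun B (fun y => `|f y - d|).
  by apply: measurableT_comp; [exact: normr_measurable|apply: measurable_funB => //; exact: measurable_cst].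
have iabs : mu.-integrable B (EFin \o (fun y => `|f y - c|)).
  by apply: integrable_norm; exact: integrableB_EFin.
have ac : `|c - a| <= e.
  have -> : c - a = - ((evol m r)^-1 * \int[mu]_(y in B) (f y - c)).
    rewrite RintegralB// Rintegral_cst// muB/= /a; field.
    by rewrite gt_eqF.
  rewrite normrN normrM gtr0_norm ?invr_gt0// ler_pdivrMl// mulrC.
  apply: (le_trans (le_normr_Rintegral mB _)); first exact: integrableB_EFin.
  rewrite -lee_fin /Rintegral fineK//; exact: integrable_fin_num.
apply: (@le_trans _ _ (\int[mu]_(y in B) (`|f y - c| + e)%:E)%E).
  apply: ge0_le_integral_rV => //.
    by apply: measurable_funD => //; exact: measurable_cst.
  by move=> y _; rewrite (le_trans (ler_distD c _ _))// lerD2l.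
have e0 : 0 <= e by exact: le_trans ac.
under eq_integral do rewrite EFinD.
rewrite ge0_integralD//; last exact/measurable_EFinP.
rewrite integral_cst// muB (le_trans (leeD hc (lexx _)))//.
by rewrite -EFinM -EFinD lee_fin le_eqVlt; apply/orP; left; apply/eqP; ring.
Qed.

Lemma mean_oscillation_le h x r e : 0 < r ->
  (forall j, mu.-integrable (eball x r) (EFin \o (fun y => h y 0 j))) ->
  (forall j, osc_le (fun y => h y 0 j) x r e) ->
  (mean_oscillation h (eball x r) <= (k%:R * (2 * e))%:E)%E.
Proof.
move=> r0 ih osc; rewrite /mean_oscillation; set B := eball x r; set av := average h B.
have mB : measurable B by exact: measurable_eball.
have v0 : 0 < evol m r := evol_gt0 m r0.
have avE j : av 0 j = (evol m r)^-1 * \int[mu]_(y in B) h y 0 j.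
  by rewrite /av /average !mxE mu_eball.
have mh j : measurable_fun B (fun y => h y 0 j).
  by case/integrableP : (ih j) => /measurable_EFinP.
have mabs j : measurable_fun B (fun y => `|h y 0 j - av 0 j|).
  by apply: measurableT_comp; [exact: normr_measurable|apply: measurable_funB => //; exact: measurable_cst].
have H : (\int[mu]_(y in B) (enorm (h y - av))%:E <= (k%:R * (2 * e * evol m r))%:E)%E.
  apply: (@le_trans _ _ (\int[mu]_(y in B) (\sum_j `|h y 0 j - av 0 j|)%:E)%E).
    apply: ge0_le_integral_rV => //.
    - apply: (@measurableT_comp _ _ _ _ _ _ (@Num.sqrt R)).
        by apply: continuous_measurable_fun => y; exact: sqrt_continuous.
      apply: measurable_sum => j; apply: measurable_funM; under eq_fun do rewrite !mxE;
        by apply: measurable_funB => //; exact: measurable_cst.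
    - by apply: measurable_sum.
    - by move=> y _; exact: enorm_ge0.
    - move=> y _; rewrite (le_trans (enorm_le_sum _))//; apply: ler_sum => j _.
      by rewrite !mxE.
  under eq_integral do rewrite -sumEFin.
  rewrite ge0_integral_sum//; last by move=> j; exact/measurable_EFinP.
  apply: (@le_trans _ _ (\sum_(j < k) (2 * e * evol m r)%:E)%E).
    apply: lee_sum => j _; rewrite avE; exact: average_dist.
  by rewrite sumEFin sumr_const card_ord -[X in (X%:E <= _)%E]mulr_natl.
rewrite mu_eball// inver gt_eqF//.
apply: (@le_trans _ _ ((evol m r)^-1%:E * (k%:R * (2 * e * evol m r))%:E)%E).
  by move: H; apply: lee_wpmul2l; rewrite lee_fin invr_ge0 ltW.
by rewrite -EFinM lee_fin le_eqVlt; apply/orP; left; apply/eqP; field; rewrite gt_eqF.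
Qed.

Lemma bmo_seminorm_le U h e : open U ->
  (forall j, mu.-integrable U (EFin \o (fun y => h y 0 j))) ->
  (forall j x r, 0 < r -> eball x r `<=` U -> osc_le (fun y => h y 0 j) x r e) ->
  (bmo_seminorm U h <= (k%:R * (2 * e))%:E)%E.
Proof.
move=> oU ih osc; apply: ge_ereal_sup => _ [x [r [Ux r0 rd ->]]].
have BU := eball_sub_boundary oU Ux rd.
have mU := measurable_open_rV oU.
apply: mean_oscillation_le => // j; last exact: osc.
by apply: integrableS (ih j) => //; exact: measurable_eball.
Qed.

(** The components are approximated separately. Finiteness of the seminorm also comes from an
    approximation, with error 1: adding back the bounded [g] raises the oscillation by at most its
    bound [M]. *)
Lemma vmo_small_osc U z0 h : open U -> ~ U z0 -> (mu U < +oo)%E ->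
  (forall j, mu.-integrable U (EFin \o (fun y => h y 0 j))) ->
  (forall j e, 0 < e -> exists2 r0, 0 < r0 & forall x r, 0 < r < r0 ->
    eball x r `<=` U -> osc_le (fun y => h y 0 j) x r e) ->
  VMO U h.
Proof.
move=> oU Uz0 Ufin ih small; have mU := measurable_open_rV oU.
have approx e : 0 < e -> exists (g : 'rV[R]_m -> 'rV[R]_k) (M : R),
    [/\ forall j, continuous (fun x => g x 0 j), 0 <= M, forall x j, `|g x 0 j| <= M &
    forall j x r, 0 < r -> eball x r `<=` U -> osc_le (fun y => h y 0 j - g y 0 j) x r e].
  move=> e0.
  have one j : exists gM : ('rV[R]_m -> R) * R, [/\ continuous gM.1, forall x, `|gM.1 x| <= gM.2 &
      forall x r, 0 < r -> eball x r `<=` U -> osc_le (fun y => h y 0 j - gM.1 y) x r e].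
    (* Extension by zero is measurable on the whole space and unchanged on the balls of [U]. *)
    pose H := (fun y => h y 0 j) \_ U.
    have HE x r : eball x r `<=` U -> forall y, eball x r y -> H y = h y 0 j.
      by move=> BU y /BU Uy; rewrite /H patchE mem_set.
    have mH : measurable_fun [set: 'rV[R]_m] H.
      by apply/(measurable_restrictT _ mU); case/integrableP : (ih j) => /measurable_EFinP.
    have iH : mu.-integrable U (EFin \o H).
      by apply: eq_integrable (ih j) => // y yU /=; rewrite /H patchE yU.
    have [|g [M [cg gM og]]] := vmo_approx oU Uz0 Ufin mH iH _ e0.
      move=> e1 e10; have [r0 r00 hr0] := small j e1 e10; exists r0 => // x r rr BU.
      apply: osc_le_ext (hr0 x r rr BU) => y yB; by rewrite (HE _ _ BU).
    exists (g, M); split => // x r r0 BU; apply: osc_le_ext (og x r r0 BU) => y yB.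
    by rewrite (HE _ _ BU).
  have [gM hgM] := choice one.
  exists (fun x => \row_j (gM j).1 x), (\sum_j `|(gM j).2|); split.
  - move=> j; under eq_fun do rewrite mxE; by have [] := hgM j.
  - exact: sumr_ge0.
  - move=> x j; rewrite mxE; have [_ h1 _] := hgM j.
    rewrite (le_trans (h1 x))// (le_trans (ler_norm _))// (bigD1 j)//= lerDl.
    exact: sumr_ge0.
  - move=> j x r r0 BU; have [_ _ h1] := hgM j.
    by apply: osc_le_ext (h1 x r r0 BU) => y _; rewrite mxE.
have ig (g : 'rV[R]_m -> 'rV[R]_k) M j : continuous (fun x => g x 0 j) ->
    (forall x j, `|g x 0 j| <= M) -> mu.-integrable U (EFin \o (fun x => g x 0 j)).
  move=> cg gM; apply: (@integrable_bounded_rV _ _ _ _ M) => //.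
  by apply: measurable_funTS; exact: measurable_continuous_rV.
split.
  split=> [j|]; first exact: integrable_L1loc.
  have [g [M [cg M0 gM og]]] := approx 1 ltr01.
  apply: (@le_lt_trans _ _ (k%:R * (2 * (1 + M)))%:E); last by rewrite ltry.
  apply: bmo_seminorm_le => // j x r r0 BU.
  have [c hc] := og j x r r0 BU.
  have mB : measurable (eball x r) by exact: measurable_eball.
  have mh : measurable_fun (eball x r) (fun y => h y 0 j).
    by case/integrableP : (ih j) => /measurable_EFinP + _; apply: measurable_funS.
  have mg : measurable_fun (eball x r) (fun y => g y 0 j).
    by apply: measurable_funTS; exact: measurable_continuous_rV.
  exists c; apply: (@le_trans _ _ (\int[mu]_(y in eball x r) (`|h y 0 j - g y 0 j - c| + M)%:E)%E).
    apply: ge0_le_integral_rV => //.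
    - by apply: measurableT_comp; [exact: normr_measurable|apply: measurable_funB => //; exact: measurable_cst].
    - apply: measurable_funD; last exact: measurable_cst.
      apply: measurableT_comp; first exact: normr_measurable.
      by apply: measurable_funB; [exact: measurable_funB|exact: measurable_cst].
    move=> y _; have -> : h y 0 j - c = (h y 0 j - g y 0 j - c) + g y 0 j by ring.
    by rewrite (le_trans (ler_normD _ _))// lerD2l.
  under eq_integral do rewrite EFinD.
  rewrite ge0_integralD//; last first.
    apply/measurable_EFinP; apply: measurableT_comp; first exact: normr_measurable.
    by apply: measurable_funB; [exact: measurable_funB|exact: measurable_cst].
  rewrite integral_cst// mu_eball// (le_trans (leeD hc (lexx _)))//.
  by rewrite -EFinM -EFinD lee_fin mulrDl.
(* The components sum to at most 2 k e' <= e / 2, so the final inequality is strict; [k.+1] keeps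
   the divisor nonzero for [k = 0]. *)
move=> e e0; pose e' := e / (4 * k.+1%:R).
have e'0 : 0 < e' by rewrite divr_gt0// mulr_gt0.
have [g [M [cg M0 gM og]]] := approx e' e'0.
exists g.
  apply: continuous_subspaceT => x; apply/(@cvg_ballP _ _ _ _ (nbhs_filter x)) => d d0.
  have : \forall y \near nbhs x, forall j, `|g x 0 j - g y 0 j| < d.
    by apply: filter_forall => j; move: (cg j x) => /(@cvgrPdist_lt _ _ _ _ (nbhs_filter x)); apply.
  by apply: filterS => y hy; apply/ball_rV.
apply: (@le_lt_trans _ _ (k%:R * (2 * e'))%:E).
  apply: bmo_seminorm_le => // [j|j x r r0 BU].
    have := integrableB_EFin mU (ih j) (ig _ _ _ (cg j) gM).
    by apply: eq_integrable => // y _ /=; rewrite !mxE.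
  by apply: osc_le_ext (og j x r r0 BU) => y _; rewrite !mxE.
rewrite lte_fin; apply: (@le_lt_trans _ _ (k.+1%:R * (2 * e'))).
  by rewrite ler_wpM2r ?ler_nat// mulr_ge0// ltW.
have -> : k.+1%:R * (2 * e') = e / 2 by rewrite /e'; field.
by lra.
Qed.

End mean_oscillations.

(** * The normal extension *)

Section power_integrable.
Context {R : realType} (m : nat).
Local Notation mu := (@lebesgue_rV R m).
Implicit Types (D : set 'rV[R]_m) (f g : 'rV[R]_m -> R).

(** The condition [Lp] for a natural exponent, with integer powers in place of [powR]. *)
Definition pow_integrable D k g :=
  measurable_fun D g /\ mu.-integrable D (EFin \o (fun x => `|g x| ^+ k)).

Lemma LpP D k g : measurable D -> Lp D k%:R g <-> pow_integrable D k g.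
Proof.
move=> mD.
have E : (\int[mu]_(x in D) (`|g x| `^ k%:R)%:E = \int[mu]_(x in D) `|(`|g x| ^+ k)%:E|)%E.
  by apply: eq_integral => x _; rewrite powR_mulrn// gee0_abs// lee_fin exprn_ge0.
split=> -[mg]; rewrite ?E => h; split => //.
- apply/integrableP; split => //; apply/measurable_EFinP; apply: measurable_funX.
  exact: measurableT_comp.
- by rewrite E; case/integrableP : h.
Qed.

(** |g| <= 1 + |g|^k, and constants are integrable on a set of finite measure. *)
Lemma pow_integrable_integrable D k g : measurable D -> (mu D < +oo)%E -> (0 < k)%N ->
  pow_integrable D k g -> mu.-integrable D (EFin \o g).
Proof.
move=> mD fD k0 [mg ig].
have i1 : mu.-integrable D (EFin \o (fun=> 1)).
  by apply: (@integrable_bounded_rV _ _ _ _ 1) => // _; rewrite normr1.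
apply: (le_integrable mD _ _ (integrableD_EFin mD i1 ig)); first exact/measurable_EFinP.
move=> x _ /=; rewrite lee_fin; apply: le_trans (ler_norm _).
have [h|h] := leP `|g x| 1; first by rewrite (le_trans h)// lerDl exprn_ge0.
by rewrite (@le_trans _ _ (`|g x| ^+ k))// ?lerDr// ler_eXnr// ltW.
Qed.

Lemma pow_integrable_le D k f g : measurable D -> measurable_fun D g ->
  pow_integrable D k f -> (forall x, D x -> `|g x| <= `|f x|) -> pow_integrable D k g.
Proof.
move=> mD mg [mf i_f] gf; split => //; apply: (le_integrable mD _ _ i_f).
  by apply/measurable_EFinP; apply: measurable_funX; exact: measurableT_comp.
move=> x Dx /=; rewrite lee_fin !normrX !normr_id.
by rewrite lerXn2r ?nnegrE//; exact: gf.
Qed.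

Lemma pow_integrableD D k f g : measurable D -> pow_integrable D k f ->
  pow_integrable D k g -> pow_integrable D k (fun x => f x + g x).
Proof.
move=> mD [mf i_f] [mg ig]; have mfg : measurable_fun D (fun x => f x + g x).
  exact: measurable_funD.
split => //.
have I := integrableZl_EFin mD (2 ^+ k) (integrableD_EFin mD i_f ig).
apply: (le_integrable mD _ _ I).
  by apply/measurable_EFinP; apply: measurable_funX; exact: measurableT_comp.
move=> x Dx /=; rewrite lee_fin; apply: le_trans (ler_norm _).
rewrite ger0_norm ?exprn_ge0//.
(* By symmetry the larger of the two is |g|, so that |f + g|^k <= (2 |g|)^k. *)
wlog fg : f g {mf i_f mg ig mfg I} / `|f x| <= `|g x|.
  move=> H; have [h|h] := leP `|f x| `|g x|; first exact: H.
  by rewrite addrC [X in _ * X]addrC; apply: H; exact: ltW.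
apply: (@le_trans _ _ ((2 * `|g x|) ^+ k)).
  rewrite lerXn2r ?nnegrE ?mulr_ge0// (le_trans (ler_normD _ _))//.
  by rewrite mulrDl mul1r lerD2r.
by rewrite exprMn ler_wpM2l ?exprn_ge0// lerDr exprn_ge0.
Qed.

Lemma pow_integrable_norm D k g : measurable D -> pow_integrable D k g ->
  pow_integrable D k (fun x => `|g x|).
Proof.
move=> mD ig; apply: (pow_integrable_le mD _ ig) => [|x _]; last by rewrite normr_id.
by apply: measurableT_comp => //; case: ig.
Qed.

Lemma pow_integrable0 D k : measurable D -> (0 < k)%N -> pow_integrable D k (fun=> 0).
Proof.
move=> mD k0; split; first exact: measurable_cst.
rewrite (_ : _ \o _ = cst 0%E); first exact: integrable0.
by apply/funext => x /=; rewrite normr0 expr0n gtn_eqF.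
Qed.

Lemma pow_integrable_sum D k (I : finType) (F : I -> 'rV[R]_m -> R) : measurable D ->
  (0 < k)%N -> (forall i, pow_integrable D k (F i)) ->
  pow_integrable D k (fun x => \sum_i F i x).
Proof.
move=> mD k0 iF; elim: (index_enum I) => [|i s IH].
  by under eq_fun do rewrite big_nil; exact: pow_integrable0.
by under eq_fun do rewrite big_cons/=; exact: pow_integrableD.
Qed.

(** The measure lives on the Borel sets and is not completed, so almost everywhere equality does not
    transfer measurability; it has to be supplied for [f]. *)
Lemma integrable_ae_eq D f g : measurable D -> measurable_fun D f ->
  mu.-integrable D (EFin \o g) -> {ae mu, forall x, D x -> f x = g x} ->
  mu.-integrable D (EFin \o f).
Proof.
move=> mD mf /integrableP[mg ig] fg; apply/integrableP; split; first exact/measurable_EFinP.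
rewrite (@ge0_ae_eq_integral _ _ _ _ _ _ (fun x => `|(EFin \o g) x|%E))//.
- by apply: measurableT_comp => //; exact/measurable_EFinP.
- exact: measurableT_comp.
- by apply: filterS fg => x h Dx /=; rewrite h.
Qed.

End power_integrable.

(** * The normal extension on a cylinder *)

Section normal_extension_cylinder.
Context {R : realType} (n : nat).
Local Notation mu := (@lebesgue_rV R _).
Local Notation p := (col' ord_max).
Variables (O : set 'rV[R]_n.+1) (d : R).
Hypothesis oO : open O.
Hypothesis bO : bounded_set O.
Hypothesis d01 : 0 < d <= 1.
Local Notation U := (cyl O (- d) d).

Let mO : measurable O. Proof. exact: measurable_open_rV. Qed.
Let oU : open U. Proof. exact: open_cyl. Qed.
Let mU : measurable U. Proof. exact: measurable_cyl. Qed.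
Let dd : - d < d. Proof. by case/andP : d01 => ? _; rewrite gtrN. Qed.

Let t1 t : - d < t < d -> `|t| <= 1.
Proof. by move=> h; case/andP : d01 => _; apply: le_trans; rewrite ltW// ltr_norml. Qed.

Let m1 : measurable_fun [set: R] (fun=> 1 : R).
Proof. exact: measurable_cst. Qed.

Let b1 t : - d < t < d -> `|1 : R| <= 1.
Proof. by rewrite normr1. Qed.

Let Ofin : (mu O < +oo)%E.
Proof.
have [M M0 hM] := bounded_coord bO.
exact: (coord_bounded_lty mO (ltW M0) hM).
Qed.

Lemma cyl_coord : exists2 M, 0 < M & forall y, U y -> forall i, `|y 0 i| <= M.
Proof.
have [M M0 hM] := bounded_coord bO.
exists (M + 1) => [|y [yO yd] i]; first by rewrite addr_gt0.
case: (unliftP ord_max i) => [j ->|->]; last by rewrite (le_trans (t1 yd))// lerDr ltW.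
by have := hM _ yO j; rewrite mxE => h; rewrite (le_trans h)// lerDl.
Qed.

Let Ufin : (mu U < +oo)%E.
Proof.
have [M M0 hM] := cyl_coord.
exact: (coord_bounded_lty mU (ltW M0) hM).
Qed.

Lemma pow_integrable_cyl k (g : 'rV[R]_n.+1 -> R) : pow_integrable O k g ->
  pow_integrable U k (fun y => g (p y)).
Proof.
move=> [mg ig]; split.
  apply/measurable_EFinP; apply: (measurable_fun_cyl _ _ (w := EFin \o g)) => //.
  exact/measurable_EFinP.
have := integrable_cyl dd mO ig m1 b1.
by apply: eq_integrable => // y _ /=; rewrite mulr1.
Qed.

Lemma pow_integrable_cyl_mul k (g : 'rV[R]_n.+1 -> R) : pow_integrable O k g ->
  pow_integrable U k (fun y => g (p y) * y 0 ord_max).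
Proof.
move=> /pow_integrable_cyl ig; apply: (pow_integrable_le mU _ ig).
  apply: measurable_funM; first by case: ig.
  by apply: measurable_funTS; exact: measurable_coor.
by move=> y [_ yd]; rewrite normrM ler_piMr// t1.
Qed.

(** The cylinder over a null set is null, its measure being 2 d times 0. *)
Lemma ae_cyl (P : 'rV[R]_n.+1 -> Prop) : {ae mu, forall x, O x -> P x} ->
  {ae mu, forall y, U y -> P (p y)}.
Proof.
move=> [N [mN N0 hN]]; exists (cyl N (- d) d); split; first exact: measurable_cyl.
  transitivity (\int[mu]_(y in cyl N (- d) d) (cst 1%E (p y)))%E.
    by rewrite integral_cst ?mul1e//; exact: measurable_cyl.
  rewrite (ge0_integral_cyl dd mN (w := cst 1%E))//.
  by rewrite integral_cst// mul1e N0 mule0.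
move=> y /= /not_implyP[[yO yd] yP]; split => //; apply: hN => /= h.
exact/yP/h.
Qed.

Variables (f nu : 'rV[R]_n.+1 -> 'rV[R]_n.+2).
Variables (Df Dnu : 'rV[R]_n.+1 -> 'M[R]_(n.+1, n.+2)).
Hypothesis pf : forall j, pow_integrable O n.+1 (fun x => f x 0 j).
Hypothesis pnu : forall j, pow_integrable O n.+1 (fun x => nu x 0 j).
Hypothesis pDf : forall i j, pow_integrable O n.+1 (fun x => Df x i j).
Hypothesis pDnu : forall i j, pow_integrable O n.+1 (fun x => Dnu x i j).
Hypothesis wf : weak_gradient O f Df.
Hypothesis wnu : weak_gradient O nu Dnu.

Let int1 g : pow_integrable O n.+1 g -> mu.-integrable O (EFin \o g).
Proof. exact: pow_integrable_integrable. Qed.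

Let intU g : pow_integrable U n.+1 g -> mu.-integrable U (EFin \o g).
Proof. exact: pow_integrable_integrable. Qed.

Definition extension_gradient (y : 'rV[R]_n.+2) : 'M[R]_n.+2 :=
  \matrix_(i, j) oapp (fun i' => Df (p y) i' j + Dnu (p y) i' j * y 0 ord_max)
    (nu (p y) 0 j) (unlift ord_max i).

Local Notation F := (normal_extension f nu).
Local Notation DF := extension_gradient.

Lemma normal_extensionE y j :
  F y 0 j = f (p y) 0 j + nu (p y) 0 j * y 0 ord_max.
Proof. by rewrite /normal_extension !mxE mulrC. Qed.

Lemma pow_integrable_extension j : pow_integrable U n.+1 (fun y => F y 0 j).
Proof.
under eq_fun do rewrite normal_extensionE.
exact: (pow_integrableD mU (pow_integrable_cyl (pf j)) (pow_integrable_cyl_mul (pnu j))).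
Qed.

Lemma pow_integrable_extension_gradient i j : pow_integrable U n.+1 (fun y => DF y i j).
Proof.
under eq_fun do rewrite mxE; case: unliftP => [i' _|_] /=.
  exact: (pow_integrableD mU (pow_integrable_cyl (pDf i' j)) (pow_integrable_cyl_mul (pDnu i' j))).
exact: (pow_integrable_cyl (pnu j)).
Qed.

Lemma weak_gradient_extension : weak_gradient U F DF.
Proof.
move=> i j; under eq_fun do rewrite normal_extensionE.
have i1 := int1 (pf j); have i2 := int1 (pnu j).
have if1 := intU (pow_integrable_cyl (pf j)).
have if2 := intU (pow_integrable_cyl_mul (pnu j)).
case: (unliftP ord_max i) => [i' ->|->].
  under [X in weak_partial _ _ _ X]eq_fun do rewrite mxE liftK/=.
  have i3 := int1 (pDf i' j); have i4 := int1 (pDnu i' j).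
  apply: weak_partialD => //.
  - exact: (intU (pow_integrable_cyl (pDf i' j))).
  - exact: (intU (pow_integrable_cyl_mul (pDnu i' j))).
  - have := weak_partial_cyl_lift dd mO i1 i3 (wf i' j) m1 b1.
    by under eq_fun do rewrite mulr1; under [X in weak_partial _ _ _ X]eq_fun do rewrite mulr1.
  - exact: (weak_partial_cyl_lift dd mO i2 i4 (wnu i' j) (@measurable_id _ _ _) t1).
under [X in weak_partial _ _ _ X]eq_fun do rewrite mxE unlift_none/=.
(* The affine factor is 1 for the summand with [f] and t for the one with [nu]; the derivatives are
   0 and [nu]. *)
have w1 := weak_partial_cyl_last dd mO 1 0 i1.
have w2 := weak_partial_cyl_last dd mO 0 1 i2.
have E1 : (fun y => f (p y) 0 j * (1 + 0 * y 0 ord_max)) = (fun y : 'rV[R]_n.+2 => f (p y) 0 j).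
  by apply/funext => y; rewrite mul0r addr0 mulr1.
have E1' : (fun y => f (p y) 0 j * 0) = (fun y : 'rV[R]_n.+2 => 0).
  by apply/funext => y; rewrite mulr0.
have E2 : (fun y => nu (p y) 0 j * (0 + 1 * y 0 ord_max)) =
    (fun y : 'rV[R]_n.+2 => nu (p y) 0 j * y 0 ord_max).
  by apply/funext => y; rewrite mul1r add0r.
have E2' : (fun y => nu (p y) 0 j * 1) = (fun y : 'rV[R]_n.+2 => nu (p y) 0 j).
  by apply/funext => y; rewrite mulr1.
rewrite E1 E1' in w1; rewrite E2 E2' in w2.
have := weak_partialD mU if1 (intU (pow_integrable0 mU (ltn0Sn n))) if2
  (intU (pow_integrable_cyl (pnu j))) w1 w2.
by under [X in weak_partial _ _ _ X]eq_fun do rewrite add0r.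
Qed.

Lemma W1p_extension : W1p U n.+1%:R F.
Proof.
split; first by move=> j; apply/LpP => //; exact: pow_integrable_extension.
exists DF; first exact: weak_gradient_extension.
by move=> i j; apply/LpP => //; exact: pow_integrable_extension_gradient.
Qed.

Lemma VMO_extension : VMO U F.
Proof.
have [M M0 hM] := cyl_coord.
(* A point outside [U], available because [U] is bounded; [cdist] needs one. *)
pose z0 : 'rV[R]_n.+2 := const_mx (M + 1).
have Uz0 : ~ U z0.
  move=> /hM /(_ ord0); rewrite mxE ger0_norm ?addr_ge0// ?(ltW M0)//.
  by rewrite gerDl ler10.
apply: (vmo_small_osc oU Uz0 Ufin) => j; first exact/intU/pow_integrable_extension.
(* A single function of the base point dominating the j-th column of the gradient: since [|t| <= 1],
   the factor t drops out. *)
pose w x := \sum_i (`|Df x i j| + `|Dnu x i j|) + `|nu x 0 j|.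
have w0 x : 0 <= w x by rewrite addr_ge0// sumr_ge0// => i _; rewrite addr_ge0.
have pw : pow_integrable O n.+1 w.
  apply: pow_integrableD => //; last exact: pow_integrable_norm.
  by apply: pow_integrable_sum => // i; apply: pow_integrableD => //; exact: pow_integrable_norm.
apply: (small_osc_cyl (dh := fun i y => DF y i j) (w := w)) => //.
- exact/intU/pow_integrable_extension.
- by move=> i; exact/intU/pow_integrable_extension_gradient.
- by move=> i; exact: weak_gradient_extension.
- by case: pw.
- case: pw => _; apply: eq_integrable => // x _ /=.
  by rewrite ger0_norm.
- move=> i y [_ yd]; rewrite mxE; case: unliftP => [i' _|_] /=.
    rewrite /w (bigD1 i')//= -addrA (le_trans (ler_normD _ _))// ler_wpDr//.
      by rewrite addr_ge0// sumr_ge0// => k _; rewrite addr_ge0.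
    by rewrite lerD2l normrM ler_piMr// t1.
  by rewrite /w lerDr sumr_ge0// => k _; rewrite addr_ge0.
Qed.

Hypothesis nu1 : {ae mu, forall x, O x -> enorm (nu x) = 1}.

Lemma det_extension_integrable G : weak_gradient U F G ->
  mu.-integrable U (fun y => (\det (G y))%:E).
Proof.
move=> wG.
(* Measurability of an arbitrary weak gradient is part of its local integrability. *)
have mG i j : measurable_fun U (fun y => G y i j) by have [_ []] := wG i j.
(* [nu] is bounded by 1 only almost everywhere, hence the truncation of the last row. *)
pose G1 (y : 'rV[R]_n.+2) : 'M[R]_n.+2 := \matrix_(i, j)
  if i == ord_max then trunc 1 (DF y i j) else DF y i j.
have mDF i j : measurable_fun U (fun y => DF y i j).
  by case: (pow_integrable_extension_gradient i j).
have mG1 i j : measurable_fun U (fun y => G1 y i j).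
  have -> : (fun y => G1 y i j) =
      (fun y => if i == ord_max then trunc 1 (DF y i j) else DF y i j).
    by apply/funext => y; rewrite mxE.
  case: (i == ord_max); last exact: mDF.
  by apply: measurable_maxr => //; exact: measurable_minr.
have iG1 : mu.-integrable U (fun y => (\det (G1 y))%:E).
  apply: integrable_det => // [i j|y j _]; last by rewrite mxE eqxx; exact: trunc_le.
  have [_] := pow_integrable_extension_gradient (lift ord_max i) j.
  apply: eq_integrable => // y _ /=; rewrite [G1 y _ _]mxE.
  by rewrite eq_sym (negbTE (neq_lift _ _)).
have GDF : {ae mu, forall y, forall i j, U y -> G y i j = DF y i j}.
  have one i j := weak_partial_unique oU (wG i j) (weak_gradient_extension i j).
  by apply: filter_forall => i; apply: filter_forall => j; exact: one.
apply: (@integrable_ae_eq _ _ _ (fun y => \det (G y)) _ mU _ iG1); first exact: measurable_det.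
have nuU := ae_cyl nu1.
apply: filterS2 GDF nuU => y GE nE Uy; congr (\det _); apply/matrixP => i j.
rewrite GE// [RHS]mxE; case: eqP => // ->.
rewrite trunc_id// mxE unlift_none/= (le_trans (coord_le_enorm _ _))//.
by rewrite nE.
Qed.

End normal_extension_cylinder.

Theorem claim4p5 (R : realType) (n : nat) (n_gt0 : (0 < n)%N)
    (Omega : set 'rV[R]_n)
    (Omega_bounded : bounded_set Omega) (Omega_open : open Omega)
    (Omega_connected : connected Omega)
    (Omega_smooth : smooth_boundary Omega)
    (f : 'rV[R]_n -> 'rV[R]_n.+1) (Df : 'rV[R]_n -> 'M[R]_(n, n.+1))
    (f_W1n : W1p Omega n%:R f) (Df_grad : weak_gradient Omega f Df)
    (Df_rank : {ae lebesgue_rV n, forall x, Omega x -> \rank (Df x) = n})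
    (nu : 'rV[R]_n -> 'rV[R]_n.+1)
    (nu_normal : unit_normal Omega Df nu)
    (nu_W1n : W1p Omega n%:R nu) :
  exists d : R,
    0 < d < 1 /\
    let U := cylinder Omega d in
    let F := normal_extension f nu in
    [/\ VMO U F, W1p U n%:R F &
        forall DF : 'rV[R]_n.+1 -> 'M[R]_n.+1,
          weak_gradient U F DF ->
          (lebesgue_rV n.+1).-integrable U (fun y => (\det (DF y))%:E)].
Proof.
clear Omega_connected Omega_smooth Df_grad Df_rank.
case: n n_gt0 Omega Omega_bounded Omega_open f Df f_W1n nu nu_normal nu_W1n => // n _ O bO oO f Df [Lf [Df' wf LDf]] nu normal
  [Lnu [Dnu wnu LDnu]].
have mO := measurable_open_rV oO.
exists 2^-1; split; first by rewrite invr_gt0 ltr0n invf_lt1// ltr1n.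
have d1 : 0 < (2^-1 : R) <= 1 by rewrite invr_gt0 ltr0n invf_le1// ler1n.
have pf j := (LpP n.+1 _ mO).1 (Lf j); have pnu j := (LpP n.+1 _ mO).1 (Lnu j).
have pDf i j := (LpP n.+1 _ mO).1 (LDf i j); have pDnu i j := (LpP n.+1 _ mO).1 (LDnu i j).
split.
- exact: (VMO_extension oO bO d1 pf pnu pDf pDnu wf wnu).
- exact: (W1p_extension oO bO d1 pf pnu pDf pDnu wf wnu).
- apply: (det_extension_integrable oO bO d1 pf pnu pDf pDnu wf wnu).
  by apply: filterS normal => x h Ox; have [] := h Ox.
Qed.
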